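(* Let $G=\langle h_1,\ldots,h_m\rangle\in\mathcal{G}_{dis}$ be a polynomial semigroup with $m\geq3$, and write $\hat{\mathcal{J}}=\hat{\mathcal{J}}_G$. Suppose that there exists an element $J_0\in\hat{\mathcal{J}}$ such that $\bigcup_{j=1}^{m-1}J(h_j)\subset J_0$, and such that for each $j=1,\ldots,m-1$ we have $h_j^{-1}(J(h_m))\cap J_0\neq\emptyset$. Then all of the following hold. 1. $\sharp(\hat{\mathcal{J}})=\aleph_0$. 2. $J_0=J_{\min}$, or $J_0=J_{\max}$. 3. If $J_0=J_{\min}$, then $J_{\max}=J(h_m)$, $J(G)=J_{\max}\cup\bigcup_{n\in\mathbb{N}\cup\{0\}}(h_m)^{-n}(J_{\min})$, and for any $J\in\hat{\mathcal{J}}$ with $J\neq J_{\max}$, there exists no sequence $\{C_j\}_{j\in\mathbb{N}}$ of mutually distinct elements of $\hat{\mathcal{J}}$ such that $\min_{z\in C_j}d(z,J)\to0$ as $j\to\infty$. 4. If $J_0=J_{\max}$, then $J_{\min}=J(h_m)$, $J(G)=J_{\min}\cup\bigcup_{n\in\mathbb{N}\cup\{0\}}(h_m)^{-n}(J_{\max})$, and for any $J\in\hat{\mathcal{J}}$ with $J\neq J_{\min}$, there exists no sequence $\{C_j\}_{j\in\mathbb{N}}$ of mutually distinct elements of $\hat{\mathcal{J}}$ such that $\min_{z\in C_j}d(z,J)\to0$ as $j\to\infty$.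
   Context: $\hat{\mathbb{C}}$ is the Riemann sphere with spherical distance $d$, and $d(z,A)=\inf_{w\in A}d(z,w)$. A polynomial semigroup is a semigroup, under composition, generated by a non-empty family of non-constant polynomial maps $\hat{\mathbb{C}}\to\hat{\mathbb{C}}$; $\langle h_1,\ldots,h_m\rangle$ is the semigroup generated by $h_1,\ldots,h_m$. The Fatou set $F(G)$ is the set of $z\in\hat{\mathbb{C}}$ having a neighborhood on which $G$ is a normal family; the Julia set is $J(G)=\hat{\mathbb{C}}\setminus F(G)$; for a single map $g$, $J(g)=J(\langle g\rangle)$. $CV(g)$ is the set of critical values of $g:\hat{\mathbb{C}}\to\hat{\mathbb{C}}$, $P(G)=\overline{\bigcup_{g\in G}CV(g)}$ (closure in $\hat{\mathbb{C}}$), and $P^{\ast}(G)=P(G)\setminus\{\infty\}$. $\mathcal{G}$ is the set of all polynomial semigroups $G$ such that each element of $G$ has degree at least two and $P^{\ast}(G)$ is bounded in $\mathbb{C}$; $\mathcal{G}_{dis}$ is the set of $G\in\mathcal{G}$ with $J(G)$ disconnected. $\hat{\mathcal{J}}_G$ is the set of all connected components of $J(G)$; for $G\in\mathcal{G}_{dis}$ all of them are contained in $\mathbb{C}$. Surrounding order: for connected sets $K_1,K_2\subset\mathbb{C}$, $K_1\leq K_2$ means that $K_1=K_2$ or $K_1$ is included in a bounded component of $\mathbb{C}\setminus K_2$. For $G\in\mathcal{G}_{dis}$, $J_{\min}=J_{\min}(G)$ and $J_{\max}=J_{\max}(G)$ denote the (existing, unique) elements of $\hat{\mathcal{J}}_G$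 with $J_{\min}\leq J\leq J_{\max}$ for all $J\in\hat{\mathcal{J}}_G$. $(h_m)^{-n}$ denotes the preimage under the $n$-th iterate of $h_m$. *)

(* Defs.v *)
From HB Require Import structures.
From mathcomp Require Import all_boot all_order all_algebra.
From mathcomp Require Import all_classical all_reals all_analysis.
From mathcomp Require Import complex.

Set Implicit Arguments.
Unset Strict Implicit.
Unset Printing Implicit Defensive.

Import Order.TTheory GRing.Theory Num.Theory numFieldNormedType.Exports.

Local Open Scope classical_set_scope.
Local Open Scope ring_scope.
Local Open Scope complex_scope.

(* [R[i]] carries no topology by itself; [R[i]^o] is the complex line as a
   normed space over itself. In the one-point compactification, a finite point
   [c] is [Some c] and the point at infinity is [None]. *)
Notation Cplane R := (R[i]^o) (only parsing).
Notation sphere R := (one_point_compactification R[i]^o).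

Section PolynomialSemigroups.
Context {R : realType}.
Local Notation C := (Cplane R).
Local Notation Chat := (sphere R).
Implicit Types (z w a : Chat) (f g : Chat -> Chat) (G S : set (Chat -> Chat)).
Implicit Types (J K U A B : set Chat).

Definition modulus (c : R[i]) : R := complex.Re `|c|.

(* Euclidean distance in R^3 between the images of [z] and [w] on the unit
   sphere under stereographic projection. *)
Definition chordal_dist z w : R :=
  match z, w with
  | Some c, Some c' =>
      2 * modulus (c - c')
        / (Num.sqrt (1 + modulus c ^+ 2) * Num.sqrt (1 + modulus c' ^+ 2))
  | Some c, None | None, Some c => 2 / Num.sqrt (1 + modulus c ^+ 2)
  | None, None => 0
  end.

(* Great-circle distance on the unit sphere. *)
Definition sph_dist z w : R := 2 * asin (chordal_dist z w / 2).

Definition dist_to_set z A : R := inf [set sph_dist z w | w in A].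

(* On components of a Julia set, which are compact, this infimum over [B] is
   attained. *)
Definition min_dist B A : R := inf [set dist_to_set z A | z in B].

(* The map of the sphere induced by a non-constant polynomial. *)
Definition poly_ext (p : {poly R[i]}) z : Chat :=
  if z is Some c then Some (p.[c] : C) else None.

Definition poly_map_of_degree (d : nat) f :=
  exists2 p : {poly R[i]}, size p = d.+1 & f = poly_ext p.

Definition nonconstant_poly_map f :=
  exists2 d : nat, (1 <= d)%N & poly_map_of_degree d f.

Definition comp_closed G := forall f g, G f -> G g -> G (f \o g).

Definition semigroup_gen S : set (Chat -> Chat) := smallest comp_closed S.

Definition polynomial_semigroup G :=
  exists S, [/\ S !=set0, S `<=` nonconstant_poly_map & G = semigroup_gen S].

(* Every sequence in [G] has a subsequence converging, with respect to the
   spherical distance, uniformly on every compact subset of [U]. *)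
Definition normal_on G U :=
  forall u : nat -> Chat -> Chat, (forall k, G (u k)) ->
  exists s : nat -> nat, {homo s : i j / (i < j)%N} /\
  exists l : Chat -> Chat, forall K, compact K -> K `<=` U ->
  forall e : R, 0 < e ->
  exists N : nat, forall k, (N <= k)%N ->
  forall z, K z -> sph_dist (u (s k) z) (l z) < e.

Definition Fatou G : set Chat :=
  [set z | exists2 U, open_nbhs z U & normal_on G U].

Definition Julia G : set Chat := ~` Fatou G.

Definition Julia_map g : set Chat := Julia (semigroup_gen [set g]).

(* z |-> 1/z on the sphere *)
Definition sphere_inv z : Chat :=
  match z with
  | Some c => if c == 0 then None else Some (c^-1 : C)
  | None => Some (0 : C)
  end.

(* Coordinates around a point [a]: the affine one if [a] is finite, and 1/z if
   [a] is infinity. The value [0] of [affine_coord] at infinity is junk, away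
   from the base point. *)
Definition affine_coord z : C := if z is Some c then c else 0.

Definition coord a z : C :=
  if a is Some _ then affine_coord z else affine_coord (sphere_inv z).

Definition coord_inv a (c : C) : Chat :=
  if a is Some _ then Some c else sphere_inv (Some c).

Definition critical_point f a :=
  is_derive (coord a a) (1 : C) (coord (f a) \o f \o coord_inv a) (0 : C).

Definition critical_values f : set Chat := f @` critical_point f.

Definition postcritical G : set Chat :=
  closure (\bigcup_(g in G) critical_values g).

Definition postcritical_star G : set C := Some @^-1` postcritical G.

Definition calG G :=
  [/\ polynomial_semigroup G,
      forall g, G g -> exists2 d : nat, (2 <= d)%N & poly_map_of_degree d g
    & bounded_set (postcritical_star G)].

Definition calG_dis G := calG G /\ ~ connected (Julia G).

Definition Julia_components G : set (set Chat) :=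
  [set connected_component (Julia G) z | z in Julia G].

Definition surround_le (K1 K2 : set C) :=
  K1 = K2 \/
  exists c : C, [/\ (~` K2) c, bounded_set (connected_component (~` K2) c)
                  & K1 `<=` connected_component (~` K2) c].

(* The components of J(G) lie in the plane when G is in [calG_dis]. *)
Definition component_le K1 K2 := surround_le (Some @^-1` K1) (Some @^-1` K2).

(* For G in [calG_dis] the least and the greatest component exist and are
   unique, so [get] returns them. *)
Definition Jmin G : set Chat :=
  get [set J | Julia_components G J /\
               forall J', Julia_components G J' -> component_le J J'].

Definition Jmax G : set Chat :=
  get [set J | Julia_components G J /\
               forall J', Julia_components G J' -> component_le J' J].

Definition approached_by_components G J :=
  exists D : nat -> set Chat,
    [/\ injective D, forall j, Julia_components G (D j)
      & (fun j => min_dist (D j) J) @ \oo --> (0 : R)].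

End PolynomialSemigroups.

(* Main.v *)
Require Import Defs.
From HB Require Import structures.
From mathcomp Require Import all_boot all_order all_algebra.
From mathcomp Require Import all_classical all_reals all_analysis.
From mathcomp Require Import complex ring lra zify cyclic separable cyclotomic.

Set Implicit Arguments.
Unset Strict Implicit.
Unset Printing Implicit Defensive.

Import Order.TTheory GRing.Theory Num.Theory numFieldNormedType.Exports.

Local Open Scope classical_set_scope.
Local Open Scope ring_scope.

(* All generators fix infinity and escape outside a large disc, so everything
   happens in the plane. As critical values of words stay bounded, the sets
   {|P| <= r} and {|P| = r} are connected for every word P, and so are their
   decreasing limits P^-1(K(h_i)) and P^-1(J(h_i)). All the filled sets
   P^-1(K(h_i)) share a point (any critical value of a generator), which forces
   any two of these continua that do not meet to be nested.

   If J0 met J(h_m), then J0 would be backward invariant and J(G) connected.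
   Hence J0 lies outside K(h_m) or in its interior, and in both cases an
   induction on words gives P^-1(J(h_m)) inside J0 whenever the letter of P that
   is applied first is not h_m. So J(G) is the closure of the union of J(h_m)
   and the pairwise disjoint connected sets h_m^-n(J0). These accumulate only on
   J(h_m): outside K(h_m) by the attraction of infinity, inside by the
   absorption of orbits into the filled set of another generator.

   The only analytic input is Montel's theorem for polynomials avoiding a Julia
   set: composed with a high iterate such a polynomial has modulus at least 1 on
   a disc, and the Harnack inequality for log|f| bounds it after taking roots. *)

(** * Topology of the complex line in terms of the modulus *)

Section Modulus.
Context {R : realType}.
Implicit Types (z w : R[i]).
Local Notation C := (R[i]^o).
Local Open Scope complex_scope.

(** The induction on words turns on two inclusions. Put S = P_w^-1(K(h_m)). If S lies in h_j^-1(S),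
    then S is bounded and forward invariant, hence inside K(h_j). If h_j^-1(S) lies in S, a disc off
    S has all its h_j-iterates off S, and Montel's theorem leaves no point of J(h_j) there, so
    J(h_j) lies in S. A wrong position of J0 forces one of these inclusions, and its conclusion
    contradicts J(h_j) being inside J0, or the position of J0 relative to K(h_m).

    J(G) is the closure of the preimages of J(h_i) for whichever i: i = m produces the layers
    h_m^-n(J0), while one fixed generator h_j1 other than h_m supplies comparison sets K(h_j1),
    whose boundary lies in J0.

    No plane separation theorem or degree count is used. Absence of holes is the maximum principle
    in the form [full]. A lemniscate is connected because a separation of it would propagate through
    the higher levels, free of critical points, to the connected set {l <= |f|}. Boundedness in
    [surround_le] comes from the compact filled sets. *)

Lemma norm_modulus z : `|z| = (modulus z)%:C.
Proof. by rewrite /modulus normc_def. Qed.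

Lemma modulus_ge0 z : 0 <= modulus z.
Proof. by rewrite -ler0c -norm_modulus normr_ge0. Qed.

Lemma modulusM z w : modulus (z * w) = modulus z * modulus w.
Proof. by apply: complexI; rewrite rmorphM /= -!norm_modulus normrM. Qed.

Lemma modulus0 : modulus (0 : R[i]) = 0.
Proof. by apply: complexI; rewrite -norm_modulus normr0. Qed.

Lemma modulus1 : modulus (1 : R[i]) = 1.
Proof. by apply: complexI; rewrite -norm_modulus normr1. Qed.

Lemma modulus_eq0 z : (modulus z == 0) = (z == 0).
Proof. by rewrite -(inj_eq (@complexI R)) -norm_modulus normr_eq0. Qed.

Lemma modulus_gt0 z : (0 < modulus z) = (z != 0).
Proof. by rewrite lt_def modulus_ge0 andbT modulus_eq0. Qed.

Lemma modulusD z w : modulus (z + w) <= modulus z + modulus w.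
Proof. by rewrite -lecR rmorphD /= -!norm_modulus ler_normD. Qed.

Lemma modulusN z : modulus (- z) = modulus z.
Proof. by apply: complexI; rewrite -!norm_modulus normrN. Qed.

Lemma modulusBC z w : modulus (z - w) = modulus (w - z).
Proof. by rewrite -modulusN opprB. Qed.

Lemma modulusX z n : modulus (z ^+ n) = modulus z ^+ n.
Proof. by apply: complexI; rewrite rmorphXn /= -!norm_modulus normrX. Qed.

Lemma modulusV z : modulus z^-1 = (modulus z)^-1.
Proof. by apply: complexI; rewrite fmorphV /= -!norm_modulus normfV. Qed.

Lemma modulus_real (x : R) : modulus x%:C = `|x|.
Proof. by rewrite /modulus normc_def /= expr0n /= addr0 sqrtr_sqr. Qed.

Lemma modulus_nat n : modulus (n%:R : R[i]) = n%:R.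
Proof. by rewrite -(rmorph_nat (real_complex R)) modulus_real normr_nat. Qed.

Lemma le_modulusB z w : modulus z - modulus w <= modulus (z - w).
Proof. by rewrite lerBlDr -{1}(subrK w z) modulusD. Qed.

Lemma le_modulusBD z w : modulus (z - w) <= modulus z + modulus w.
Proof. by rewrite -(modulusN w) modulusD. Qed.

Lemma modulus_dist u z w : modulus (z - w) <= modulus (z - u) + modulus (u - w).
Proof. by rewrite -{1}(subrK u z) -addrA modulusD. Qed.

Lemma modulus_prod (I : Type) (s : seq I) (F : I -> R[i]) :
  modulus (\prod_(i <- s) F i) = \prod_(i <- s) modulus (F i).
Proof. exact: (big_morph _ modulusM modulus1). Qed.

Lemma modulus_sum (I : Type) (s : seq I) (F : I -> R[i]) :
  modulus (\sum_(i <- s) F i) <= \sum_(i <- s) modulus (F i).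
Proof.
elim/big_rec2: _ => [|i x y _ h]; first by rewrite modulus0.
by rewrite (le_trans (modulusD _ _)) // lerD2l.
Qed.

Lemma modulus_Re z : `|complex.Re z| <= modulus z.
Proof. by have := normc_ge_Re z; rewrite norm_modulus lecR. Qed.

Lemma modulus_i : modulus ('i : R[i]) = 1.
Proof. by rewrite /modulus normc_def /= expr0n expr1n add0r sqrtr1. Qed.

Lemma modulus_Im z : `|complex.Im z| <= modulus z.
Proof.
by have := modulus_Re (z * 'i); rewrite ReiNIm normrN modulusM modulus_i mulr1.
Qed.

Lemma modulus_le z : modulus z <= `|complex.Re z| + `|complex.Im z|.
Proof.
by rewrite {1}(complexE z) (le_trans (modulusD _ _)) // modulusM !modulus_real modulus_i mul1r.
Qed.

Lemma nbhsC z (A : set C) : nbhs (z : C) A <->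
  exists2 r : R, 0 < r & forall w, modulus (w - z) < r -> A w.
Proof.
split=> [/nbhs_ballP[e /= e0 h]|[r r0 h]].
  have ee : e = (complex.Re e)%:C by rewrite RRe_real // realE ltW.
  exists (complex.Re e); first by rewrite -ltcR -ee.
  move=> w hw; apply: h; rewrite /ball /= -[w]/(w : R[i]).
  by rewrite ee norm_modulus ltcR modulusBC.
apply/nbhs_ballP; exists r%:C; first by rewrite /= ltcR.
by move=> w; rewrite /ball /= norm_modulus ltcR modulusBC; apply: h.
Qed.

Lemma openC (A : set C) : open A <-> forall z, A z ->
  exists2 r : R, 0 < r & forall w, modulus (w - z) < r -> A w.
Proof.
rewrite openE; split=> [h z /h|h z Az]; first by move=> /nbhsC.
by apply/nbhsC; exact: h.
Qed.

Lemma closedC (A : set C) : closed A <-> forall z, ~ A z ->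
  exists2 r : R, 0 < r & forall w, modulus (w - z) < r -> ~ A w.
Proof.
split=> [/closed_openC/openC//|h].
by rewrite -[A]setCK; apply: open_closedC; apply/openC.
Qed.

Lemma closureC (A : set C) z : closure A z <->
  forall r : R, 0 < r -> exists2 w, A w & modulus (w - z) < r.
Proof.
split=> [h r r0|h B /nbhsC[r r0 rB]].
  have [w [Aw Bw]] := h [set w : C | modulus (w - z) < r] ltac:(by apply/nbhsC; exists r).
  by exists w.
by have [w Aw wr] := h r r0; exists w; split=> //; apply: rB.
Qed.

Lemma continuousC (f : C -> C) : continuous f <-> forall z (e : R), 0 < e ->
  exists2 r : R, 0 < r & forall w, modulus (w - z) < r -> modulus (f w - f z) < e.
Proof.
split=> [h z e e0|h z B /nbhsC[e e0 eB]].
  have /nbhsC[r r0 hr] := h z [set w : C | modulus (w - f z) < e] ltac:(by apply/nbhsC; exists e).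
  by exists r.
by have [r r0 hr] := h z e e0; apply/nbhsC; exists r => // w /hr/eB.
Qed.

Definition disc z (r : R) : set C := [set w | modulus (w - z) < r].
Definition cdisc z (r : R) : set C := [set w | modulus (w - z) <= r].

Lemma open_disc z r : open (disc z r).
Proof.
apply/openC => w; rewrite /disc /= => wr; exists (r - modulus (w - z)).
  by rewrite subr_gt0.
by move=> v; rewrite ltrBrDr; apply: le_lt_trans; exact: modulus_dist.
Qed.

Lemma closed_cdisc z r : closed (cdisc z r).
Proof.
apply/closedC => w; rewrite /cdisc /= => /negP; rewrite -ltNge => wr.
exists (modulus (w - z) - r); first by rewrite subr_gt0.
move=> v vw; apply/negP; rewrite -ltNge.
have := modulus_dist v w z; rewrite (modulusBC w v) => h; lra.
Qed.

Lemma nbhs_disc z r : 0 < r -> nbhs (z : C) (disc z r).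
Proof. by move=> r0; apply/nbhsC; exists r. Qed.

Lemma modulus_continuous : continuous (modulus : C -> R).
Proof.
move=> z B /nbhs_ballP[e /= e0 eB]; apply/nbhsC; exists e => // w wz.
apply: eB; rewrite /ball /= ltr_norml; apply/andP; split.
  by rewrite ltrNl opprB (le_lt_trans (le_modulusB _ _)).
by rewrite (le_lt_trans (le_modulusB _ _)) // modulusBC.
Qed.

Lemma mkC_continuous : continuous ((fun x : R * R => (x.1 +i* x.2)) : R * R -> C).
Proof.
move=> [a b] B /nbhsC[e e0 eB]; have e20 : 0 < e / 2 by rewrite divr_gt0.
apply: (filterS (P := (ball a (e/2) `*` ball b (e/2)))).
  move=> [c d] [/= ca db]; apply: eB.
  apply: (le_lt_trans (modulus_le _)) => /=.
  by rewrite distrC (distrC d) (splitr e) ltrD.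
by exists (ball a (e/2), ball b (e/2)) => //=; split; apply: nbhsx_ballx.
Qed.

Lemma compact_closed_bounded (A : set C) M :
  closed A -> (forall z, A z -> modulus z <= M) -> compact A.
Proof.
move=> cA bA.
pose B := (fun x : R * R => (x.1 +i* x.2)) @` (`[-M, M]%classic `*` `[-M, M]%classic) : set C.
apply: (subclosed_compact cA (B := B)).
  apply: continuous_compact; first exact/continuous_subspaceT/mkC_continuous.
  by apply: compact_setX; apply: segment_compact.
move=> z Az; exists (complex.Re z, complex.Im z) => /=; last by case: (z).
split; rewrite /= in_itv /= -ler_norml.
  exact: le_trans (modulus_Re _) (bA _ Az).
exact: le_trans (modulus_Im _) (bA _ Az).
Qed.

Lemma hausdorffC : hausdorff_space C.
Proof. exact: norm_hausdorff. Qed.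

Lemma compact_modulus_le (A : set C) : compact A -> exists M, forall z, A z -> modulus z <= M.
Proof.
move=> cA; have [->|/set0P A0] := eqVneq A set0; first by exists 0.
have [c _ hc] := compact_EVT_max A0 cA (continuous_subspaceT modulus_continuous).
by exists (modulus c) => z Az; apply: hc; rewrite inE.
Qed.

Lemma compact_cdisc z r : compact (cdisc z r).
Proof.
apply: (@compact_closed_bounded _ (r + modulus z)); first exact: closed_cdisc.
by move=> w; rewrite /cdisc /= -lerBlDr; apply: le_trans; exact: le_modulusB.
Qed.

Lemma compact_cluster_seq (A : set C) (u : nat -> C) :
  compact A -> (forall k, A (u k)) ->
  exists2 z, A z & forall (e : R), 0 < e -> forall N, exists2 k, (N <= k)%N & modulus (u k - z) < e.
Proof.
move=> cA Au; have h0 : (u @ \oo) A by exists 0%N => // k _; exact: Au.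
have [z [Az cz]] := cA (u @ \oo) _ h0.
exists z => // e e0 N.
have h1 : (u @ \oo) (u @` [set k | (N <= k)%N]) by exists N => // k /= Nk; exists k.
by have [w [[k /= Nk <-] we]] := cz _ _ h1 (nbhs_disc z e0); exists k.
Qed.

Lemma connected_segmentC z w : connected ([set z + t%:C * (w - z) | t in `[0, 1]] : set C).
Proof.
apply: connected_continuous_connected; first exact: segment_connected.
apply: continuous_subspaceT => t B /nbhsC[e e0 eB].
have m0 : 0 < 1 + modulus (w - z) by rewrite ltr_wpDr // modulus_ge0.
apply/nbhs_ballP; exists (e / (1 + modulus (w - z))); first by rewrite /= divr_gt0.
move=> s; rewrite /ball /= => st; apply: eB.
have -> : z + s%:C * (w - z) - (z + t%:C * (w - z)) = (s - t)%:C * (w - z).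
  by rewrite rmorphB /=; ring.
rewrite modulusM modulus_real distrC; move: st; rewrite ltr_pdivlMr // mulrDr mulr1.
by apply: le_lt_trans; rewrite lerDr.
Qed.

Lemma connected_convex (A : set C) :
  (forall z w t, A z -> A w -> 0 <= t <= 1 -> A (z + t%:C * (w - z))) -> connected A.
Proof.
move=> h; have [->|/set0P[z0 Az0]] := eqVneq A set0; first exact: connected0.
have -> : A = \bigcup_(w in A) [set z0 + t%:C * (w - z0) | t in `[0, 1]].
  apply/seteqP; split=> [w Aw|w [v Av [t /= t01 <-]]]; last by apply: h; rewrite -?in_itv.
  exists w => //; exists 1; first by rewrite /= in_itv /= ler01 lexx.
  by rewrite rmorph1 mul1r addrC subrK.
apply: bigcup_connected => [|w _]; last exact: connected_segmentC.
exists z0 => w Aw; exists 0; first by rewrite /= in_itv /= lexx ler01.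
by rewrite mul0r addr0.
Qed.

Lemma modulus_convex z w c t : 0 <= t <= 1 ->
  modulus (z + t%:C * (w - z) - c) <= (1 - t) * modulus (z - c) + t * modulus (w - c).
Proof.
case/andP=> t0 t1; have -> : z + t%:C * (w - z) - c = (1 - t)%:C * (z - c) + t%:C * (w - c).
  by rewrite rmorphB /=; ring.
by rewrite (le_trans (modulusD _ _)) // !modulusM !modulus_real !ger0_norm // subr_ge0.
Qed.

Lemma connected_disc z r : connected (disc z r).
Proof.
apply: connected_convex => u v t; rewrite /disc /= => ur vr t01.
apply: (le_lt_trans (modulus_convex _ _ _ t01)); case/andP: t01 => t0 t1.
have [h|h] := leP (modulus (u - z)) (modulus (v - z)); nra.
Qed.

End Modulus.

(** * Polynomials as open and closed maps *)

Section Polynomials.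
Context {R : realType}.
Implicit Types (z w : R[i]) (p q : {poly R[i]}).
Local Notation C := (R[i]^o).
Local Open Scope complex_scope.

Definition pfun p : C -> C := fun z => p.[z].

(** Splitting [p - w] into linear factors is the one algebraic input: openness, closedness,
    properness and growth of polynomials all come from this product of distances. *)
Lemma modulus_poly_roots p w : (1 < size p)%N ->
  exists2 s : seq R[i], size s = (size p).-1 &
  forall z, modulus (p.[z] - w) = modulus (lead_coef p) * \prod_(a <- s) modulus (z - a).
Proof.
move=> sp; have [s hs] := closed_field_poly_normal (p - w%:P).
have sw : (size (- w%:P) < size p)%N.
  by rewrite size_polyN (leq_ltn_trans (size_polyC_leq1 w)).
have slc : lead_coef (p - w%:P) = lead_coef p by rewrite lead_coefDl.
have ssz : size (p - w%:P) = size p by rewrite size_polyDl.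
rewrite slc in hs.
have lc0 : lead_coef p != 0 by rewrite lead_coef_eq0 -size_poly_gt0; apply: ltn_trans sp.
exists s.
  by rewrite -ssz hs size_scale // size_prod_XsubC.
move=> z; rewrite -[p.[z] - w]/(_) .
have -> : p.[z] - w = (p - w%:P).[z] by rewrite hornerD hornerN hornerC.
rewrite hs hornerZ modulusM horner_prod modulus_prod; congr (_ * _).
by apply: eq_bigr => a _; rewrite hornerXsubC.
Qed.

Lemma modulus_lead_gt0 p : (1 < size p)%N -> 0 < modulus (lead_coef p).
Proof.
by move=> sp; rewrite modulus_gt0 lead_coef_eq0 -size_poly_gt0; apply: ltn_trans sp.
Qed.

Lemma prod_lt_exists (s : seq R[i]) z r : 0 <= r ->
  \prod_(a <- s) modulus (z - a) < r ^+ size s ->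
  exists2 a, a \in s & modulus (a - z) < r.
Proof.
move=> r0; elim: s => [|a s IH]; first by rewrite big_nil expr0 ltxx.
rewrite big_cons /= exprS; have [za _|za] := ltP (modulus (z - a)) r.
  by exists a; rewrite ?mem_head // modulusBC.
move=> h; have [|b bs br] := IH; last by exists b; rewrite ?in_cons ?bs ?orbT.
rewrite ltNge; apply/negP => h2; move: h; rewrite ltNge => /negP; apply.
by apply: ler_pM => //; rewrite exprn_ge0.
Qed.

(** A quantitative open mapping theorem: when the product of the distances from [z] to the roots of
    [p - w] is below [r ^ deg p], some factor is below [r]. *)
Lemma root_near p z w r : (1 < size p)%N -> 0 <= r ->
  modulus (p.[z] - w) < modulus (lead_coef p) * r ^+ (size p).-1 ->
  exists2 y, p.[y] = w & modulus (y - z) < r.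
Proof.
move=> sp r0; have [s ss hs] := modulus_poly_roots w sp.
rewrite hs ltr_pM2l ?modulus_lead_gt0 // -ss => /prod_lt_exists[//|a as_ ar].
exists a => //; apply/eqP; rewrite -subr_eq0 -modulus_eq0 hs mulf_eq0; apply/orP; right.
by rewrite (big_rem a) //= subrr modulus0 mul0r.
Qed.

Lemma horner_surj p w : (1 < size p)%N -> exists z, p.[z] = w.
Proof.
move=> sp; have l0 := modulus_lead_gt0 sp.
(* As [r >= 1] and [|lead| * r] exceeds [|p(0) - w|], so does [|lead| * r ^ deg p], and [root_near]
   applies at [0]. *)
pose r := (modulus (p.[0] - w) + 1) / modulus (lead_coef p) + 1.
have r1 : 1 <= r by rewrite lerDr divr_ge0 ?(ltW l0) // addr_ge0 ?modulus_ge0.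
have [||y hy _] := @root_near p 0 w r sp; [lra| |by exists y].
apply: (@lt_le_trans _ _ (modulus (lead_coef p) * r)).
  rewrite /r mulrDr mulrC divfK ?gt_eqF // mulr1.
  by have := modulus_ge0 (p.[0] - w); lra.
rewrite ler_pM2l // -{1}(expr1 r) ler_weXn2l //; lia.
Qed.

Lemma open_horner p (A : set C) : (1 < size p)%N -> open A -> open (pfun p @` A).
Proof.
move=> sp /openC oA; apply/openC => _ [z Az <-].
have [r r0 rA] := oA _ Az.
exists (modulus (lead_coef p) * r ^+ (size p).-1).
  by rewrite mulr_gt0 ?exprn_gt0 ?modulus_lead_gt0.
move=> w; rewrite modulusBC => /root_near[//||y <- yz]; first exact: ltW.
by exists y => //; apply: rA.
Qed.

(** If [w] is not a value on [A], the finitely many roots of [p - w] keep a common distance [r] from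
    [A]; a value on [A] close to [w] would need a point of [A] within [r] of a root. *)
Lemma closed_horner p (A : set C) : (1 < size p)%N -> closed A -> closed (pfun p @` A).
Proof.
move=> sp /closedC cA; apply/closedC => w nw.
have [s ss hs] := modulus_poly_roots w sp.
have sr a : a \in s -> p.[a] = w.
  move=> as_; apply/eqP; rewrite -subr_eq0 -modulus_eq0 hs mulf_eq0; apply/orP; right.
  by rewrite (big_rem a) //= subrr modulus0 mul0r.
have [r r0 hr] : exists2 r : R, 0 < r & forall a, a \in s -> forall z, modulus (z - a) < r -> ~ A z.
  have: forall a, a \in s -> ~ A a by move=> a /sr pa Aa; apply: nw; exists a.
  elim: (s) => [|a t IH] h; first by exists 1.
  have [r1 r10 h1] := IH (fun b bt => h b (@mem_behead _ (a :: t) _ bt)).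
  have [r2 r20 h2] := cA a (h a (mem_head _ _)).
  exists (Num.min r1 r2); first by rewrite lt_min r10.
  move=> b; rewrite in_cons => /orP[/eqP->|bt] z; rewrite lt_min => /andP[z1 z2].
    exact: h2.
  exact: h1 bt _ z1.
exists (modulus (lead_coef p) * r ^+ (size p).-1).
  by rewrite mulr_gt0 ?exprn_gt0 ?modulus_lead_gt0.
move=> v hv [z Az pz]; move: hv; rewrite -pz hs -ss ltr_pM2l ?modulus_lead_gt0 //.
by move=> /prod_lt_exists[|a as_ ar]; [exact: ltW|apply: (hr a as_ z) => //; rewrite modulusBC].
Qed.

Lemma horner_bounded p (M : R) : exists2 B, 0 <= B & forall z, modulus z <= M -> modulus p.[z] <= B.
Proof.
elim/poly_ind: p => [|p c [B B0 hB]].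
  by exists 0 => // z _; rewrite horner0 modulus0.
exists (B * `|M| + modulus c); first by rewrite addr_ge0 ?mulr_ge0 ?modulus_ge0.
move=> z zM; rewrite hornerMXaddC (le_trans (modulusD _ _)) // lerD2r modulusM.
by rewrite ler_pM ?modulus_ge0 ?hB // (le_trans zM) ?ler_norm.
Qed.

Lemma horner_lipschitz p (M : R) : exists2 L, 0 <= L & forall z w,
  modulus z <= M -> modulus w <= M -> modulus (p.[z] - p.[w]) <= L * modulus (z - w).
Proof.
elim/poly_ind: p => [|p c [L L0 hL]].
  by exists 0 => // z w _ _; rewrite !horner0 subrr modulus0 mul0r.
have [B B0 hB] := horner_bounded p M.
exists (L * `|M| + B); first by rewrite addr_ge0 ?mulr_ge0.
move=> z w zM wM; rewrite !hornerMXaddC.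
have -> : p.[z] * z + c - (p.[w] * w + c) = (p.[z] - p.[w]) * z + p.[w] * (z - w) by ring.
rewrite (le_trans (modulusD _ _)) // !modulusM mulrDl lerD //; last first.
  by rewrite ler_wpM2r ?modulus_ge0 ?hB.
rewrite mulrAC; apply: ler_pM; rewrite ?modulus_ge0 ?hL //.
by rewrite (le_trans zM) ?ler_norm.
Qed.

Lemma horner_taylor p (M : R) : exists2 L, 0 <= L & forall z h,
  modulus z <= M -> modulus h <= 1 ->
  modulus (p.[z + h] - p.[z] - h * p^`().[z]) <= L * modulus h ^+ 2.
Proof.
elim/poly_ind: p => [|p c [L L0 hL]].
  by exists 0 => // z h _ _; rewrite deriv0 !horner0 mulr0 !subr0 modulus0 mul0r.
have [B B0 hB] := horner_bounded p^`() M.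
exists (L * (`|M| + 1) + B); first by rewrite addr_ge0 ?mulr_ge0 ?addr_ge0.
move=> z h zM h1; rewrite derivMXaddC hornerD hornerMX !hornerMXaddC.
have -> : p.[z + h] * (z + h) + c - (p.[z] * z + c) - h * (p.[z] + p^`().[z] * z) =
  (p.[z + h] - p.[z] - h * p^`().[z]) * (z + h) + p^`().[z] * h ^+ 2 by ring.
rewrite (le_trans (modulusD _ _)) // (modulusM _ (z + h)) (modulusM p^`().[z]) modulusX mulrDl lerD //; last first.
  by rewrite ler_wpM2r ?exprn_ge0 ?modulus_ge0 ?hB.
rewrite mulrAC; apply: ler_pM; rewrite ?modulus_ge0 ?hL //.
rewrite (le_trans (modulusD _ _)) // lerD //.
by rewrite (le_trans zM) ?ler_norm.
Qed.

Lemma horner_continuousC p z (e : R) : 0 < e ->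
  exists2 r : R, 0 < r & forall w, modulus (w - z) < r -> modulus (p.[w] - p.[z]) < e.
Proof.
move=> e0; have [L L0 hL] := horner_lipschitz p (modulus z + 1).
exists (Num.min 1 (e / (L + 1))); first by rewrite lt_min ltr01 divr_gt0 // ltr_wpDl.
move=> w; rewrite lt_min => /andP[w1 w2].
apply: (@le_lt_trans _ _ ((L + 1) * modulus (w - z))).
  apply: (le_trans (hL w z _ _)); last 1 first.
  - by rewrite ler_wpM2r ?modulus_ge0 // lerDl.
  - have := modulusD (w - z) z; rewrite subrK => h; lra.
  - by rewrite lerDl.
by rewrite mulrC -ltr_pdivlMr // ltr_wpDl.
Qed.

Lemma horner_continuous p : continuous (pfun p).
Proof. by apply/continuousC => z e e0; exact: horner_continuousC. Qed.

Lemma open_preimage_horner p (A : set C) : open A -> open (pfun p @^-1` A).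
Proof. by apply: open_comp => z _; exact: horner_continuous. Qed.

Lemma closed_preimage_horner p (A : set C) : closed A -> closed (pfun p @^-1` A).
Proof. by apply: closed_comp => z _; exact: horner_continuous. Qed.

Lemma modulus_horner_continuous p : continuous ((fun z => modulus p.[z]) : C -> R).
Proof.
move=> z; apply: (@continuous_comp _ _ _ (pfun p) (modulus : C -> R)).
  exact: horner_continuous.
exact: modulus_continuous.
Qed.

Lemma interior_preimage_horner p (A : set C) : (1 < size p)%N ->
  (pfun p @^-1` A)^° = pfun p @^-1` A^°.
Proof.
move=> sp; apply/seteqP; split=> z hz.
  have sub : pfun p @` (pfun p @^-1` A)^° `<=` A.
    by move=> _ [y /interior_subset Ay <-].
  have := interiorS sub; have /interior_id -> : open (pfun p @` (pfun p @^-1` A)^°).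
    by apply: open_horner => //; exact: open_interior.
  by apply; exists z.
have sub : pfun p @^-1` A^° `<=` (pfun p @^-1` A).
  by move=> y /= /interior_subset.
have := interiorS sub; have /interior_id -> : open (pfun p @^-1` A^°).
  by apply: open_preimage_horner; exact: open_interior.
by apply.
Qed.

Lemma further z (s : R) : 0 <= s ->
  exists2 w, modulus (w - z) = s & modulus w = modulus z + s.
Proof.
move=> s0; have [->|z0] := eqVneq z 0.
  by exists s%:C; rewrite ?subr0 modulus_real ger0_norm // modulus0 add0r.
have m0 : 0 < modulus z by rewrite modulus_gt0.
exists (z * (1 + s / modulus z)%:C); last first.
  rewrite modulusM modulus_real ger0_norm; last by rewrite addr_ge0 // divr_ge0 // ltW.
  by rewrite mulrDr mulr1 mulrCA divff ?mulr1 // gt_eqF.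
rewrite rmorphD /= rmorph1 mulrDr mulr1 addrC addKr modulusM modulus_real.
rewrite ger0_norm; last by rewrite divr_ge0 // ltW.
by rewrite mulrCA divff ?mulr1 // gt_eqF.
Qed.

(** At an interior maximum [c] the image is a neighbourhood of [p.[c]], so it contains a value
    further from the origin. *)
Lemma max_modulus p (S : set C) M : (1 < size p)%N -> compact S ->
  (forall z : C, S z -> ~ S^° z -> modulus p.[z] <= M) ->
  forall z : C, S z -> modulus p.[z] <= M.
Proof.
move=> sp cS h z Sz.
have [|c cS' hc] := @compact_EVT_max C R (fun z : C => modulus p.[z]) S (ex_intro _ z Sz) cS.
  exact/continuous_subspaceT/modulus_horner_continuous.
apply: (@le_trans _ _ (modulus p.[c])); first by apply: hc; rewrite inE.
rewrite inE in cS'; apply: h => // ic.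
have /openC o := open_horner sp (@open_interior _ S).
have [|r r0 hr] := o p.[c]; first by exists c.
have [w w1 w2] := further p.[c] (ltW (divr_gt0 r0 (ltr0n _ 2))).
have [|y /interior_subset Sy yw] := hr w; first by rewrite w1 ltr_pdivrMr // ltr_pMr // ltr1n.
have := hc y; rewrite inE => /(_ Sy) /=; rewrite -/(pfun p y) yw w2 => hh.
have : 0 < r / 2 by rewrite divr_gt0.
lra.
Qed.

Lemma compact_preimage_horner p (A : set C) : (1 < size p)%N -> compact A ->
  compact (pfun p @^-1` A).
Proof.
move=> sp cA; have [M hM] := compact_modulus_le cA.
have [s ss hs] := modulus_poly_roots 0 sp.
pose r := (`|M| + 1) / modulus (lead_coef p) + 1.
have l0 := modulus_lead_gt0 sp.
have r1 : 1 <= r by rewrite lerDr divr_ge0 ?(ltW l0) // addr_ge0.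
apply: (@compact_closed_bounded _ _ (\sum_(a <- s) modulus a + r)).
  by apply: closed_preimage_horner; apply: compact_closed => //; exact: hausdorffC.
move=> z /hM; rewrite /pfun -[p.[z]]subr0 hs => h.
have [||a as_ ar] := @prod_lt_exists s z r; first lra.
  rewrite -(ltr_pM2l l0); apply: (le_lt_trans h).
  apply: (@lt_le_trans _ _ (modulus (lead_coef p) * r)).
    rewrite /r mulrDr mulrC divfK ?gt_eqF // mulr1.
    by have := ler_norm M; lra.
  rewrite ler_pM2l // -{1}(expr1 r) ler_weXn2l // ss; lia.
have := modulusD (z - a) a; rewrite subrK modulusBC => h1.
have : modulus a <= \sum_(a <- s) modulus a.
  by rewrite (big_rem a) //= lerDl; apply: sumr_ge0 => b _; exact: modulus_ge0.
lra.
Qed.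

Lemma prod_le_pow (s : seq R[i]) (f : R[i] -> R) (c : R) :
  (forall a, a \in s -> 0 <= f a <= c) -> \prod_(a <- s) f a <= c ^+ size s.
Proof.
elim: s => [|a s IH] h; first by rewrite big_nil expr0.
have /andP[f0 fc] := h a (mem_head _ _).
rewrite big_cons /= exprS ler_pM ?IH //; last first.
  by move=> b bs; apply: h; rewrite in_cons bs orbT.
by rewrite big_seq; apply: prodr_ge0 => b bs; have /andP[] := h b (@mem_behead _ (a :: s) _ bs).
Qed.

Lemma prod_ge_pow (s : seq R[i]) (f : R[i] -> R) (c : R) : 0 <= c ->
  (forall a, a \in s -> c <= f a) -> c ^+ size s <= \prod_(a <- s) f a.
Proof.
move=> c0; elim: s => [|a s IH] h; first by rewrite big_nil expr0.
rewrite big_cons /= exprS ler_pM ?IH ?exprn_ge0 //; first by apply: h; rewrite mem_head.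
by move=> b bs; apply: h; rewrite in_cons bs orbT.
Qed.

Lemma horner_growth p : (1 < size p)%N ->
  exists c1 c2 r0 : R, [/\ 1 <= c1, 0 < c2 <= 1, 1 <= r0,
    forall z, modulus p.[z] <= c1 * Num.max 1 (modulus z) ^+ (size p).-1
  & forall z, r0 <= modulus z -> c2 * modulus z ^+ (size p).-1 <= modulus p.[z]].
Proof.
move=> sp; have [s ss hs] := modulus_poly_roots 0 sp.
have l0 := modulus_lead_gt0 sp; set l := modulus (lead_coef p) in hs l0.
pose m := \sum_(a <- s) modulus a.
have ms a : a \in s -> modulus a <= m.
  by move=> as_; rewrite /m (big_rem a) //= lerDl; apply: sumr_ge0 => b _; exact: modulus_ge0.
have m0 : 0 <= m by apply: sumr_ge0 => b _; exact: modulus_ge0.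
pose d := (size p).-1.
(* Every root [a] has [|a| <= m], so [|z - a|] is at most [(1 + m) * max 1 |z|], and at least
   [|z| / 2] once [|z| >= 2 * m + 1]. *)
exists (Num.max 1 (l * (1 + m) ^+ d)), (Num.min 1 (l / 2 ^+ d)), (2 * m + 1).
split.
- by rewrite le_max lexx.
- by rewrite lt_min ltr01 divr_gt0 ?exprn_gt0 //= ge_min lexx.
- lra.
- move=> z; rewrite -[p.[z]]subr0 hs.
  apply: (@le_trans _ _ (l * (1 + m) ^+ d * Num.max 1 (modulus z) ^+ d)); last first.
    by rewrite ler_wpM2r ?exprn_ge0 ?le_max ?ler01 // lexx orbT.
  rewrite -mulrA -exprMn ler_pM2l // /d -ss; apply: prod_le_pow => a as_.
  rewrite modulus_ge0 /=; apply: (le_trans (le_modulusBD _ _)).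
  have h1 := ms _ as_; have h2 : 1 <= Num.max 1 (modulus z) by rewrite le_max lexx.
  have h3 : modulus z <= Num.max 1 (modulus z) by rewrite le_max lexx orbT.
  by nra.
- move=> z hz; rewrite -[p.[z]]subr0 hs.
  apply: (@le_trans _ _ (l / 2 ^+ d * modulus z ^+ d)).
    by rewrite ler_wpM2r ?exprn_ge0 ?modulus_ge0 // ge_min lexx orbT.
  rewrite -mulrA -exprVn -exprMn ler_pM2l // /d -ss; apply: prod_ge_pow.
    by rewrite mulr_ge0 ?modulus_ge0.
  move=> a as_; have h1 := ms _ as_; have h2 := le_modulusB z a.
  by rewrite mulrC; lra.
Qed.

(* The maximum principle gives this form of "no holes" for sublevel sets, without
   any reference to the components of the complement. *)
Definition full (D : set C) := forall S : set C, compact S ->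
  (forall z : C, S z -> ~ S^° z -> D z) -> S `<=` D.

Lemma full_interior (D S : set C) : full D -> compact S ->
  (forall z : C, S z -> ~ S^° z -> D^° z) -> S `<=` D^°.
Proof.
move=> fD cS h; have SD : S `<=` D by apply: fD => // z Sz nz; exact: interior_subset (h z Sz nz).
move=> z Sz; have [iz|nz] := pselect (S^° z); last exact: h.
exact: (interiorS SD).
Qed.

Lemma full_sublevel (I : Type) (f : I -> {poly R[i]}) (M : R) :
  (forall i, 1 < size (f i))%N -> full [set z | forall i, modulus (f i).[z] <= M].
Proof.
move=> sf S cS h z Sz i; apply: max_modulus cS _ z Sz => // w Sw nw.
exact: h Sw nw i.
Qed.

End Polynomials.

(** * Connected plane sets *)

Section Connectedness.
Context {R : realType}.
Implicit Types (z w : R[i]) (p q : {poly R[i]}).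
Local Notation C := (R[i]^o).
Local Open Scope complex_scope.

(** The part of [S] in [D] is relatively closed, and relatively open since it is also the part of
    [S] in the interior of [D]. *)
Lemma connected_cut (S D : set C) : connected S -> closed D -> S `&` D !=set0 ->
  (forall z : C, S z -> D z -> D^° z) -> S `<=` D^°.
Proof.
move=> cS cD SD h.
have E : S `&` D = S.
  apply: cS => //; last by exists D.
  exists D^°; first exact: open_interior.
  apply/seteqP; split=> z [Sz Dz]; split=> //; first exact: h.
  exact: interior_subset.
by move=> z; rewrite -E => -[Sz Dz]; exact: h.
Qed.

Lemma connected_open_split (S U V : set C) : connected S -> open U -> open V ->
  U `&` V = set0 -> S `<=` U `|` V -> S `<=` U \/ S `<=` V.
Proof.
move=> cS oU oV UV SUV; apply: (connected_subset _ SUV cS); split.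
  apply/seteqP; split=> // z [cUz Vz].
  have [y [Uy Vy]] := cUz V (open_nbhs_nbhs (conj oV Vz)).
  by have : (U `&` V) y by []; rewrite UV.
apply/seteqP; split=> // z [Uz cVz].
have [y [Uy Vy]] := cVz U (open_nbhs_nbhs (conj oU Uz)).
by have : (U `&` V) y by []; rewrite UV.
Qed.

Lemma connected_closed_split (S U V : set C) : connected S -> closed U -> closed V ->
  U `&` V = set0 -> S `<=` U `|` V -> S `<=` U \/ S `<=` V.
Proof.
move=> cS cU cV UV SUV; apply: (connected_subset _ SUV cS).
by split; [rewrite -((closure_id U).1 cU)|rewrite -((closure_id V).1 cV)].
Qed.

Lemma compact_closed_dist (A B : set C) : compact A -> closed B -> A `&` B = set0 ->
  exists2 d : R, 0 < d & forall a b, A a -> B b -> d <= modulus (a - b).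
Proof.
move=> cA cB AB; apply: contrapT => h.
have hk (k : nat) : exists a, A a /\ exists2 b, B b & modulus (a - b) < k.+1%:R^-1.
  apply: contrapT => hn; apply: h; exists (k.+1%:R^-1); first by rewrite invr_gt0.
  move=> a b Aa Bb; rewrite leNgt; apply/negP => lt; apply: hn.
  by exists a; split=> //; exists b.
have [u hu] := choice hk.
have [z Az hz] := compact_cluster_seq cA (fun k => (hu k).1).
have nBz : ~ B z by move=> Bz; have : (A `&` B) z by []; rewrite AB.
have /closedC/(_ z nBz)[r r0 hr] := cB.
have r20 : 0 < r / 2 by rewrite divr_gt0.
pose N := Num.bound ((r / 2)^-1).
have [k Nk kz] := hz _ r20 N.
have [b Bb ub] := (hu k).2.
have kr : k.+1%:R^-1 < r / 2.
  rewrite invf_plt ?posrE //; have := archi_boundP (ltW (_ : 0 < (r/2)^-1)).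
  rewrite invr_gt0 r20 => /(_ isT)/lt_le_trans; apply; rewrite ler_nat.
  exact: leq_trans Nk _.
apply: (hr b) => //.
apply: (le_lt_trans (modulus_dist (u k) b z)); rewrite (modulusBC b (u k)).
by rewrite (splitr r) ltrD // (lt_trans ub kr).
Qed.

Lemma compact_closed_separate (A B : set C) : compact A -> closed B -> A `&` B = set0 ->
  exists U V : set C, [/\ open U, open V, U `&` V = set0, A `<=` U & B `<=` V].
Proof.
move=> cA cB AB; have [d d0 hd] := compact_closed_dist cA cB AB.
have d20 : 0 < d / 2 by rewrite divr_gt0.
exists (\bigcup_(a in A) disc a (d/2)), (\bigcup_(b in B) disc b (d/2)); split.
- by apply: bigcup_open => a _; exact: open_disc.
- by apply: bigcup_open => a _; exact: open_disc.
- apply/seteqP; split=> // z [[a Aa za] [b Bb zb]]; have := hd a b Aa Bb.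
  rewrite leNgt => /negP; apply; apply: (le_lt_trans (modulus_dist z a b)).
  by rewrite (splitr d) ltrD // modulusBC.
- by move=> a Aa; exists a => //; rewrite /disc /= subrr modulus0.
- by move=> a Aa; exists a => //; rewrite /disc /= subrr modulus0.
Qed.

Lemma disconnected_compact (J : set C) : compact J -> ~ connected J ->
  exists U V : set C, [/\ open U, open V, U `&` V = set0, J `<=` U `|` V &
     J `&` U !=set0 /\ J `&` V !=set0].
Proof.
move=> cJ /connectedPn[E [E0 EJ [s1 s2]]].
have clJ : closed J by apply: compact_closed => //; exact: hausdorffC.
have cE b : closed (E b).
  move=> z cz; have : J z.
    apply: clJ; apply: closure_subset cz; rewrite EJ; case: (b); [exact: subsetUr|exact: subsetUl].
  case: b cz; rewrite EJ => cz [] // Ez.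
    by have : (E false `&` closure (E true)) z by []; rewrite s2.
  by have : (closure (E false) `&` E true) z by []; rewrite s1.
have cf : compact (E false).
  by apply: (subclosed_compact (cE _) cJ); rewrite EJ; exact: subsetUl.
have [|U [V [oU oV UV EU EV]]] := compact_closed_separate cf (cE true).
  by rewrite {1}((closure_id _).1 (cE true)).
exists U, V; split=> //; first by rewrite EJ; exact: setUSS.
split; [have [z Ez] := E0 false|have [z Ez] := E0 true]; exists z; rewrite EJ; split.
- by left.
- exact: EU.
- by right.
- exact: EV.
Qed.

(** Convergence is asked in the two Hausdorff senses, without nesting, so that level curves are
    covered as well as decreasing sublevel sets. *)
Lemma connected_limit (G : nat -> set C) (J : set C) : compact J ->
  (forall n, connected (G n)) ->
  (forall U, open U -> J `<=` U -> exists N, forall n, (N <= n)%N -> G n `<=` U) ->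
  (forall z r, J z -> 0 < r -> exists N, forall n, (N <= n)%N -> G n `&` disc z r !=set0) ->
  connected J.
Proof.
move=> cJ cG h1 h2; apply: contrapT => /(disconnected_compact cJ).
move=> [U [V [oU oV UV JUV [[a [Ja Ua]] [b [Jb Vb]]]]]].
have [N hN] := h1 _ (openU oU oV) JUV.
have /openC/(_ _ Ua)[r r0 hr] := oU; have /openC/(_ _ Vb)[s s0 hs] := oV.
have [Na hNa] := h2 a r Ja r0; have [Nb hNb] := h2 b s Jb s0.
pose n := maxn N (maxn Na Nb).
have [|x [Gx xa]] := hNa n; first by rewrite !leq_max leqnn orbT.
have [|y [Gy yb]] := hNb n; first by rewrite !leq_max leqnn !orbT.
have UVx z : U z -> V z -> False by move=> Uz Vz; have : (U `&` V) z by []; rewrite UV.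
have [|GU|GV] := connected_open_split (cG n) oU oV UV; first by apply: hN; rewrite leq_maxl.
  by apply: (UVx y); [exact: GU|exact: hs].
by apply: (UVx x); [exact: hr|exact: GV].
Qed.

(** A polynomial is an open and a closed map, so the image of a relatively clopen part of the
    preimage is relatively clopen in [K]. *)
Lemma clopen_onto p (K B O F : set C) : (1 < size p)%N -> connected K -> B !=set0 ->
  open O -> closed F -> B = pfun p @^-1` K `&` O -> B = pfun p @^-1` K `&` F ->
  pfun p @` B = K.
Proof.
move=> sp cK [b Bb] oO cF BO BF; apply: cK.
- by exists (pfun p b), b.
- exists (pfun p @` O); first exact: open_horner.
  rewrite BO; apply/seteqP; split=> [_ [z [Kz Oz] <-]|w [Kw [z Oz zw]]].
    by split=> //; exists z.
  by exists z => //; split=> //; rewrite /preimage /= zw.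
- exists (pfun p @` F); first exact: closed_horner.
  rewrite BF; apply/seteqP; split=> [_ [z [Kz Oz] <-]|w [Kw [z Oz zw]]].
    by split=> //; exists z.
  by exists z => //; split=> //; rewrite /preimage /= zw.
Qed.

(* A relatively clopen part of the preimage of [K] maps onto [K], so it meets
   the preimage of [Z]. *)
Lemma connected_preimage p (K Z : set C) : (1 < size p)%N -> connected K ->
  Z !=set0 -> Z `<=` K -> connected (pfun p @^-1` Z) -> connected (pfun p @^-1` K).
Proof.
move=> sp cK [z0 Zz0] ZK cZ B B0 [W oO BO] [F cF BF].
apply: contrapT => nB.
have B'0 : (pfun p @^-1` K `&` ~` F) !=set0.
  apply/set0P/eqP => h; apply: nB; rewrite BF; apply/setIidPl => z Kz.
  by apply: contrapT => nF; have : (pfun p @^-1` K `&` ~` F) z by []; rewrite h.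
have E : pfun p @^-1` K `&` ~` F = pfun p @^-1` K `&` ~` W.
  apply/seteqP; split=> z [Kz nz]; split=> //= Hz; apply: nz.
    have : B z by rewrite BO.
    by rewrite BF => -[].
  have : B z by rewrite BF.
  by rewrite BO => -[].
have o1 := clopen_onto sp cK B0 oO cF BO BF.
have o2 := clopen_onto sp cK B'0 (closed_openC cF) (open_closedC oO) erefl E.
have [x Bx xz] : (pfun p @` B) z0 by rewrite o1; exact: ZK.
have [y [_ By] yz] : (pfun p @` (pfun p @^-1` K `&` ~` F)) z0 by rewrite o2; exact: ZK.
have e1 : pfun p @^-1` Z `&` W = pfun p @^-1` Z `&` F.
  apply/seteqP; split=> z [Zz Hz]; split=> //.
    have : B z by rewrite BO; split=> //; exact: ZK.
    by rewrite BF => -[].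
  have : B z by rewrite BF; split=> //; exact: ZK.
  by rewrite BO => -[].
have e2 : pfun p @^-1` Z `&` W = pfun p @^-1` Z.
  apply: cZ; [|by exists W|by exists F].
  exists x; split; first by rewrite /preimage /= xz.
  by move: Bx; rewrite BO => -[].
apply: By; have : (pfun p @^-1` Z `&` W) y by rewrite e2 /preimage /= yz.
by rewrite e1 => -[].
Qed.

Lemma connected_circle (r : R) : 0 <= r -> connected [set w : C | modulus w = r].
Proof.
move=> r0.
have modE (a b : R) : modulus (a +i* b) = Num.sqrt (a ^+ 2 + b ^+ 2).
  by rewrite /modulus normc_def.
have half (e : R) : e ^+ 2 = 1 -> connected ([set x +i* (e * Num.sqrt (r ^+ 2 - x ^+ 2)) | x in `[-r, r]] : set C).
  move=> e1; apply: connected_continuous_connected; first exact: segment_connected.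
  apply: continuous_subspaceT => x.
  have h1 : {for x, continuous (fun x : R => (x, e * Num.sqrt (r ^+ 2 - x ^+ 2)))}.
    apply: (@cvg_pair _ _ _ _ (nbhs x) (nbhs (e * Num.sqrt (r ^+ 2 - x ^+ 2)))); first exact: cvg_id.
    apply: cvgM; first exact: cvg_cst.
    apply: (@continuous_comp R R R (fun x => r ^+ 2 - x ^+ 2) Num.sqrt); last exact: sqrt_continuous.
    by apply: cvgB; [exact: cvg_cst|exact: exprn_continuous].
  exact: (continuous_comp h1 (@mkC_continuous R _)).
have -> : [set w : C | modulus w = r] =
    ([set x +i* (1 * Num.sqrt (r ^+ 2 - x ^+ 2)) | x in `[-r, r]] : set C) `|`
    ([set x +i* (-1 * Num.sqrt (r ^+ 2 - x ^+ 2)) | x in `[-r, r]] : set C).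
  have rng (x : R) : `[-r, r]%classic x -> 0 <= r ^+ 2 - x ^+ 2.
    by rewrite /= in_itv /= => /andP[x1 x2]; nra.
  apply/seteqP; split=> [[a b] /= h|w [] [x xr <-]] /=; last first.
  - rewrite modE exprMn sqrrN expr1n mul1r sqr_sqrtr ?rng // addrC subrK sqrtr_sqr ger0_norm //.
  - rewrite modE exprMn expr1n mul1r sqr_sqrtr ?rng // addrC subrK sqrtr_sqr ger0_norm //.
  have ar : `[-r, r]%classic a.
    by rewrite /= in_itv /= -ler_norml -h; exact: (modulus_Re (a +i* b)).
  have bb : r ^+ 2 - a ^+ 2 = b ^+ 2.
    by rewrite -h modE sqr_sqrtr ?addr_ge0 ?sqr_ge0 // addrC addrA addNr add0r.
  have [b0|b0] := leP 0 b; [left|right]; exists a => //; congr (_ +i* _).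
    by rewrite bb sqrtr_sqr ger0_norm // mul1r.
  by rewrite bb sqrtr_sqr ltr0_norm // mulrNN mul1r.
apply: connectedU; [|exact/half/expr1n|by apply: half; rewrite sqrrN expr1n].
have rr : `[-r, r]%classic r by rewrite /= in_itv /= lexx andbT; lra.
exists (r +i* 0); split; exists r => //; congr (_ +i* _);
by rewrite subrr sqrtr0 ?mulr0.
Qed.

Lemma connected_annulus (l s : R) : 0 <= l <= s -> connected [set w : C | l <= modulus w <= s].
Proof.
case/andP=> l0 ls.
(* Each member is a radial segment together with the whole inner circle, so all members share a
   point, also when [l = 0]. *)
have -> : [set w : C | l <= modulus w <= s] =
   \bigcup_(u in [set u : C | modulus u = 1]) ([set w : C | modulus w = l] `|`
       [set l%:C * u + t%:C * (s%:C * u - l%:C * u) | t in `[0, 1]]).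
  apply/seteqP; split=> [w /= /andP[lw ws]|w [u /= u1 [/= ->|]]]; last 2 first.
  - by rewrite lexx.
  - move=> [t]; rewrite in_itv /= => /andP[t0 t1] <-.
    have -> : l%:C * u + t%:C * (s%:C * u - l%:C * u) = (l + t * (s - l))%:C * u.
      by rewrite rmorphD rmorphM rmorphB /=; ring.
    rewrite modulusM u1 modulus_real mulr1 ger0_norm; last by nra.
    by apply/andP; split; nra.
  have [w0|w0] := eqVneq w 0.
    exists 1; first by rewrite /= modulus1.
    left=> /=; move: lw; rewrite w0 modulus0 => lw.
    by apply/eqP; rewrite eq_le l0 lw.
  have m0 : 0 < modulus w by rewrite modulus_gt0.
  have mC : (modulus w)%:C != 0 by rewrite -(rmorph0 (real_complex R)) (inj_eq (@complexI R)) gt_eqF.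
  exists (w / (modulus w)%:C).
    by rewrite /= modulusM modulusV modulus_real gtr0_norm // divff // gt_eqF.
  have [sl|sl] := eqVneq s l; first by left; apply/eqP; rewrite eq_le lw -sl ws.
  have sl0 : 0 < s - l by rewrite subr_gt0 lt_neqAle eq_sym sl.
  right; exists ((modulus w - l) / (s - l)).
    rewrite /= in_itv /= divr_ge0 ?(ltW sl0) ?subr_ge0 //= ler_pdivrMr // mul1r.
    lra.
  set u := w / _.
  have -> : l%:C * u + ((modulus w - l) / (s - l))%:C * (s%:C * u - l%:C * u) =
    (l + (modulus w - l) / (s - l) * (s - l))%:C * u.
    by rewrite rmorphD rmorphM rmorphB /=; ring.
  by rewrite divfK ?gt_eqF // addrC subrK /u mulrC divfK.
apply: bigcup_connected.
  exists l%:C => u _; left => /=; by rewrite modulus_real ger0_norm.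
move=> u /= u1; apply: connectedU; [|exact: connected_circle|exact: connected_segmentC].
exists (l%:C * u); split; first by rewrite /= modulusM u1 modulus_real ger0_norm ?mulr1.
by exists 0; rewrite ?mul0r ?addr0 //= in_itv /= lexx ler01.
Qed.

Lemma connected_exterior (l : R) : 0 <= l -> connected [set w : C | l <= modulus w].
Proof.
move=> l0; have -> : [set w : C | l <= modulus w] =
   \bigcup_(s in [set s : R | l <= s]) [set w : C | l <= modulus w <= s].
  apply/seteqP; split=> [w /= lw|w [s /= ls /andP[]//]].
  by exists (modulus w) => //=; rewrite lw lexx.
apply: bigcup_connected => [|s /= ls]; last by apply: connected_annulus; rewrite l0.
by exists l%:C => s /= ls; rewrite modulus_real ger0_norm // lexx.
Qed.

End Connectedness.

(** * Connectedness of lemniscates *)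

Section Levels.
Context {R : realType}.
Implicit Types (z w x y : R[i]).
Local Notation C := (R[i]^o).
Local Open Scope complex_scope.

(** [u] is the Newton step at [z0]: to first order [f(x + t u)] is [(1 - t) f(x)]. Keeping [u] fixed
    for all [x] near [z0] costs two error terms of size [t |f(z0)| / 8], which the weaker factor
    [1 - t / 2] absorbs. *)
Lemma modulus_descent (f : {poly R[i]}) z0 : f.[z0] != 0 -> f^`().[z0] != 0 ->
  exists u : R[i], exists2 d : R, 0 < d & forall x t, modulus (x - z0) < d -> 0 <= t <= d ->
    modulus f.[x + t%:C * u] <= modulus f.[x] * (1 - t / 2).
Proof.
move=> f0 f'0; pose u := - f.[z0] / f^`().[z0]; exists u.
have F0 : 0 < modulus f.[z0] by rewrite modulus_gt0.
set F := modulus f.[z0] in F0.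
have [L L0 hL] := horner_taylor f (modulus z0 + 1).
have e0 : 0 < F / 8 by rewrite divr_gt0.
have u0 : 0 <= modulus u := modulus_ge0 u.
(* This combination vanishes at [z0]; it measures the error of using the same [u] at a nearby
   [x]. *)
have [d1 d10 h1] := horner_continuousC (f + u *: f^`()) z0 e0.
have e20 : 0 < F / 2 by rewrite divr_gt0.
have [d2 d20 h2] := horner_continuousC f z0 e20.
pose d3 := (modulus u + 1)^-1.
have d30 : 0 < d3 by rewrite invr_gt0 ltr_wpDl.
pose d4 := F / 8 / (L * modulus u ^+ 2 + 1).
have d40 : 0 < d4 by rewrite divr_gt0 // ltr_wpDl ?mulr_ge0 ?exprn_ge0.
exists (Num.min (Num.min d1 d2) (Num.min (Num.min d3 d4) 1)).
  by rewrite !lt_min d10 d20 d30 d40 ltr01.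
move=> x t; rewrite !lt_min !le_min => /andP[/andP[x1 x2] /andP[/andP[_ _] x5]].
case/andP=> t0 /andP[/andP[_ _] /andP[/andP[t3 t4] t5]].
have hx : modulus x <= modulus z0 + 1.
  by have := modulusD (x - z0) z0; rewrite subrK => h; lra.
have tu1 : modulus (t%:C * u) <= 1.
  rewrite modulusM modulus_real ger0_norm //.
  apply: (@le_trans _ _ (d3 * modulus u)); first by rewrite ler_wpM2r.
  by rewrite /d3 mulrC ler_pdivrMr ?mul1r ?lerDl // ltr_wpDl.
have := hL _ _ hx tu1; rewrite [in X in _ <= _ * X]modulusM modulus_real ger0_norm // => T.
have {}h1 : modulus (f.[x] + u * f^`().[x]) < F / 8.
  have := h1 x x1; rewrite !hornerD !hornerZ.
  have -> : f.[z0] + u * f^`().[z0] = 0 by rewrite /u divfK // addrN.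
  by rewrite subr0.
have {}h2 : F / 2 < modulus f.[x].
  have := h2 x x2; have := le_modulusB f.[z0] f.[x]; rewrite modulusBC -/F => A B; lra.
have -> : f.[x + t%:C * u] = (f.[x + t%:C * u] - f.[x] - t%:C * u * f^`().[x]) +
    (1 - t)%:C * f.[x] + t%:C * (f.[x] + u * f^`().[x]).
  by rewrite rmorphB /=; ring.
apply: (le_trans (modulusD _ _)); apply: (@le_trans _ _ (t * (F/8) + (1 - t) * modulus f.[x] + t * (F / 8))).
  apply: lerD.
    apply: (le_trans (modulusD _ _)); apply: lerD.
      apply: (le_trans T); rewrite exprMn.
      have : t * (L * modulus u ^+ 2 + 1) <= F / 8.
        by rewrite -ler_pdivlMr // ltr_wpDl ?mulr_ge0 ?exprn_ge0.
      have : 0 <= L * modulus u ^+ 2 by rewrite mulr_ge0 ?exprn_ge0.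
      move=> a b; rewrite [X in X <= _](_ : _ = t * (t * (L * modulus u ^+ 2))); last by ring.
      by rewrite ler_wpM2l //; nra.
    by rewrite modulusM modulus_real ger0_norm // subr_ge0.
  by rewrite modulusM modulus_real ger0_norm // ler_wpM2l // ltW.
nra.
Qed.

(** Both points descend along [u] for a time [t] and end in a small disc around [z0 + t u], where
    [|f|] is already below the level of [z0]. At a critical point distinct components of the
    sublevel set may meet, which the nonzero derivative rules out. *)
Lemma level_join (f : {poly R[i]}) z0 (l : R) : f^`().[z0] != 0 -> 0 <= l < modulus f.[z0] ->
  exists2 d : R, 0 < d & forall x y, modulus (x - z0) < d -> modulus (y - z0) < d ->
    modulus f.[x] < modulus f.[z0] -> modulus f.[y] < modulus f.[z0] ->
    exists2 s, s < modulus f.[z0] & exists T : set C, [/\ connected T, T x, T y &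
      forall z, T z -> l <= modulus f.[z] <= s].
Proof.
move=> f'0 /andP[l0 lF]; set F := modulus f.[z0] in lF *.
have F0 : 0 < F by apply: le_lt_trans lF.
have fz0 : f.[z0] != 0 by rewrite -modulus_gt0.
have [u [d0 d00 hd]] := modulus_descent fz0 f'0.
have e0 : 0 < F - l by rewrite subr_gt0.
have [r r0 hr] := horner_continuousC f z0 e0.
have u0 : 0 <= modulus u := modulus_ge0 u.
(* [t |u| <= r / 2] keeps the descending segments and the final disc within [r] of [z0], where [|f|]
   stays above [l]. *)
pose t := Num.min (Num.min d0 1) (r / 2 / (modulus u + 1)).
have t0 : 0 < t by rewrite !lt_min d00 ltr01 !divr_gt0 // ltr_wpDl.
have td0 : t <= d0 by rewrite !ge_min lexx.
have t1 : t <= 1 by rewrite !ge_min lexx orbT.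
have tu : t * modulus u <= r / 2.
  have : t * (modulus u + 1) <= r / 2 by rewrite -ler_pdivlMr ?ge_min ?lexx ?orbT // ltr_wpDl.
  by nra.
have e1 : 0 < F * (t / 4) by rewrite mulr_gt0 // divr_gt0.
have [d1 d10 h1] := horner_continuousC f z0 e1.
have r20 : 0 < r / 2 by rewrite divr_gt0.
pose d := Num.min (Num.min d0 d1) (r / 2).
exists d; first by rewrite !lt_min d00 d10.
have dd0 : d <= d0 by rewrite !ge_min lexx.
have dd1 : d <= d1 by rewrite !ge_min lexx orbT.
have ddr : d <= r / 2 by rewrite !ge_min lexx orbT.
have lower x s : modulus (x - z0) < d -> 0 <= s <= t -> l <= modulus f.[x + s%:C * u].
  move=> xd /andP[s0 st].
  have : modulus (x + s%:C * u - z0) < r.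
    rewrite addrAC; apply: (le_lt_trans (modulusD _ _)).
    rewrite modulusM modulus_real ger0_norm //.
    have : s * modulus u <= t * modulus u by rewrite ler_wpM2r.
    lra.
  move/hr; have := le_modulusB f.[z0] f.[x + s%:C * u]; rewrite modulusBC -/F => A B; lra.
have drop x s : modulus (x - z0) < d -> 0 <= s <= t -> modulus f.[x + s%:C * u] <= modulus f.[x].
  move=> xd /andP[s0 st]; apply: (le_trans (hd x s _ _)).
  - by apply: lt_le_trans dd0.
  - by rewrite s0 (le_trans st).
  - have := modulus_ge0 f.[x]; nra.
have low x : modulus (x - z0) < d -> modulus f.[x + t%:C * u] <= F * (1 - t / 4).
  move=> xd; apply: (le_trans (hd x t _ _)).
  - by apply: lt_le_trans dd0.
  - by rewrite (ltW t0).
  - have A := h1 x (lt_le_trans xd dd1); have := le_modulusB f.[x] f.[z0]; rewrite -/F => B.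
    have : modulus f.[x] <= F * (1 + t / 4) by lra.
    have := modulus_ge0 f.[x]; nra.
move=> x y xd yd xF yF.
exists (Num.max (Num.max (modulus f.[x]) (modulus f.[y])) (F * (1 - t / 4))).
  rewrite !gt_max xF yF /=; nra.
pose seg a : set C := [set a + s%:C * ((a + t%:C * u) - a) | s in `[0, 1]].
exists (seg x `|` disc (z0 + t%:C * u) d `|` seg y).
have inx a : modulus (a - z0) < d -> disc (z0 + t%:C * u) d (a + t%:C * u).
  by rewrite /disc /= [a + _ - _](_ : _ = a - z0) //; ring.
have endp a : seg a (a + t%:C * u).
  exists 1; first by rewrite /= in_itv /= ler01 lexx.
  by rewrite rmorph1 mul1r addrC subrK.
have startp a : seg a a.
  by exists 0; rewrite ?mul0r ?addr0 //= in_itv /= lexx ler01.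
have segb a z : modulus (a - z0) < d -> seg a z -> l <= modulus f.[z] <= modulus f.[a].
  move=> ad [s]; rewrite /= in_itv /= => /andP[s0 s1] <-.
  have -> : a + s%:C * (a + t%:C * u - a) = a + (s * t)%:C * u by rewrite rmorphM; ring.
  have st : 0 <= s * t <= t by apply/andP; split; nra.
  by rewrite lower ?drop.
split.
- apply: connectedU; last exact: connected_segmentC.
    by exists (y + t%:C * u); split=> //; right; exact: inx.
  apply: connectedU; [|exact: connected_segmentC|exact: connected_disc].
  by exists (x + t%:C * u); split=> //; exact: inx.
- by left; left; exact: startp.
- by right; exact: startp.
- move=> z [[hz|hz]|hz].
  + by have /andP[A1 A2] := segb _ _ xd hz; apply/andP; split=> //; rewrite !le_max A2.
  + have {}h : modulus (z - t%:C * u - z0) < d.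
      by move: hz; rewrite /disc /= opprD addrA addrAC.
    have tt : 0 <= t <= t by rewrite (ltW t0) lexx.
    have A1 := lower _ _ h tt; have A2 := low _ h; rewrite subrK in A1 A2.
    by apply/andP; split=> //; rewrite !le_max A2 orbT.
  + by have /andP[A1 A2] := segb _ _ yd hz; apply/andP; split=> //; rewrite !le_max A2 orbT.
Qed.

(** * Separations of the bands l <= |f| <= s *)

Section Splitting.
Variables (f : {poly R[i]}) (l s1 : R).
Hypothesis sf : (1 < size f)%N.
Hypothesis l0 : 0 <= l.
Hypothesis ls : l <= s1.
Hypothesis s10 : 0 < s1.
Hypothesis ncrit : forall z, s1 <= modulus f.[z] -> f^`().[z] != 0.

Definition band (s : R) : set C := [set z | l <= modulus f.[z] <= s].

Lemma band_preimage s : band s = pfun f @^-1` [set w : C | l <= modulus w <= s].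
Proof. by []. Qed.

Lemma closed_ring (a b : R) : closed [set w : C | a <= modulus w <= b].
Proof.
have -> : [set w : C | a <= modulus w <= b] = ~` (disc 0 a) `&` cdisc 0 b.
  apply/seteqP; split=> w; rewrite /disc /cdisc /= subr0.
    by move=> /andP[h ->]; split=> //; apply/negP; rewrite -leNgt.
  by move=> [/negP]; rewrite -leNgt => -> ->.
by apply: closedI; [apply: open_closedC; exact: open_disc|exact: closed_cdisc].
Qed.

Lemma compact_ring (a b : R) : compact [set w : C | a <= modulus w <= b].
Proof. by apply: (compact_closed_bounded (@closed_ring a b)) => z /= /andP[_]; apply. Qed.

Lemma compact_band s : compact (band s).
Proof. rewrite band_preimage; apply: compact_preimage_horner => //; exact: compact_ring. Qed.

Lemma closed_band s : closed (band s).
Proof. by apply: compact_closed; [exact: hausdorffC|exact: compact_band]. Qed.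

(* A separation of [band s1] extends to a separation of every larger band, since
   there is no critical point above level [s1]; this contradicts the
   connectedness of {l <= |f|}. *)
Definition splits (U V : set C) (s : R) (U' V' : set C) :=
  [/\ closed U', closed V', U' `&` V' = set0, U' `|` V' = band s &
      U' `&` band s1 = U /\ V' `&` band s1 = V].

Lemma splitsC U V s U' V' : splits U V s U' V' -> splits V U s V' U'.
Proof. by move=> [c1 c2 i u [r1 r2]]; split=> //; rewrite 1?setIC 1?setUC. Qed.

Lemma splits_sub U V s s' U' V' : s1 <= s' <= s -> splits U V s U' V' ->
  splits U V s' (U' `&` band s') (V' `&` band s').
Proof.
move=> /andP[s1s' s's] [c1 c2 i u [r1 r2]].
have b1 : band s1 `<=` band s' by move=> z; rewrite /band /= => /andP[-> h]; rewrite (le_trans h).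
have b2 : band s' `<=` band s by move=> z; rewrite /band /= => /andP[-> h]; rewrite (le_trans h).
split; [by apply: closedI => //; exact: closed_band|by apply: closedI => //; exact: closed_band| | |split].
- by rewrite setIACA i set0I.
- by rewrite -setIUl u; apply/setIidPr.
- by rewrite -setIA (setIidr b1).
- by rewrite -setIA (setIidr b1).
Qed.

(** Uniqueness of the extension: the overlap of [U1] and [V2] is relatively clopen in [band s], so
    if nonempty it maps onto the whole ring and has a point at level [s1], which would lie in both
    [U] and [V]. *)
Lemma splits_disj U V s U1 V1 U2 V2 : s1 <= s -> splits U V s U1 V1 -> splits U V s U2 V2 ->
  U1 `&` V2 = set0.
Proof.
move=> ss [c1 d1 i1 u1 [r1 t1]] [c2 d2 i2 u2 [r2 t2]].
apply: contrapT => /eqP/set0P n0.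
have E : U1 `&` V2 = band s `&` ~` (V1 `|` U2).
  apply/seteqP; split=> z.
    move=> [z1 z2]; split; first by rewrite -u1; left.
    case=> h; first by have : (U1 `&` V1) z by []; rewrite i1.
    by have : (U2 `&` V2) z by []; rewrite i2.
  move=> [bz /not_orP[n1 n2]]; split.
    by move: bz; rewrite -u1 => -[].
  by move: bz; rewrite -u2 => -[].
have E2 : U1 `&` V2 = band s `&` (U1 `&` V2).
  by apply/esym/setIidPr => z [U1z _]; rewrite -u1; left.
have cK : connected [set w : C | l <= modulus w <= s].
  by apply: connected_annulus; rewrite l0 (le_trans ls).
rewrite band_preimage in E E2.
have onto := clopen_onto sf cK n0 (closed_openC (closedU d1 c2)) (closedI c1 d2) E E2.
have : (pfun f @` (U1 `&` V2)) s1%:C.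
  by rewrite onto /= modulus_real gtr0_norm // ls ss.
move=> [z [z1 z2] fz].
have bz : band s1 z by rewrite /band /= -[f.[z]]/(pfun f z) fz modulus_real gtr0_norm // ls lexx.
have : (U1 `&` V1) z; last by rewrite i1.
have : (U `&` V) z by split; [rewrite -r1|rewrite -t2].
by rewrite -r1 -t1 => -[[? _] [? _]].
Qed.

Lemma splits_le U V s s' U1 V1 U2 V2 z : s1 <= s <= s' ->
  splits U V s U1 V1 -> splits U V s' U2 V2 -> U2 z -> modulus f.[z] <= s -> U1 z.
Proof.
move=> sss h1 h2 zU zs.
have h2' := splits_sub sss h2; have /andP[ss _] := sss.
have bz : band s z.
  rewrite /band /= zs andbT.
  have : band s' z by case: h2 => _ _ _ <- _; left.
  by move=> /andP[].
case: (h1) => _ _ _ u1 _; have := bz; rewrite -u1 => -[//|Vz].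
have : ((U2 `&` band s) `&` V1) z by [].
by rewrite (splits_disj ss h2' h1).
Qed.

Lemma splits_ge U V s s' U1 V1 U2 V2 z : s1 <= s <= s' ->
  splits U V s U1 V1 -> splits U V s' U2 V2 -> U1 z -> U2 z.
Proof.
move=> sss h1 h2 zU.
have h2' := splits_sub sss h2; have /andP[ss _] := sss.
have bz : band s z by case: h1 => _ _ _ <- _; left.
case: (h2') => _ _ _ u2 _; have := bz; rewrite -u2 => -[[]//|Vz].
have : (U1 `&` (V2 `&` band s)) z by [].
by rewrite (splits_disj ss h1 h2').
Qed.

(** By uniqueness the sides found at different levels agree, so this is the [U]-side of the union of
    the bands with level in [I]. *)
Definition sweep (I : R -> Prop) (U V : set C) : set C :=
  [set z | exists s U' V', [/\ I s, s1 <= s, splits U V s U' V' & U' z]].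

Lemma closure_sweep I U V s U' V' z : s1 <= s -> splits U V s U' V' ->
  modulus f.[z] < s -> closure (sweep I U V) z -> U' z.
Proof.
move=> ss h zs cz; have cU' : closed U' by case: h.
have e0 : 0 < s - modulus f.[z] by rewrite subr_gt0.
have [r r0 hr] := horner_continuousC f z e0.
apply: cU'; apply/closureC => d d0.
have [|w [t [U2 [V2 [It st ht U2w]]]]] := (closureC _ _).1 cz (Num.min r d).
  by rewrite lt_min r0.
rewrite lt_min => /andP[wr wd]; exists w => //.
have ws : modulus f.[w] <= s.
  by have := hr w wr; have := le_modulusB f.[w] f.[z] => A B; lra.
have [st'|st'] := leP s t.
  by apply: (splits_le _ h ht U2w ws); rewrite ss.
by apply: (splits_ge _ ht h U2w); rewrite st ltW.
Qed.

(** Both sides are thickened to disjoint open sets. What these leave uncovered has a closed image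
    under [f], disjoint from the compact ring, so slightly higher levels are still covered. *)
Lemma splits_extend U V s U' V' : s1 <= s -> splits U V s U' V' ->
  exists2 s', s < s' & exists U2 V2, splits U V s' U2 V2.
Proof.
move=> ss h; have [c1 c2 i u [r1 r2]] := h.
have s0 : 0 < s by apply: lt_le_trans ss.
have cU : compact U'.
  by apply: (subclosed_compact c1 (@compact_band s)); rewrite -u => z; left.
have [A [B [oA oB AB UA VB]]] := compact_closed_separate cU c2 i.
pose Q := pfun f @` ~` (A `|` B).
have cQ : closed Q by apply: closed_horner => //; apply: open_closedC; exact: openU.
have rQ : [set w : C | l <= modulus w <= s] `&` Q = set0.
  apply/seteqP; split=> // w [ws [z nAB fz]]; apply: nAB.
  have : band s z by rewrite /band /= -[f.[z]]/(pfun f z) fz.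
  by rewrite -u => -[/UA|/VB]; [left|right].
have [d d0 hd] := compact_closed_dist (@compact_ring l s) cQ rQ.
exists (s + d / 2); first by rewrite ltrDl divr_gt0.
set s' := s + d / 2.
have ss' : s < s' by rewrite ltrDl divr_gt0.
have cov : band s' `<=` A `|` B.
  move=> z bz; apply: contrapT => nz.
  have Qz : Q (pfun f z) by exists z.
  move: bz => /andP[lz zs'].
  have [zs|zs] := leP (modulus f.[z]) s.
    have : ([set w : C | l <= modulus w <= s] `&` Q) (pfun f z).
      by split => //=; apply/andP.
    by rewrite rQ.
  have m0 : 0 < modulus f.[z] by apply: lt_trans zs.
  (* The radial projection of [f.[z]] to the circle of radius [s]: a point of the ring within
     [d / 2] of [f.[z]]. *)
  pose w := f.[z] * (s / modulus f.[z])%:C.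
  have w1 : modulus w = s.
    by rewrite modulusM modulus_real gtr0_norm ?divr_gt0 // mulrCA divff ?mulr1 // gt_eqF.
  have := hd w (pfun f z) _ Qz; rewrite /= w1 lexx (le_trans ls ss) => /(_ isT).
  have -> : w - pfun f z = f.[z] * (s / modulus f.[z] - 1)%:C.
    by rewrite /w /pfun rmorphB /= mulrBr rmorph1 mulr1.
  rewrite modulusM modulus_real ler0_norm; last by rewrite subr_le0 ler_pdivrMr // mul1r ltW.
  rewrite mulrN mulrBr mulrCA divff ?mulr1 ?gt_eqF // opprB.
  move: zs'; rewrite /s'; lra.
have ABx z : A z -> B z -> False by move=> Az Bz; have : (A `&` B) z by []; rewrite AB.
have bs : band s1 `<=` band s by move=> z; rewrite /band /= => /andP[-> k]; rewrite (le_trans k).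
have bs' : band s1 `<=` band s'.
  move=> z /bs; rewrite /band /= => /andP[-> k]; rewrite (le_trans k) //; exact: ltW.
exists (band s' `&` ~` B), (band s' `&` ~` A); split.
- by apply: closedI; [exact: closed_band|exact: open_closedC].
- by apply: closedI; [exact: closed_band|exact: open_closedC].
- by apply/seteqP; split=> // z [[bz nB] [_ nA]]; have [] := cov z bz.
- apply/seteqP; split=> [z [[]|[]]//|z bz].
  by have [Az|Bz] := cov z bz; [left|right]; split=> // k; exact: (ABx z).
- split; apply/seteqP; split=> z.
  + move=> [[b1 nB] bz]; rewrite -r1; split=> //.
    by have := bs _ bz; rewrite -u => -[//|/VB].
  + rewrite -r1 => -[Uz bz]; split=> //; split; first exact: bs'.
    by move=> Bz; apply: (ABx z) => //; exact: UA.
  + move=> [[b1 nA] bz]; rewrite -r2; split=> //.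
    by have := bs _ bz; rewrite -u => -[/UA|].
  + rewrite -r2 => -[Uz bz]; split=> //; split; first exact: bs'.
    by move=> Az; apply: (ABx z) => //; exact: VB.
Qed.

(** The sides at level [s0] are the closures of the sweeps. They cover, since by the open mapping
    property points at level [s0] are limits of points at lower levels; they are disjoint, since
    near a common point [level_join] would connect the two sides inside one lower band. *)
Lemma splits_limit U V s0 : s1 < s0 ->
  (forall s, s1 <= s < s0 -> exists U' V', splits U V s U' V') ->
  exists U' V', splits U V s0 U' V'.
Proof.
move=> ss0 hg; pose I := fun s => s < s0.
have s00 : 0 < s0 by apply: lt_trans ss0.
have lfz z : modulus f.[z] < s0 -> exists s, s1 <= s < s0 /\ modulus f.[z] < s.
  move=> zs; exists ((Num.max s1 (modulus f.[z]) + s0) / 2).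
  have h : Num.max s1 (modulus f.[z]) < s0 by rewrite gt_max ss0.
  have h1 : s1 <= Num.max s1 (modulus f.[z]) by rewrite le_max lexx.
  have h2 : modulus f.[z] <= Num.max s1 (modulus f.[z]) by rewrite le_max lexx orbT.
  split; [apply/andP; split|]; lra.
have sweepI U2 V2 s A B z : splits U2 V2 s A B -> s1 <= s < s0 -> A z -> sweep I U2 V2 z.
  by move=> h /andP[h1 h2] Az; exists s, A, B; split.
have restr U2 V2 : (forall s, s1 <= s < s0 -> exists U' V', splits U2 V2 s U' V') ->
    band s0 `&` closure (sweep I U2 V2) `&` band s1 = U2.
  move=> hg2; apply/seteqP; split=> [z [[_ cz] bz]|z Uz].
    have zs1 : modulus f.[z] <= s1 by move: bz => /andP[].
    have [s [sI zs]] := lfz z (le_lt_trans zs1 ss0).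
    have [A [B h]] := hg2 s sI.
    have /andP[ss _] := sI.
    have := closure_sweep ss h zs cz.
    by case: h => _ _ _ _ [<- _].
  have s1I : s1 <= s1 < s0 by rewrite lexx.
  have [A [B h]] := hg2 _ s1I.
  have [Az bz] : (A `&` band s1) z by case: h => _ _ _ _ [-> _].
  split=> //; split.
    by move: bz; rewrite /band /= => /andP[-> k]; rewrite (le_trans k) // ltW.
  by apply: subset_closure; exact: sweepI h s1I Az.
have hgC s : s1 <= s < s0 -> exists U' V', splits V U s U' V'.
  by move=> /hg[A [B h]]; exists B, A; exact: splitsC.
exists (band s0 `&` closure (sweep I U V)), (band s0 `&` closure (sweep I V U)); split.
- by apply: closedI; [exact: closed_band|exact: closed_closure].
- by apply: closedI; [exact: closed_band|exact: closed_closure].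
- apply/seteqP; split=> // z [[bz cU] [_ cV]].
  move: bz => /andP[lz]; rewrite le_eqVlt => /predU1P[zs0|zs0]; last first.
    have [s [sI zs]] := lfz z zs0; have [A [B h]] := hg s sI.
    have /andP[ss _] := sI.
    have Az := closure_sweep ss h zs cU; have Bz := closure_sweep ss (splitsC h) zs cV.
    case: h => _ _ i _ _; have : (A `&` B) z by []; by rewrite i.
  have f'z : f^`().[z] != 0 by apply: ncrit; rewrite zs0 ltW.
  have lz' : 0 <= l < modulus f.[z] by rewrite l0 zs0 (le_lt_trans ls).
  have [d d0 hd] := level_join f'z lz'.
  have [x [sx [Ax [Bx [Ix sx1 hx Axx]]]] xz] := (closureC _ _).1 cU d d0.
  have [y [sy [Ay [By [Iy sy1 hy Ayy]]]] yz] := (closureC _ _).1 cV d d0.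
  have fx : modulus f.[x] <= sx.
    by case: hx => _ _ _ ux _; have : band sx x; [by rewrite -ux; left|move=> /andP[]].
  have fy : modulus f.[y] <= sy.
    by case: hy => _ _ _ uy _; have : band sy y; [by rewrite -uy; left|move=> /andP[]].
  rewrite zs0 in hd.
  have [s ss [T [cT Tx Ty Tb]]] := hd x y xz yz (le_lt_trans fx Ix) (le_lt_trans fy Iy).
  pose t := Num.max s (Num.max sx sy).
  have tI : s1 <= t < s0 by rewrite !le_max sx1 !orbT /= !gt_max ss (Ix : sx < s0) (Iy : sy < s0).
  have [A [B h]] := hg t tI.
  have xA : A x by apply: (splits_ge _ hx h Axx); rewrite sx1 !le_max lexx orbT.
  have yB : B y by apply: (splits_ge _ hy (splitsC h) Ayy); rewrite sy1 !le_max lexx !orbT.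
  case: h => cA cB i u _.
  have TAB : T `<=` A `|` B.
    by move=> w /Tb/andP[k1 k2]; rewrite u /band /= k1 !le_max k2.
  have [TA|TB] := connected_closed_split cT cA cB i TAB.
    by have : (A `&` B) y; [split=> //; exact: TA|rewrite i].
  by have : (A `&` B) x; [split=> //; exact: TB|rewrite i].
- rewrite -setIUr -closureU; apply/setIidPl => z bz; apply/closureC => r r0.
  have key w : l <= modulus f.[w] -> modulus f.[w] < s0 -> (sweep I U V `|` sweep I V U) w.
    move=> lw ws0; have [s [sI zs]] := lfz w ws0; have [A [B h]] := hg s sI.
    have : band s w by rewrite /band /= lw ltW.
    case: (h) => _ _ _ <- _ [Aw|Bw]; [left; exact: sweepI h sI Aw|right].
    exact: sweepI (splitsC h) sI Bw.
  move: bz => /andP[lz]; rewrite le_eqVlt => /predU1P[zs0|zs0]; last first.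
    by exists z; [exact: key|rewrite subrr modulus0].
  have /openC oz := open_horner sf (@open_disc _ z r).
  have [|e e0 he] := oz f.[z]; first by exists z => //; rewrite /disc /= subrr modulus0.
  (* At most [e / 2] so that the shrunken value is attained in the disc, at most [s0 - l] so that
     its modulus is still at least [l]. *)
  pose k := Num.min (e / 2) (s0 - l).
  have k0 : 0 < k by rewrite lt_min divr_gt0 //= subr_gt0 (le_lt_trans ls).
  have ke : k <= e / 2 by rewrite ge_min lexx.
  have kl : k <= s0 - l by rewrite ge_min lexx orbT.
  have ks : 1 - k / s0 = (s0 - k) / s0 by rewrite mulrBl divff // gt_eqF.
  have ks0 : 0 <= 1 - k / s0.
    by rewrite ks; apply: divr_ge0; [move: kl l0 => A1 A2; lra|exact: ltW].
  have [|w wz fw] := he (f.[z] * (1 - k / s0)%:C).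
    rewrite rmorphB /= rmorph1 mulrBr mulr1 addrC addKr modulusN modulusM modulus_real zs0.
    rewrite ger0_norm ?divr_ge0 ?(ltW k0) ?(ltW s00) // mulrCA divff ?gt_eqF // mulr1; lra.
  exists w => //; have mfw : modulus f.[w] = s0 - k.
    rewrite -[f.[w]]/(pfun f w) fw modulusM modulus_real zs0 ger0_norm //.
    by rewrite ks mulrCA divff ?gt_eqF // mulr1.
  by apply: key; rewrite mfw; lra.
- split; first exact: restr.
  exact: restr.
Qed.

(** Two complementary relatively clopen parts would both map onto [{l <= |w|}], hence both be
    unbounded; but the exterior of a large disc is connected and lies in only one of them. *)
Lemma connected_outside : connected [set z : C | l <= modulus f.[z]].
Proof.
have [c1 [c2 [r0 [c11 /andP[c20 c21] r01 h1 h2]]]] := horner_growth sf.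
pose rho := Num.max r0 (l / c2).
have rho0 : 0 <= rho by rewrite le_max; apply/orP; left; lra.
have far z : rho <= modulus z -> l <= modulus f.[z].
  rewrite ge_max => /andP[z1 z2]; apply: le_trans (h2 z z1).
  apply: (@le_trans _ _ (c2 * modulus z)); first by rewrite mulrC -ler_pdivrMr.
  rewrite ler_pM2l // -{1}(expr1 (modulus z)) ler_weXn2l //; first exact: le_trans r01 z1.
  by case: (size f) sf => [|[|k]].
have cE := connected_exterior rho0.
have cK := connected_exterior l0.
have unb B : pfun f @` B = [set w : C | l <= modulus w] -> ~ (B `<=` [set z : C | modulus z <= rho]).
  move=> hB sB; have [M M0 hM] := horner_bounded f rho.
  have : (pfun f @` B) (l + M + 1)%:C.
    rewrite hB /= modulus_real ger0_norm; last by rewrite !addr_ge0.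
    by rewrite -addrA lerDl addr_ge0.
  move=> [z /sB zr fz]; have := hM z zr; rewrite -[f.[z]]/(pfun f z) fz modulus_real.
  rewrite ger0_norm ?addr_ge0 //; have := l0; lra.
move=> B B0 [W oW BW] [F cF BF].
have onto : pfun f @` B = [set w : C | l <= modulus w].
  exact: (clopen_onto sf cK B0 oW cF BW BF).
apply: contrapT => nB.
have E : [set z : C | l <= modulus f.[z]] `&` ~` F = [set z : C | l <= modulus f.[z]] `&` ~` W.
  apply/seteqP; split=> z [Kz nz]; split=> //= Hz; apply: nz.
    have : B z by rewrite BW.
    by rewrite BF => -[].
  have : B z by rewrite BF.
  by rewrite BW => -[].
have B'0 : ([set z : C | l <= modulus f.[z]] `&` ~` F) !=set0.
  apply/set0P/eqP => h; apply: nB; rewrite BF; apply/setIidPl => z Kz.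
  by apply: contrapT => nF; have : ([set z : C | l <= modulus f.[z]] `&` ~` F) z by []; rewrite h.
have onto' := clopen_onto sf cK B'0 (closed_openC cF) (open_closedC oW) erefl E.
have cov : [set z : C | rho <= modulus z] `<=` W `|` ~` F.
  move=> z /far lz; have [Fz|nF] := pselect (F z); [left|by right].
  have : B z by rewrite BF.
  by rewrite BW => -[].
have EB : [set z : C | rho <= modulus z] `&` W = [set z : C | rho <= modulus z] `&` F.
  apply/seteqP; split=> z [rz Hz]; split=> //.
    have : B z by rewrite BW; split=> //; exact: far.
    by rewrite BF => -[].
  have : B z by rewrite BF; split=> //; exact: far.
  by rewrite BW => -[].
have [rW0|/set0P rW] := eqVneq ([set z : C | rho <= modulus z] `&` W) set0.
  apply: (unb _ onto) => z; rewrite BW => -[_ Wz] /=; rewrite leNgt; apply/negP => lt.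
  have : ([set z : C | rho <= modulus z] `&` W) z by split => //=; exact: ltW.
  by rewrite rW0.
have rWE : [set z : C | rho <= modulus z] `&` W = [set z : C | rho <= modulus z].
  by apply: cE => //; [exists W|exists F].
apply: (unb _ onto') => z [_ nF] /=; rewrite leNgt; apply/negP => lt; apply: nF.
have : ([set z : C | rho <= modulus z] `&` W) z by rewrite rWE /=; exact: ltW.
by rewrite EB => -[].
Qed.

(** A supremum argument on the levels reached by a separation: [splits_limit] includes the supremum
    and [splits_extend] passes beyond it. With every level reached, the two sweeps disconnect
    [{l <= |f|}]. *)
Lemma connected_band : connected (band s1).
Proof.
apply: contrapT => /(disconnected_compact (@compact_band s1)).
move=> [A [B [oA oB AB bAB [[a [ba Aa]] [b [bb Bb]]]]]].
have ABx z : A z -> B z -> False by move=> Az Bz; have : (A `&` B) z by []; rewrite AB.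
pose U := band s1 `&` ~` B; pose V := band s1 `&` ~` A.
have base : splits U V s1 U V.
  split; [by apply: closedI; [exact: closed_band|exact: open_closedC]..| | |].
  - by apply/seteqP; split=> // z [[bz nB] [_ nA]]; have [] := bAB z bz.
  - apply/seteqP; split=> [z [[]|[]]//|z bz].
    by have [Az|Bz] := bAB z bz; [left|right]; split=> // k; exact: (ABx z).
  - by split; apply/setIidPl => z [].
have Ua : U a by split=> // /(ABx a).
have Vb : V b by split=> // Ab; exact: (ABx b).
pose Good : set R := [set s | s1 <= s /\ exists U' V', splits U V s U' V'].
have Gs1 : Good s1 by split=> //; exists U, V.
have Gd s s' : s1 <= s' <= s -> Good s -> Good s'.
  move=> ss [_ [U' [V' h]]]; split; first by case/andP: ss.
  by exists (U' `&` band s'), (V' `&` band s'); exact: splits_sub h.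
have Gall s : s1 <= s -> Good s.
  move=> ss; apply: contrapT => nG.
  have ubG : ubound Good s.
    by move=> t Gt; rewrite leNgt; apply/negP => st; apply: nG; apply: Gd Gt; rewrite ss ltW.
  have sG : has_sup Good by split; [exists s1|exists s].
  have le0 : s1 <= sup Good by apply: sup_upper_bound.
  have lt_good t : s1 <= t < sup Good -> Good t.
    move=> /andP[t1 t2]; have e0 : 0 < sup Good - t by rewrite subr_gt0.
    have [u Gu] := sup_adherent e0 sG; rewrite subKr => tu.
    by apply: Gd Gu; rewrite t1 ltW.
  have [_ [A' [B' h]]] : Good (sup Good).
    move: le0; rewrite le_eqVlt => /predU1P[<-//|lt0]; split; first exact: ltW.
    by apply: splits_limit => // t /lt_good[].
  have [s' ss' [A2 [B2 h2]]] := splits_extend le0 h.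
  have : Good s' by split; [exact: le_trans le0 (ltW ss')|exists A2, B2].
  by move/(sup_upper_bound sG); rewrite leNgt ss'.
pose I := fun s : R => True.
have cS U2 V2 : (forall s, s1 <= s -> exists U' V', splits U2 V2 s U' V') -> closed (sweep I U2 V2).
  move=> hg z cz; pose t := Num.max s1 (modulus f.[z] + 1).
  have st : s1 <= t by rewrite le_max lexx.
  have zt : modulus f.[z] < t by rewrite lt_max ltrDl ltr01 orbT.
  have [A' [B' h]] := hg t st; have Az := closure_sweep st h zt cz.
  by exists t, A', B'; split.
have gU s : s1 <= s -> exists U' V', splits U V s U' V' by move=> /Gall[].
have gV s : s1 <= s -> exists U' V', splits V U s U' V'.
  by move=> /Gall[_ [A' [B' h]]]; exists B', A'; exact: splitsC.
have dis : sweep I U V `&` sweep I V U = set0.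
  apply/seteqP; split=> // z [[s [A1 [B1 [_ ss hs zs]]]] [t [A2 [B2 [_ st ht zt]]]]].
  have stm : s1 <= Num.max s t by rewrite le_max ss.
  have [A' [B' h]] := gU _ stm.
  have : (A' `&` B') z.
    split; [apply: (splits_ge _ hs h zs)|apply: (splits_ge _ ht (splitsC h) zt)].
      by rewrite ss le_max lexx.
    by rewrite st le_max lexx orbT.
  by case: h => _ _ -> _ _.
have cov : [set z : C | l <= modulus f.[z]] `<=` sweep I U V `|` sweep I V U.
  move=> z /= lz; pose t := Num.max s1 (modulus f.[z]).
  have st : s1 <= t by rewrite le_max lexx.
  have [A' [B' h]] := gU t st.
  have : band t z by rewrite /band /= lz le_max lexx orbT.
  case: (h) => _ _ _ <- _ [Az|Bz]; [left|right]; exists t.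
    by exists A', B'; split.
  by exists B', A'; split=> //; exact: splitsC.
have bo z : band s1 z -> [set z : C | l <= modulus f.[z]] z by move=> /andP[].
have Ua' : sweep I U V a by exists s1, U, V; split.
have Vb' : sweep I V U b by exists s1, V, U; split=> //; exact: splitsC.
have [h|h] := connected_closed_split connected_outside (cS _ _ gU) (cS _ _ gV) dis cov.
  have : (sweep I U V `&` sweep I V U) b by split=> //; apply: h; exact: bo.
  by rewrite dis.
have : (sweep I U V `&` sweep I V U) a by split=> //; apply: h; exact: bo.
by rewrite dis.
Qed.

End Splitting.

Lemma connected_sublevel (f : {poly R[i]}) (r : R) : (1 < size f)%N -> 0 < r ->
  (forall z, r <= modulus f.[z] -> f^`().[z] != 0) ->
  connected [set z : C | modulus f.[z] <= r].
Proof.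
move=> sf r0 nc; have -> : [set z : C | modulus f.[z] <= r] = band f 0 r.
  by apply/seteqP; split=> z; rewrite /band /= modulus_ge0.
by apply: connected_band => //; exact: ltW.
Qed.

(** The degenerate band [l = s1 = r]; this case is the reason why bands carry a lower bound [l]. *)
Lemma connected_level (f : {poly R[i]}) (r : R) : (1 < size f)%N -> 0 < r ->
  (forall z, r <= modulus f.[z] -> f^`().[z] != 0) ->
  connected [set z : C | modulus f.[z] = r].
Proof.
move=> sf r0 nc; have -> : [set z : C | modulus f.[z] = r] = band f r r.
  apply/seteqP; split=> z; rewrite /band /=; first by move=> ->; rewrite lexx.
  by move=> h; apply/eqP; rewrite eq_le andbC.
by apply: connected_band => //; exact: ltW.
Qed.

End Levels.

(** * A Harnack inequality for polynomials *)

Section Harnack.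
Context {R : realType}.
Implicit Types (z w x y : R[i]).
Local Notation C := (R[i]^o).
Local Open Scope complex_scope.

Lemma prim_root_ex n : (0 < n)%N -> exists z : R[i], n.-primitive_root z.
Proof.
move=> n0; have [s Dp] := closed_field_poly_normal ('X^n - 1 : {poly R[i]}).
rewrite (monicP _) ?monicXnsubC // scale1r in Dp.
have us : uniq s by rewrite -separable_prod_XsubC -Dp separable_Xn_sub_1 // pnatr_eq0 -lt0n.
have rs : all n.-unity_root s by apply/allP=> z; rewrite -root_prod_XsubC -Dp.
have ss : (n <= size s)%N by rewrite -ltnS -(size_prod_XsubC s id) -Dp size_XnsubC.
by have /hasP[z _ hz] := has_prim_root n0 rs us ss; exists z.
Qed.

Lemma sum_prim_root N (o : R[i]) e : N.-primitive_root o -> ~~ (N %| e)%N ->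
  \sum_(j < N) o ^+ (j * e) = 0.
Proof.
move=> po ne; have o1 : o ^+ e - 1 != 0 by rewrite subr_eq0 -(prim_order_dvd po).
apply: (mulfI o1); rewrite mulr0.
have -> : \sum_(j < N) o ^+ (j * e) = \sum_(j < N) (o ^+ e) ^+ j.
  by apply: eq_bigr => j _; rewrite mulnC exprM.
by rewrite -subrX1 -exprM mulnC exprM (prim_expr_order po) expr1n subrr.
Qed.

Lemma modulus_root_unity N (o : R[i]) : (0 < N)%N -> o ^+ N = 1 -> modulus o = 1.
Proof.
move=> N0 oN; apply/eqP; rewrite -(@pexpr_eq1 _ (modulus o) N) ?modulus_ge0 //.
  by rewrite -modulusX oN modulus1.
Qed.

Lemma ReD z w : complex.Re (z + w) = complex.Re z + complex.Re w.
Proof. by case: z w => [a b] [c d]. Qed.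

Lemma Re_sum (I : Type) (s : seq I) (F : I -> R[i]) :
  complex.Re (\sum_(i <- s) F i) = \sum_(i <- s) complex.Re (F i).
Proof. exact: (big_morph _ ReD). Qed.

Lemma conjcM z w : conjc (z * w) = conjc z * conjc w.
Proof. by rewrite rmorphM. Qed.

Lemma conjc1B z : conjc (1 - z) = 1 - conjc z.
Proof. by rewrite rmorphB rmorph1. Qed.

Lemma conjcX z n : conjc (z ^+ n) = conjc z ^+ n.
Proof. by rewrite rmorphXn. Qed.

Lemma conjc_sum (I : Type) (s : seq I) (F : I -> R[i]) :
  conjc (\sum_(i <- s) F i) = \sum_(i <- s) conjc (F i).
Proof. exact: rmorph_sum. Qed.

Lemma conjc_mul_modulus z : z * conjc z = (modulus z ^+ 2)%:C.
Proof. by rewrite -sqr_normc norm_modulus rmorphXn. Qed.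

(* Averaging over N-th roots of unity with N > 2n replaces Cauchy's formula. *)
Lemma caratheodory n (t : nat -> R[i]) (c r : R) : 0 < r ->
  (forall z, modulus z = r -> complex.Re (\sum_(k < n) t k * z ^+ k.+1) <= c) ->
  forall k, (k < n)%N -> modulus (t k) * r ^+ k.+1 <= 2 * c.
Proof.
(* The exponents [k.+1] of the sum and [- l.+1] of its conjugate, all at most [n] in absolute value,
   are then distinct modulo [N]. *)
move=> r0 h k kn; pose N := (2 * n).+1.
have [om po] := @prim_root_ex N (ltn0Sn _).
have oN := prim_expr_order po.
have mo : modulus om = 1 by apply: (@modulus_root_unity N).
have oJ : conjc om = om ^+ N.-1.
  have on0 : om != 0 by rewrite -modulus_gt0 mo.
  apply: (mulfI on0); rewrite conjc_mul_modulus mo expr1n -exprS oN; by rewrite rmorph1.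
pose A (j : nat) := \sum_(l < n) t l * (r%:C * om ^+ j) ^+ l.+1.
have mzj j : modulus (r%:C * om ^+ j) = r.
  by rewrite modulusM modulusX mo expr1n mulr1 modulus_real gtr0_norm.
have hA j : complex.Re (A j) <= c by apply: h.
have sA e : \sum_(j < N) om ^+ (j * e) * A j =
    \sum_(l < n) t l * r%:C ^+ l.+1 * \sum_(j < N) om ^+ (j * (e + l.+1)).
  rewrite (eq_bigr (fun j : 'I_N => \sum_(l < n) t l * r%:C ^+ l.+1 * om ^+ (j * (e + l.+1)))).
    by rewrite exchange_big /=; apply: eq_bigr => l _; rewrite mulr_sumr.
  move=> j _; rewrite mulr_sumr; apply: eq_bigr => l _.
  rewrite exprMn -exprM mulnDr exprD; ring.
have sAJ e : \sum_(j < N) om ^+ (j * e) * conjc (A j) =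
    \sum_(l < n) conjc (t l) * r%:C ^+ l.+1 * \sum_(j < N) om ^+ (j * (e + N.-1 * l.+1)).
  rewrite (eq_bigr (fun j : 'I_N => \sum_(l < n) conjc (t l) * r%:C ^+ l.+1 * om ^+ (j * (e + N.-1 * l.+1)))).
    by rewrite exchange_big /=; apply: eq_bigr => l _; rewrite mulr_sumr.
  move=> j _; rewrite /A conjc_sum mulr_sumr; apply: eq_bigr => l _.
  rewrite conjcM conjcX conjcM conjcX oJ conjc_real.
  rewrite exprMn -!exprM mulnDr exprD.
  have -> : (N.-1 * j * l.+1 = j * (N.-1 * l.+1))%N by lia.
  by ring.
have A0 : \sum_(j < N) A j = 0.
  have := sA 0%N; rewrite (eq_bigr (fun j : 'I_N => A j)) => [->|j _]; last first.
    by rewrite muln0 mul1r.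
  apply: big1 => l _; rewrite sum_prim_root ?mulr0 // add0n.
  by apply/negP => /dvdn_leq; have := ltn_ord l; rewrite /N; lia.
(* The weights are powers of the inverse of [om ^+ k.+1]: they pick the coefficient [t k] out of [A]
   and annihilate both the conjugate and the constant [2 * c]. *)
have main : \sum_(j < N) om ^+ (j * (N - k.+1)) * (A j + conjc (A j) - (2 * c)%:C) =
   N%:R * (t k * r%:C ^+ k.+1).
  rewrite (eq_bigr (fun j : 'I_N => om ^+ (j * (N - k.+1)) * A j + om ^+ (j * (N - k.+1)) * conjc (A j)
     - om ^+ (j * (N - k.+1)) * (2 * c)%:C)); last by move=> j _; rewrite mulrBr mulrDr.
  rewrite sumrB big_split /= -mulr_suml sA sAJ.
  rewrite (sum_prim_root po) ?mul0r ?subr0; last first.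
    by apply/negP => /dvdn_leq; rewrite /N; lia.
  rewrite [X in _ + X]big1 ?addr0; last first.
    move=> l _; rewrite (sum_prim_root po) ?mulr0 //.
    apply/negP => d; have : (N %| (N - k.+1 + N.-1 * l.+1) + (k.+1 + l.+1))%N.
      have -> : (N - k.+1 + N.-1 * l.+1 + (k.+1 + l.+1) = N * l.+2)%N by rewrite /N; lia.
      exact: dvdn_mulr.
    rewrite dvdn_addr // => /dvdn_leq; have := ltn_ord l; rewrite /N; lia.
  rewrite (bigD1 (Ordinal kn)) //= [X in _ + X]big1 ?addr0; last first.
    move=> l lk; rewrite (sum_prim_root po) ?mulr0 //; apply/negP => /dvdnP[q].
    have lk' : (l : nat) != k by apply: contra lk => /eqP e; apply/eqP/val_inj.
    have := ltn_ord l; rewrite /N; case: q => [|[|q]] *; [lia|lia|].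
    have : ((2 * n).+1 * 2 <= q.+2 * (2 * n).+1)%N by nia.
    lia.
  have e1 : \sum_(j < N) om ^+ (j * (N - k.+1 + k.+1)) = N%:R.
    transitivity (\sum_(j < N) (1 : R[i])); last by rewrite sumr_const card_ord.
    apply: eq_bigr => j _.
    by rewrite subnK ?[(j * N)%N]mulnC ?exprM ?oN ?expr1n // /N; lia.
  by rewrite e1 mulrC.
(* The real numbers [2 Re (A j) - 2 c] are nonpositive and [A] has mean zero, so their absolute
   values sum to exactly [N * (2 * c)]. *)
have bound : N%:R * (modulus (t k) * r ^+ k.+1) <= N%:R * (2 * c).
  have -> : N%:R * (modulus (t k) * r ^+ k.+1) = modulus (N%:R * (t k * r%:C ^+ k.+1)).
    by rewrite !modulusM modulusX modulus_nat modulus_real gtr0_norm.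
  rewrite -main; apply: (le_trans (modulus_sum _ _)).
  apply: (@le_trans _ _ (\sum_(j < N) (2 * c - 2 * complex.Re (A j)))).
    apply: ler_sum => j _; rewrite modulusM modulusX mo expr1n mul1r addcJ.
    rewrite -(rmorph_nat (real_complex R)) -rmorphM -rmorphB /= modulus_real ler0_norm.
      by rewrite opprB.
    by have := hA j; lra.
  rewrite sumrB sumr_const card_ord -[(2 * c) *+ N]mulr_natl -mulr_sumr.
  have -> : \sum_(j < N) complex.Re (A j) = complex.Re (\sum_(j < N) A j).
    by rewrite Re_sum.
  by rewrite A0 (_ : complex.Re (0 : R[i]) = 0) // mulr0 subr0.
by move: bound; rewrite ler_pM2l ?ltr0n.
Qed.

Lemma Re_realM (c : R) z : complex.Re (c%:C * z) = c * complex.Re z.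
Proof. by case: z => a b; rewrite /= mul0r subr0. Qed.

(** The Taylor remainder of [ln |1 - x|] without a complex logarithm: [q.[t] = |1 - t x|^2] and the
    partial sum [s] are real polynomials in [t], and the mean value theorem on [[0, 1]] meets the
    derivative [- Re (x (t x)^n / (1 - t x))]. *)
Lemma ln_modulus_approx n x (rho : R) : rho < 1 -> modulus x <= rho ->
  `|ln (modulus (1 - x)) + complex.Re (\sum_(k < n) (k.+1%:R^-1)%:C * x ^+ k.+1)|
    <= rho ^+ n.+1 / (1 - rho).
Proof.
move=> rho1 xr; have rho0 : 0 <= rho := le_trans (modulus_ge0 x) xr.
pose q : {poly R} := 1 - (2 * complex.Re x) *: 'X + (modulus x ^+ 2) *: 'X^2.
pose s : {poly R} := \sum_(k < n) (k.+1%:R^-1 * complex.Re (x ^+ k.+1)) *: 'X^(k.+1).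
have qE t : q.[t] = modulus (1 - t%:C * x) ^+ 2.
  apply: complexI; rewrite -conjc_mul_modulus.
  have -> : conjc (1 - t%:C * x) = 1 - t%:C * conjc x.
    by rewrite conjc1B conjcM conjc_real.
  have -> : (1 - t%:C * x) * (1 - t%:C * conjc x) =
    1 - t%:C * (x + conjc x) + t%:C ^+ 2 * (x * conjc x) by ring.
  rewrite conjc_mul_modulus addcJ.
  have -> : q.[t] = 1 - t * (2 * complex.Re x) + t ^+ 2 * modulus x ^+ 2.
    by rewrite /q !hornerE /=; ring.
  rewrite (rmorphD (real_complex R)) (rmorphB (real_complex R)) rmorph1.
  rewrite (rmorphM _ t) (rmorphM _ 2) (rmorphM _ (t ^+ 2)) (rmorphXn _ 2%N t).
  by rewrite (rmorph_nat (real_complex R)).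
have q0 (t : R) : 0 <= t <= 1 -> 0 < modulus (1 - t%:C * x).
  move=> /andP[t0 t1]; apply: lt_le_trans (le_modulusB _ _).
  rewrite modulus1 modulusM modulus_real ger0_norm // subr_gt0.
  apply: le_lt_trans rho1; apply: le_trans xr.
  by rewrite ler_piMl // modulus_ge0.
pose phi (t : R) := 2^-1 * ln q.[t] + s.[t].
pose dphi (t : R) := 2^-1 * (q.[t]^-1 * q^`().[t]) + s^`().[t].
have dP (t : R) : 0 <= t <= 1 -> is_derive t (1 : R) phi (dphi t).
  move=> t01; have qt0 : 0 < q.[t] by rewrite qE exprn_gt0 // q0.
  have d1 : is_derive t (1 : R) ((@ln R : R -> R) \o horner q) (q.[t]^-1 * q^`().[t]).
    have := is_derive1_ln qt0 => dl.
    exact: is_derive1_comp.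
  have d2 := is_deriveZ (2^-1 : R) d1.
  exact: is_deriveD d2 (is_derive_poly s t).
have [|||c c01 hc] := @MVT_segment R phi dphi 0 1.
- exact: ler01.
- by move=> t; rewrite in_itv /= => /andP[t0 t1]; apply: dP; rewrite !ltW.
- apply: continuous_in_subspaceT => t; rewrite inE /= in_itv /= => t01.
  have [dt _] := dP t t01.
  exact/differentiable_continuous/derivable1_diffP.
have phi0 : phi 0 = 0.
  rewrite /phi qE mul0r subr0 modulus1 expr1n ln1 mulr0 add0r /s horner_sum big1 // => k _.
  by rewrite hornerZ hornerXn expr0n mulr0.
have phi1 : phi 1 = ln (modulus (1 - x)) + complex.Re (\sum_(k < n) (k.+1%:R^-1)%:C * x ^+ k.+1).
  rewrite /phi qE rmorph1 mul1r; congr (_ + _).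
    have := q0 1; rewrite rmorph1 mul1r ler01 lexx => /(_ isT) m0.
    rewrite lnXn //; lra.
  rewrite /s horner_sum Re_sum; apply: eq_bigr => k _.
  by rewrite hornerZ hornerXn expr1n mulr1 Re_realM.
move: hc; rewrite phi0 phi1 !subr0 mulr1 => ->.
move: c01; rewrite in_itv /= => c01; have m0 := q0 c c01.
set y := 1 - c%:C * x in m0.
have y0 : y != 0 by rewrite -modulus_gt0.
have -> : dphi c = - complex.Re (x * (c%:C * x) ^+ n / y).
  have sE : s^`().[c] = complex.Re (x * ((1 - (c%:C * x) ^+ n) / y)).
    have -> : (1 - (c%:C * x) ^+ n) / y = \sum_(k < n) (c%:C * x) ^+ k.
      apply: (mulIf y0); rewrite divfK // -opprB subrX1 -mulNr opprB mulrC; congr (_ * _).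
    rewrite mulr_sumr Re_sum /s raddf_sum horner_sum; apply: eq_bigr => k _ /=.
    rewrite derivZ derivXn hornerZ hornerMn hornerXn /=.
    have -> : x * (c%:C * x) ^+ k = (c ^+ k)%:C * x ^+ k.+1.
      by rewrite exprMn rmorphXn exprS /=; ring.
    rewrite Re_realM -mulr_natr; have k0 : k.+1%:R != 0 :> R by rewrite pnatr_eq0.
    by field.
  have qE2 : 2^-1 * (q.[c]^-1 * q^`().[c]) = - complex.Re (x / y).
    have -> : x / y = (q.[c]^-1)%:C * (x * conjc y).
      rewrite qE -/y fmorphV /= -conjc_mul_modulus.
      have cy0 : conjc y != 0 by rewrite conjc_eq0.
      by field; rewrite y0 cy0.
    have -> : x * conjc y = x - (c * modulus x ^+ 2)%:C.
      have -> : (c * modulus x ^+ 2)%:C = c%:C * (x * conjc x) by rewrite conjc_mul_modulus rmorphM.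
      by rewrite /y conjc1B conjcM conjc_real; ring.
    have q'E : q^`().[c] = 2 * (c * modulus x ^+ 2) - 2 * complex.Re x.
      rewrite /q derivD derivB !derivZ derivX derivXn derivC !hornerE /=; ring.
    have q00 : q.[c] != 0 by rewrite qE expf_neq0 // gt_eqF.
    rewrite Re_realM ReD q'E /= ; move: q.[c] q00 => Q Q0.
    by field.
  rewrite /dphi qE2 sE.
  have -> : x * ((1 - (c%:C * x) ^+ n) / y) = x / y + - (x * (c%:C * x) ^+ n / y) by field.
  rewrite ReD addKr; by case: (x * _ / _).
rewrite normrN; apply: (le_trans (modulus_Re _)).
rewrite modulusM modulusV modulusM modulusX modulusM modulus_real.
move: c01 => /andP[c0 c1]; rewrite ger0_norm //.
have cx : c * modulus x <= rho by apply: le_trans xr; rewrite ler_piMl ?modulus_ge0.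
have cx0 : 0 <= c * modulus x by rewrite mulr_ge0 ?modulus_ge0.
apply: ler_pM; rewrite ?invr_ge0 ?mulr_ge0 ?exprn_ge0 ?modulus_ge0 ?(ltW m0) //.
  by rewrite exprS ler_pM ?exprn_ge0 ?modulus_ge0 // lerXn2r ?nnegrE.
rewrite lef_pV2 ?posrE ?subr_gt0 //.
apply: le_trans (le_modulusB _ _); rewrite modulus1 modulusM modulus_real ger0_norm //.
by rewrite lerD2l lerN2.
Qed.

Lemma small_expr (rho e : R) : 0 <= rho -> rho < 1 -> 0 < e -> exists n, rho ^+ n < e.
Proof.
move=> rho0 rho1 e0.
have h : `|rho| < 1 by rewrite ger0_norm.
have /cvgrPdist_lt/(_ _ e0)[N _ hN] := cvg_expr h.
exists N; have := hN N (leqnn N).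
by rewrite /= sub0r normrN ger0_norm ?exprn_ge0.
Qed.

Lemma sum_half_pow n : \sum_(k < n) (2^-1 : R) ^+ k.+1 <= 1.
Proof.
suff -> : \sum_(k < n) (2^-1 : R) ^+ k.+1 = 1 - 2^-1 ^+ n.
  by rewrite lerBlDr lerDl exprn_ge0 // invr_ge0.
elim: n => [|n IH]; first by rewrite big_ord0 expr0 subrr.
rewrite big_ord_recr /= IH exprS; lra.
Qed.

(** The members of [s] stand for reciprocals of roots, so that [l] plus the sum is [ln |f|], up to
    [eta] the real part of [l - A] for a polynomial [A]. [caratheodory] bounds its coefficients by
    [2 (l + eta) / r^k], and on the half disc the geometric series sums to at most [1]; the total is
    [l + 2 (l + eta) + eta]. *)
Lemma harnack_approx (s : seq R[i]) (r l eta : R) : 0 < r -> 0 < eta ->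
  (forall b, b \in s -> modulus b * r < 1) ->
  (forall z, modulus z <= r -> 0 <= l + \sum_(b <- s) ln (modulus (1 - z * b))) ->
  forall z, modulus z <= r / 2 ->
    l + \sum_(b <- s) ln (modulus (1 - z * b)) <= 3 * l + 3 * eta.
Proof.
move=> r0 eta0 sr hpos.
have [rho [rho0 rho1 hrho]] : exists rho : R, [/\ 0 <= rho, rho < 1 &
    forall b, b \in s -> modulus b * r <= rho].
  elim: s sr {hpos} => [|b s IH] h; first by exists 0.
  have [rho [r1 r2 r3]] := IH (fun c cs => h c (@mem_behead _ (b :: s) _ cs)).
  exists (Num.max rho (modulus b * r)); split.
  - by rewrite le_max r1.
  - by rewrite gt_max r2 h ?mem_head.
  - move=> c; rewrite in_cons => /orP[/eqP->|/r3 cr]; first by rewrite le_max lexx orbT.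
    by rewrite le_max cr.
pose D : R := (size s)%:R.
have D0 : 0 <= D by rewrite ler0n.
have e0 : 0 < eta * (1 - rho) / (D + 1).
  by rewrite divr_gt0 ?mulr_gt0 ?subr_gt0 // ltr_wpDl.
have [n hn] := small_expr rho0 rho1 e0.
pose eps := rho ^+ n.+1 / (1 - rho).
have rh0 : 0 < 1 - rho by rewrite subr_gt0.
have epsD : D * eps <= eta.
  have h1 : rho ^+ n.+1 <= rho ^+ n by rewrite exprS ler_piMl ?exprn_ge0 // ltW.
  have : rho ^+ n.+1 * (D + 1) <= eta * (1 - rho).
    by rewrite -ler_pdivlMr ?ltr_wpDl // (le_trans h1) // ltW.
  have p0 : 0 <= rho ^+ n.+1 by rewrite exprn_ge0.
  by rewrite /eps mulrA ler_pdivrMr // => h2; nra.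
pose t (k : nat) := \sum_(b <- s) (k.+1%:R^-1)%:C * b ^+ k.+1.
pose A z := \sum_(k < n) t k * z ^+ k.+1.
have approx z : modulus z <= r ->
    `|\sum_(b <- s) ln (modulus (1 - z * b)) + complex.Re (A z)| <= eta.
  move=> zr.
  have -> : A z = \sum_(b <- s) \sum_(k < n) (k.+1%:R^-1)%:C * (z * b) ^+ k.+1.
    rewrite exchange_big /=; apply: eq_bigr => k _; rewrite /t mulr_suml.
    by apply: eq_bigr => b _; rewrite exprMn; ring.
  rewrite Re_sum -big_split /=; apply: le_trans epsD.
  apply: (le_trans (ler_norm_sum _ _ _)).
  have -> : D * eps = \sum_(b <- s) eps.
    by rewrite big_const_seq count_predT iter_addr_0 mulr_natl.
  rewrite big_seq [leRHS]big_seq; apply: ler_sum => b bs.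
  apply: ln_modulus_approx => //; rewrite modulusM.
  by apply: le_trans (hrho b bs); rewrite mulrC ler_wpM2l ?modulus_ge0.
have tb := @caratheodory n t (l + eta) r r0.
have {}tb k : (k < n)%N -> modulus (t k) * r ^+ k.+1 <= 2 * (l + eta).
  apply: tb => z zr; have zr' : modulus z <= r by rewrite zr.
  have := approx z zr'; rewrite ler_norml -/(A z) => /andP[a1 a2].
  have := hpos z zr'; lra.
move=> z zr2; have zr : modulus z <= r by apply: le_trans zr2 _; rewrite ler_pdivrMr //; lra.
have := approx z zr; rewrite ler_norml => /andP[_ a2].
have c0 : 0 <= 2 * (l + eta).
  have hp0 := hpos 0; rewrite modulus0 (ltW r0) in hp0.
  have : \sum_(b <- s) ln (modulus (1 - 0 * b)) = 0 :> R.
    by apply: big1 => b _; rewrite mul0r subr0 modulus1 ln1.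
  move=> e; move: (hp0 isT); rewrite e; lra.
have : - (2 * (l + eta)) <= complex.Re (A z).
  rewrite lerNl; apply: le_trans (_ : modulus (A z) <= _).
    by apply: le_trans (modulus_Re _); rewrite -normrN ler_norm.
  apply: (le_trans (modulus_sum _ _)).
  apply: (@le_trans _ _ (\sum_(k < n) 2 * (l + eta) * 2^-1 ^+ k.+1)).
    apply: ler_sum => k _; rewrite modulusM modulusX.
    apply: (@le_trans _ _ (modulus (t k) * (r / 2) ^+ k.+1)).
      by rewrite ler_wpM2l ?modulus_ge0 // lerXn2r ?nnegrE ?modulus_ge0 // divr_ge0 // ltW.
    by rewrite exprMn mulrA ler_wpM2r ?tb // exprn_ge0 // invr_ge0.
  rewrite -mulr_sumr; have := sum_half_pow n; set S := \sum_(k < n) _ => S1.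
  nra.
lra.
Qed.

(** The exponent [3 = (1 + 1/2) / (1 - 1/2)] is the Harnack constant of the half disc for the
    nonnegative harmonic function [ln |f|]. It does not depend on the degree, so [f] may be a high
    iterate. *)
Lemma harnack (f : {poly R[i]}) z0 (r : R) : 0 < r ->
  (forall z, modulus (z - z0) <= r -> 1 <= modulus f.[z]) ->
  forall z, modulus (z - z0) <= r / 2 -> modulus f.[z] <= modulus f.[z0] ^+ 3.
Proof.
move=> r0 h z zr.
have h0 : 1 <= modulus f.[z0] by apply: h; rewrite subrr modulus0 ltW.
have [sf|sf] := leqP (size f) 1.
  by rewrite (size1_polyC sf) !hornerC in h0 *; rewrite ler_eXnr.
have [s ss hs] := modulus_poly_roots 0 sf.
have fE y : modulus f.[y] = modulus (lead_coef f) * \prod_(a <- s) modulus (y - a).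
  by rewrite -hs subr0.
have sfar a : a \in s -> r < modulus (a - z0).
  move=> as_; rewrite ltNge; apply/negP => /h; rewrite fE (big_rem a) //= subrr modulus0 mul0r mulr0.
  by rewrite leNgt ltr01.
have sn0 a : a \in s -> modulus (a - z0) != 0 by move=> /sfar ar; rewrite gt_eqF // (lt_trans r0).
pose bs := [seq (a - z0)^-1 | a <- s].
have ratio y : \prod_(b <- bs) modulus (1 - (y - z0) * b) = modulus f.[y] / modulus f.[z0].
  have n0 : modulus f.[z0] != 0 by rewrite gt_eqF // (lt_le_trans ltr01).
  apply: (mulIf n0); rewrite divfK // !fE mulrCA; congr (_ * _).
  rewrite /bs big_map -big_split /= big_seq [RHS]big_seq; apply: eq_bigr => a as_.
  rewrite (modulusBC z0) -modulusM (modulusBC y); congr modulus.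
  have : a - z0 != 0 by rewrite -modulus_eq0 sn0.
  by move=> n; field.
have lnE y : modulus (y - z0) <= r -> ln (modulus f.[z0]) + \sum_(b <- bs) ln (modulus (1 - (y - z0) * b)) =
    ln (modulus f.[y]).
  move=> yr; have fy := h y yr.
  have pos b : b \in bs -> 0 < modulus (1 - (y - z0) * b).
    move=> /mapP[a as_ ->]; apply: lt_le_trans (le_modulusB _ _).
    rewrite modulus1 modulusM modulusV subr_gt0 ltr_pdivrMr ?mul1r.
      by apply: le_lt_trans yr _; exact: sfar.
    by apply: lt_trans (sfar _ as_).
  have -> : \sum_(b <- bs) ln (modulus (1 - (y - z0) * b)) = ln (\prod_(b <- bs) modulus (1 - (y - z0) * b)).
    elim: (bs) pos => [|b t IH] pos; first by rewrite !big_nil ln1.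
    have pt c : c \in t -> 0 < modulus (1 - (y - z0) * c) by move=> ct; apply: pos; rewrite in_cons ct orbT.
    rewrite !big_cons IH // lnM // posrE; first by apply: pos; rewrite mem_head.
    by rewrite big_seq; apply: prodr_gt0.
  rewrite ratio ln_div ?posrE ?(lt_le_trans ltr01) // addrC subrK //.
have zr' : modulus (z - z0) <= r by apply: le_trans zr _; rewrite ler_pdivrMr //; lra.
have fz := h z zr'.
have p0 : 0 < modulus f.[z0] by apply: lt_le_trans h0.
rewrite -ler_ln ?posrE ?exprn_gt0 // ?(lt_le_trans ltr01) // lnXn //.
apply/ler_addgt0Pr => e e0.
have e30 : 0 < e / 3 by rewrite divr_gt0.
have := @harnack_approx bs r (ln (modulus f.[z0])) (e / 3) r0 e30 _ _ (z - z0) zr.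
rewrite lnE // => H; apply: (le_trans (H _ _)).
- move=> b /mapP[a as_ ->]; rewrite modulusV mulrC ltr_pdivrMr ?mul1r ?sfar //.
  by apply: lt_trans (sfar _ as_).
- move=> y yr; have := lnE (y + z0); rewrite addrK => /(_ yr) ->.
  by rewrite ln_ge0 // h // addrK.
- rewrite -[_ *+ 3]mulr_natl; lra.
Qed.

End Harnack.

(** * Filled Julia sets *)

Section Escape.
Context {R : realType}.
Implicit Types (z w x y : R[i]) (p u v f : {poly R[i]}).
Local Notation C := (R[i]^o).
Local Open Scope complex_scope.

Definition pit p n : {poly R[i]} := iter n (fun q => p \Po q) 'X.

Lemma horner_pit p n z : (pit p n).[z] = iter n (horner p) z.
Proof. by elim: n => [|n IH]; rewrite /pit /= ?hornerX // horner_comp -/(pit p n) IH. Qed.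

Lemma size_comp_gt1 p f : (1 < size p)%N -> (1 < size f)%N -> (1 < size (p \Po f))%N.
Proof.
move=> sp sf; have h := size_comp_poly p f.
have : (0 < (size p).-1 * (size f).-1)%N by rewrite muln_gt0; lia.
by rewrite -h; case: (size _) => [|[|]].
Qed.

Definition escaping p (r : R) := 1 <= r /\ forall z, r <= modulus z -> 2 * modulus z <= modulus p.[z].

(** An orbit that exceeds an escape radius tends to infinity, so under [escaping p r] these are the
    points of bounded orbit: the filled Julia set. *)
Definition filled p r : set C := [set z | forall n, modulus (iter n (horner p) z) <= r].

(** The boundary of [D] when [D] is closed; for a filled set it is the Julia set. *)
Definition frontier (D : set C) : set C := D `&` ~` D^°.

Section OneMap.
Variables (p : {poly R[i]}) (r0 : R).
Hypothesis sp : (2 < size p)%N.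
Hypothesis esc : escaping p r0.

Let sp1 : (1 < size p)%N. Proof. exact: ltnW. Qed.

Lemma escape_iter z n : r0 <= modulus z -> 2 ^+ n * modulus z <= modulus (iter n (horner p) z).
Proof.
move=> zr; have z0 : 0 <= modulus z := modulus_ge0 z.
elim: n => [|n IH]; first by rewrite expr0 mul1r.
rewrite iterS exprS -mulrA; apply: le_trans (esc.2 _ _); last first.
  apply: le_trans IH; apply: (le_trans zr); rewrite ler_peMl // exprn_ege1 //; lra.
by rewrite ler_pM2l.
Qed.

Lemma escape_mono z n m M : (n <= m)%N -> r0 <= M -> M < modulus (iter n (horner p) z) ->
  M < modulus (iter m (horner p) z).
Proof.
move=> nm rM h; rewrite -(subnK nm) iterD.
have h1 : r0 <= modulus (iter n (horner p) z) by apply: le_trans rM (ltW h).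
apply: lt_le_trans (escape_iter (m - n) h1); apply: (lt_le_trans h).
rewrite ler_peMl ?modulus_ge0 // exprn_ege1 //; lra.
Qed.

Lemma filledPn z M : ~ filled p r0 z -> exists N, forall n, (N <= n)%N -> M < modulus (iter n (horner p) z).
Proof.
move=> /existsNP[n /negP]; rewrite -ltNge => hn.
pose w := iter n (horner p) z.
have r1 : 1 <= r0 := esc.1.
pose k := Num.bound `|M|.
exists (n + k)%N => m nm.
have hk : M < 2 ^+ k.
  apply: (le_lt_trans (ler_norm _)); apply: (lt_le_trans (archi_boundP (normr_ge0 _))).
  by rewrite -natrX ler_nat ltnW // ltn_expl.
have nm' : (n <= m)%N by apply: leq_trans nm; rewrite leq_addr.
rewrite -(subnK nm') iterD.
have := @escape_iter w (m - n)%N (ltW hn); apply: lt_le_trans.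
apply: (lt_le_trans hk); apply: (@le_trans _ _ (2 ^+ (m - n) * 1)).
  rewrite mulr1 ler_weXn2l //; [lra|by rewrite leq_subRL // addnC in nm *; rewrite addnC].
rewrite ler_pM2l ?exprn_gt0 // (le_trans r1) // ltW //.
Qed.

Lemma bounded_filled z M : (forall n, modulus (iter n (horner p) z) <= M) -> filled p r0 z.
Proof.
move=> h; apply: contrapT => /(@filledPn z M)[N hN].
by have := h N; rewrite leNgt hN.
Qed.

Lemma filled_invariant z : filled p r0 p.[z] <-> filled p r0 z.
Proof.
split=> h; last by move=> n; rewrite -iterSr.
have h0 : forall n, modulus (iter n (horner p) z) <= Num.max (modulus z) r0.
  by move=> [|n]; rewrite le_max ?lexx // iterSr h orbT.
exact: (bounded_filled h0).
Qed.

Lemma filled_preimage : pfun p @^-1` filled p r0 = filled p r0.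
Proof. by apply/seteqP; split=> z /filled_invariant. Qed.

Lemma filled_iter z n : filled p r0 (iter n (horner p) z) <-> filled p r0 z.
Proof. by elim: n => [//|n IH]; rewrite iterS filled_invariant. Qed.

Lemma filled_modulus z : filled p r0 z -> modulus z <= r0.
Proof. by move/(_ 0%N). Qed.

Lemma escape_near z M : ~ filled p r0 z -> exists2 d : R, 0 < d &
  exists N, forall n w, (N <= n)%N -> modulus (w - z) < d -> M < modulus (iter n (horner p) w).
Proof.
move=> nz; pose M' := Num.max M r0.
have [N /(_ N (leqnn N)) hN] := filledPn M' nz.
have e0 : 0 < modulus (iter N (horner p) z) - M' by rewrite subr_gt0.
have [d d0 hd] := horner_continuousC (pit p N) z e0.
exists d => //; exists N => n w Nn wd.
apply: (@le_lt_trans _ _ M'); first by rewrite le_max lexx.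
apply: (escape_mono Nn); first by rewrite le_max lexx orbT.
have := hd w wd; rewrite !horner_pit modulusBC.
have := le_modulusB (iter N (horner p) z) (iter N (horner p) w) => A B; lra.
Qed.

Lemma closed_filled : closed (filled p r0).
Proof.
apply/closedC => z nz; have [d d0 [N hN]] := escape_near r0 nz.
exists d => // w wd fw; have := hN N w (leqnn N) wd.
by rewrite ltNge fw.
Qed.

Lemma compact_filled : compact (filled p r0).
Proof. exact: compact_closed_bounded closed_filled filled_modulus. Qed.

Lemma escape_compact (S : set C) M : compact S -> (forall z, S z -> ~ filled p r0 z) ->
  exists N, forall n z, (N <= n)%N -> S z -> M < modulus (iter n (horner p) z).
Proof.
move=> cS hS; apply: contrapT => h.
have hk k : exists z, S z /\ exists2 n, (k <= n)%N & modulus (iter n (horner p) z) <= M.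
  apply: contrapT => hn; apply: h; exists k => n z kn Sz; rewrite ltNge; apply/negP => le.
  by apply: hn; exists z; split=> //; exists n.
have [u hu] := choice hk.
have [z Sz hz] := compact_cluster_seq cS (fun k => (hu k).1).
have [d d0 [N hN]] := escape_near M (hS z Sz).
have [k Nk kz] := hz d d0 N; have [n kn le] := (hu k).2.
by have := hN n (u k) (leq_trans Nk kn) kz; rewrite ltNge le.
Qed.

Lemma frontier_escape z r : frontier (filled p r0) z -> 0 < r ->
  exists2 w, modulus (w - z) < r & ~ filled p r0 w.
Proof.
move=> [Kz nz] r00; apply: contrapT => h; apply: nz.
apply/nbhsC; exists r => // w wr; apply: contrapT => nw; apply: h; by exists w.
Qed.

(** The factors [c1] and [c2] are carried along so that the estimates reproduce under iteration:
    [c1 * c1 <= c1 ^ d] and [c2 ^ d <= c2 * c2] for degree [d >= 2]. Both bounds have the same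
    exponent [d ^ n]. *)
Lemma iter_growth : exists c1 c2 rho : R, [/\ 1 <= c1, 0 < c2 <= 1, r0 <= rho,
    forall A n w, 1 <= A -> modulus w <= A -> c1 * modulus (iter n (horner p) w) <= (c1 * A) ^+ ((size p).-1 ^ n)
  & forall n w, rho <= modulus w -> (c2 * modulus w) ^+ ((size p).-1 ^ n) <= c2 * modulus (iter n (horner p) w)].
Proof.
have [c1 [c2 [r1 [c11 /andP[c20 c21] r11 up low]]]] := horner_growth sp1.
set d := (size p).-1; have d2 : (2 <= d)%N by rewrite /d; lia.
have [e de] : exists e, d = e.+2 by exists (d - 2)%N; lia.
exists c1, c2, (Num.max r1 r0); split=> //.
- by rewrite c20.
- by rewrite le_max lexx orbT.
- move=> A n w A1 wA.
  have cA : 1 <= c1 * A by nra.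
  have key k : c1 * Num.max 1 (modulus (iter k (horner p) w)) <= (c1 * A) ^+ (d ^ k).
    elim: k => [|k IH]; first by rewrite expn0 expr1 /= ler_pM2l ?(lt_le_trans ltr01) // ge_max A1.
    set m := Num.max 1 _ in IH; have m1 : 1 <= m by rewrite le_max lexx.
    rewrite maxr_pMr; last lra.
    rewrite mulr1 ge_max iterS; apply/andP; split.
      apply: (@le_trans _ _ (c1 * A)); first by nra.
      by apply: ler_eXnr => //; rewrite expn_gt0; lia.
    apply: (@le_trans _ _ (c1 * (c1 * m ^+ d))); first by rewrite ler_pM2l ?(lt_le_trans ltr01) // up.
    apply: (@le_trans _ _ ((c1 * m) ^+ d)).
      rewrite exprMn mulrA ler_wpM2r ?exprn_ge0 //; first lra.
      rewrite de !exprS mulrA ler_peMr //; first by nra.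
      by rewrite exprn_ege1.
    by rewrite expnS mulnC exprM lerXn2r ?nnegrE ?exprn_ge0 //; nra.
  apply: le_trans (key n); rewrite ler_pM2l ?(lt_le_trans ltr01) //.
  by rewrite le_max lexx orbT.
- move=> n w; rewrite ge_max => /andP[wr1 wr0].
  have far k : modulus w <= modulus (iter k (horner p) w).
    apply: le_trans (escape_iter k wr0); rewrite ler_peMl ?modulus_ge0 // exprn_ege1 //; lra.
  elim: n => [|n IH]; first by rewrite expn0 expr1.
  rewrite iterS expnS mulnC exprM.
  apply: (@le_trans _ _ ((c2 * modulus (iter n (horner p) w)) ^+ d)).
    by rewrite lerXn2r ?nnegrE ?exprn_ge0 ?mulr_ge0 ?modulus_ge0 // ltW.
  apply: (@le_trans _ _ (c2 * (c2 * modulus (iter n (horner p) w) ^+ d))).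
    rewrite exprMn mulrA ler_wpM2r ?exprn_ge0 ?modulus_ge0 //.
    rewrite de !exprS mulrA ler_piMr ?mulr_ge0 ?(ltW c20) //.
    by rewrite exprn_ile1 // ltW.
  by rewrite ler_pM2l // low // (le_trans wr1).
Qed.

(* Either [u] maps the disc into the filled set, or some p^N o u has modulus at
   least 1 there and Harnack's inequality applies to it; the growth estimates
   then allow extracting a root of order d^N independently of N. *)
Lemma avoid_bounded (A : R) : exists B : R, forall u z0 r, 0 < r ->
  (forall z, modulus (z - z0) < r -> ~ frontier (filled p r0) u.[z]) ->
  modulus u.[z0] <= A -> forall z, modulus (z - z0) <= r / 4 -> modulus u.[z] <= B.
Proof.
have [c1 [c2 [rho [c11 /andP[c20 c21] rrho up low]]]] := iter_growth.
pose A' := Num.max 1 A.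
have A'1 : 1 <= A' by rewrite le_max lexx.
pose B := Num.max rho ((c1 * A') ^+ 3 / c2).
exists B => u z0 r r00 av uA z zr.
have r20 : 0 < r / 2 by rewrite divr_gt0.
have sub x s : s < r -> modulus (x - z0) <= s -> modulus (x - z0) < r.
  by move=> sr xs; apply: le_lt_trans sr.
have [meet|dis] := pselect (exists2 x, modulus (x - z0) < r & filled p r0 u.[x]).
  have cS : connected (pfun u @` disc z0 r).
    apply: connected_continuous_connected; first exact: connected_disc.
    exact/continuous_subspaceT/horner_continuous.
  have sS : pfun u @` disc z0 r `<=` (filled p r0)^°.
    apply: connected_cut cS closed_filled _ _.
      by have [x xr fx] := meet; exists u.[x]; split=> //; exists x.
    move=> _ [x xr <-] fx; apply: contrapT => nx; apply: (av x xr); split=> //.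
  have : (filled p r0)^° u.[z].
    apply: sS; exists z => //; apply: sub zr; rewrite ltr_pdivrMr //; lra.
  by move=> /interior_subset/filled_modulus/le_trans; apply; rewrite le_max rrho.
have [||N hN] := @escape_compact (pfun u @` cdisc z0 (r / 2)) 1.
- apply: continuous_compact; last exact: compact_cdisc.
  exact/continuous_subspaceT/horner_continuous.
- move=> _ [x xr <-] fx; apply: dis; exists x => //.
  apply: sub xr; rewrite ltr_pdivrMr //; lra.
rewrite le_max; have [//|zrho /=] := leP (modulus u.[z]) rho.
have hx x : modulus (x - z0) <= r / 2 -> 1 <= modulus (pit p N \Po u).[x].
  by move=> xr; rewrite horner_comp horner_pit ltW // hN //; exists x.
have hz : modulus (z - z0) <= r / 2 / 2.
  by apply: (le_trans zr); rewrite -mulrA -invfM ler_pM2l // lef_pV2 ?posrE //; lra.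
have := harnack r20 hx hz; rewrite !horner_comp !horner_pit.
set a := iter N _ u.[z]; set b := iter N _ u.[z0] => ab.
have ub : c1 * modulus b <= (c1 * A') ^+ ((size p).-1 ^ N).
  by apply: up => //; rewrite le_max uA orbT.
have lb := low N u.[z] (ltW zrho); rewrite -/a in lb.
have dN : (0 < (size p).-1 ^ N)%N by rewrite expn_gt0; case: (size p) sp => [|[|k]].
(* It suffices to compare [d ^ N]-th powers: the lower growth bound at [u.[z]], Harnack, and the
   upper growth bound at [u.[z0]] chain with one common exponent, so no trace of [N] remains. *)
rewrite ler_pdivlMr // mulrC -(ler_pXn2r dN) ?nnegrE; last 2 first.
- by rewrite mulr_ge0 ?modulus_ge0 // ltW.
- by rewrite exprn_ge0 // mulr_ge0 //; lra.
rewrite exprAC; apply: (le_trans lb).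
have b1 : modulus b <= c1 * modulus b by rewrite ler_peMl ?modulus_ge0.
apply: (@le_trans _ _ (modulus b ^+ 3)).
  by apply: le_trans ab; rewrite ler_piMl ?modulus_ge0.
by rewrite lerXn2r ?nnegrE ?modulus_ge0 ?exprn_ge0 ?mulr_ge0 //; lra.
Qed.

End OneMap.

(* Otherwise [avoid_bounded] would bound v o p^n near z0, where points escape. *)
Lemma no_avoid p r p' r' v z0 (d : R) :
  (2 < size p)%N -> escaping p r -> (2 < size p')%N -> escaping p' r' -> (1 < size v)%N ->
  frontier (filled p r) z0 -> 0 < d ->
  (forall k, exists2 n, (k <= n)%N & forall z, modulus (z - z0) < d ->
     ~ frontier (filled p' r') v.[iter n (horner p) z]) -> False.
Proof.
move=> sp ep sp' ep' sv fz d0 h.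
have [A A0 hA] := horner_bounded v r.
have [B hB] := avoid_bounded sp' ep' A.
have [c1 [c2 [r1 [_ /andP[c20 _] r11 _ low]]]] := horner_growth sv.
have d40 : 0 < d / 4 by rewrite divr_gt0.
have [w wz nw] := frontier_escape fz d40.
have [N hN] := filledPn ep (Num.max r1 (B / c2)) nw.
have [n Nn hn] := h N.
have := hN n Nn; rewrite gt_max ltr_pdivrMr // => /andP[far1 far2].
have bd : modulus v.[iter n (horner p) w] <= B.
  rewrite -horner_pit -horner_comp; apply: (hB (v \Po pit p n) z0 d d0).
  - by move=> z zd; rewrite horner_comp horner_pit; exact: hn.
  - by rewrite horner_comp horner_pit; apply: hA; case: fz.
  - exact: ltW.
have := low _ (ltW far1); set y := iter n _ w in bd far1 far2 *.
have y1 : 1 <= modulus y by apply: le_trans r11 (ltW far1).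
have : modulus y <= modulus y ^+ (size v).-1 by rewrite ler_eXnr //; case: (size v) sv => [|[|k]].
by nra.
Qed.

(** Cauchy's estimate through the polynomial difference quotient [q = (u - u(y)) / (X - y)]: on the
    circle [|z - z0| = r] one has [|z - y| >= r / 2], and the maximum principle carries the bound
    inwards. *)
Lemma lipschitz_disc u z0 (r M : R) : 0 < r -> (forall z, modulus (z - z0) <= r -> modulus u.[z] <= M) ->
  forall x y, modulus (x - z0) <= r / 2 -> modulus (y - z0) <= r / 2 ->
  modulus (u.[x] - u.[y]) <= 4 * M / r * modulus (x - y).
Proof.
move=> r0 hM x y xr yr.
have /factor_theorem[q hq] : root (u - u.[y]%:P) y.
  by rewrite /root hornerD hornerN hornerC subrr.
have uE z : u.[z] - u.[y] = q.[z] * (z - y).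
  by have := congr1 (fun f => f.[z]) hq; rewrite hornerD hornerN hornerC hornerM hornerXsubC.
have yr' : modulus (y - z0) <= r by apply: le_trans yr _; rewrite ler_pdivrMr //; lra.
have bd z : modulus (z - z0) = r -> modulus q.[z] <= 4 * M / r.
  move=> zr; have h1 : r / 2 <= modulus (z - y).
    by have := modulus_dist y z z0; rewrite zr => h; lra.
  have h2 : modulus q.[z] * modulus (z - y) <= 2 * M.
    rewrite -modulusM -uE; apply: (le_trans (le_modulusBD _ _)).
    by have := hM z; rewrite zr lexx => /(_ isT) a; have := hM y yr' => b; lra.
  have q0 := modulus_ge0 q.[z].
  rewrite ler_pdivlMr //; nra.
rewrite uE modulusM ler_wpM2r ?modulus_ge0 //.
have edge : exists z, modulus (z - z0) = r.
  by exists (z0 + r%:C); rewrite addrC addKr modulus_real gtr0_norm.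
have [sq|sq] := leqP (size q) 1.
  by have [z /bd] := edge; rewrite (size1_polyC sq) !hornerC.
apply: (@max_modulus _ q (cdisc z0 r)) => //; first exact: compact_cdisc.
  move=> z; rewrite /cdisc /= le_eqVlt => /predU1P[/bd //|zr] [].
  apply: filterS (_ : nbhs (z : C) (disc z0 r)).
    by move=> w; rewrite /disc /cdisc /= => /ltW.
  exact: (open_nbhs_nbhs (conj (@open_disc _ z0 r) zr)).
by rewrite /cdisc /=; apply: le_trans xr _; rewrite ler_pdivrMr //; lra.
Qed.

Lemma pick_increasing (Q : nat -> nat -> Prop) : (forall i N, exists2 k, (N <= k)%N & Q i k) ->
  exists s : nat -> nat, {homo s : i j / (i < j)%N} /\ forall i, Q i (s i).
Proof.
move=> h; have h' i N : exists k, (N <= k)%N /\ Q i k by have [k] := h i N; exists k.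
have [g hg] := choice (fun iN : nat * nat => h' iN.1 iN.2).
pose s := fix s i := if i is j.+1 then g (i, (s j).+1) else g (0%N, 0%N).
exists s; split; last by case=> [|i]; [have [_] := hg (0%N, 0%N)|have [_] := hg (i.+1, (s i).+1)].
apply: homo_ltn => [y x z|i]; first exact: ltn_trans.
by have [] := hg (i.+1, (s i).+1).
Qed.

(** An ultrafilter refining [\oo] gives all pointwise limits at once, in place of a diagonal
    extraction; the common Lipschitz bound makes the convergence uniform on the compact half
    disc. *)
Lemma montel_seq (u : nat -> {poly R[i]}) z0 (r M : R) : 0 < r ->
  (forall k z, modulus (z - z0) <= r -> modulus (u k).[z] <= M) ->
  exists s : nat -> nat, {homo s : i j / (i < j)%N} /\ exists l : R[i] -> R[i],
    forall e : R, 0 < e -> exists N, forall k, (N <= k)%N ->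
    forall z, modulus (z - z0) <= r / 2 -> modulus ((u (s k)).[z] - l z) < e.
Proof.
move=> r0 hM.
have M0 : 0 <= M.
  by apply: le_trans (modulus_ge0 _) (hM 0%N z0 _); rewrite subrr modulus0 ltW.
have [F [FU oF]] := ultraFilterLemma (@eventually_filter : ProperFilter \oo).
have FF : ProperFilter F by exact: ultra_proper.
have limex z : exists l, modulus (z - z0) <= r / 2 -> forall e : R, 0 < e -> F [set k | modulus ((u k).[z] - l) < e].
  have [zr|] := pselect (modulus (z - z0) <= r / 2); last by exists 0.
  have zr' : modulus (z - z0) <= r by apply: le_trans zr _; rewrite ler_pdivrMr //; lra.
  have := @compact_cdisc R 0 M.
  move=> cD; have hk k : cdisc (0 : R[i]) M (u k).[z].
    rewrite /cdisc /= subr0; exact: hM k z zr'.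
  have h0 : ((fun k => (u k).[z] : C) @ F) (cdisc 0 M).
    exact: (filterS (fun k _ => hk k) (@filterT _ F _)).
  have [l [_ cl]] := cD ((fun k => (u k).[z] : C) @ F) _ h0.
  exists l => _ e e0.
  have [//|nF] := in_ultra_setVsetC [set k | modulus ((u k).[z] - l) < e] FU.
  by have [w [nw we]] := cl (~` disc l e) (disc l e) nF (nbhs_disc l e0).
have [l hl] := choice limex.
pose L := 4 * M / r.
have L0 : 0 <= L by rewrite /L divr_ge0 ?mulr_ge0 // ltW.
have lipu k := lipschitz_disc r0 (hM k).
have lipl x y : modulus (x - z0) <= r / 2 -> modulus (y - z0) <= r / 2 -> modulus (l x - l y) <= L * modulus (x - y).
  move=> xr yr; apply/ler_addgt0Pr => e e0.
  have e20 : 0 < e / 2 by rewrite divr_gt0.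
  have [k [k1 k2]] := filter_ex (filterI (hl x xr _ e20) (hl y yr _ e20)).
  have h1 := lipu k x y xr yr; rewrite /= modulusBC in k1.
  have h2 := modulus_dist (u k).[x] (l x) (l y).
  have h3 := modulus_dist (u k).[y] (u k).[x] (l y).
  rewrite /= in k2; rewrite -/L in h1; lra.
have unif (e : R) : 0 < e -> F [set k | forall z, modulus (z - z0) <= r / 2 -> modulus ((u k).[z] - l z) < e].
  move=> e0; have := @compact_cdisc R z0 (r / 2).
  move=> /compact_near_coveringP/near_covering_withinP cov.
  have := cov nat F (fun k z => modulus ((u k).[z] - l z) < e) _.
  apply=> x xr.
  have e30 : 0 < e / 3 by rewrite divr_gt0.
  pose d := e / 3 / (L + 1).
  have d0 : 0 < d by rewrite divr_gt0 // ltr_wpDl.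
  exists (disc x d, [set k | modulus ((u k).[x] - l x) < e / 3]).
    by split; [exact: nbhs_disc|exact: hl].
  move=> [y k] [/= yd kx] yr.
  have Ld : L * modulus (y - x) < e / 3.
    apply: (@le_lt_trans _ _ ((L + 1) * modulus (y - x))).
      by rewrite ler_wpM2r ?modulus_ge0 // lerDl.
    by rewrite mulrC -ltr_pdivlMr // ltr_wpDl.
  have h1 := lipu k y x yr xr; have h2 := lipl x y xr yr; rewrite (modulusBC x) in h2.
  have h3 := modulus_dist (u k).[x] (u k).[y] (l y).
  have h4 := modulus_dist (l x) (u k).[x] (l y).
  rewrite -/L in h1; lra.
have [|s [hs hQ]] := @pick_increasing (fun i k => forall z, modulus (z - z0) <= r / 2 ->
    modulus ((u k).[z] - l z) < i.+1%:R^-1).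
  move=> i N; have i0 : 0 < (i.+1%:R^-1 : R) by rewrite invr_gt0.
  have FN : F [set k | (N <= k)%N] by apply: oF; exists N.
  have [k [k1 k2]] := filter_ex (filterI (unif _ i0) FN).
  by exists k.
exists s; split=> //; exists l => e e0.
exists (Num.bound e^-1) => k Nk z zr; apply: lt_le_trans (hQ k z zr) _.
rewrite -[e]invrK lef_pV2 ?posrE ?invr_gt0 //.
have := archi_boundP (ltW (_ : 0 < e^-1)); rewrite invr_gt0 e0 => /(_ isT)/ltW/le_trans; apply.
by rewrite ler_nat leqW.
Qed.

End Escape.

(** * Normality on the sphere *)

Section Sphere.
Context {R : realType}.
Implicit Types (z w : R[i]) (p u v : {poly R[i]}).
Local Notation C := (R[i]^o).
Local Notation Chat := (sphere R).
Local Open Scope complex_scope.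

Lemma sin_le_id (y : R) : 0 <= y -> sin y <= y.
Proof.
move=> y0.
have [|c _] := @MVT_segment R sin cos 0 y y0 (fun t _ => is_derive_sin t).
  exact/continuous_subspaceT/continuous_sin.
rewrite sin0 !subr0 => ->; rewrite ler_piMl // cos_le1.
Qed.

Lemma le_asin (x : R) : 0 <= x <= 1 -> x <= asin x.
Proof.
move=> /andP[x0 x1]; have xB : -1 <= x <= 1 by rewrite x1 andbT; lra.
have [/andP[t1 t2] st] := asin_def xB.
have [t0|t0] := leP 0 (asin x); first by rewrite -{1}st sin_le_id.
have : 0 < sin (- asin x).
  apply: sin_gt0_pi; rewrite oppr_gt0 t0 /=; have := pi_gt0 R; lra.
by rewrite sinN st oppr_gt0 ltNge x0.
Qed.

Lemma asin_small (e : R) : 0 < e -> exists2 d : R, 0 < d & forall x : R, 0 <= x < d -> asin x < e.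
Proof.
move=> e0; have z01 : -1 < (0 : R) < 1 by rewrite ltr01 oppr_lt0 ltr01.
have a0 : asin (0 : R) = 0.
  rewrite -{1}(@sin0 R) sinK // in_itv /= oppr_le0 divr_ge0 ?(ltW (pi_gt0 R)) //.
have := @continuous_asin R 0 z01 (ball (asin (0 : R)) e) (nbhsx_ballx _ _ e0).
move=> /nbhs_ballP[d /= d0 h]; exists d => // x /andP[x0 xd].
have /h : ball (0 : R) d x by rewrite /ball /= sub0r normrN ger0_norm.
by rewrite /ball /= a0 sub0r normrN; apply: le_lt_trans; exact: ler_norm.
Qed.

Lemma sqrt1_ge1 (a : R) : 0 <= a -> 1 <= Num.sqrt (1 + a ^+ 2).
Proof. by move=> a0; rewrite -[leLHS]sqrtr1 ler_wsqrtr // lerDl exprn_ge0. Qed.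

Lemma sqrt1_le (a : R) : 0 <= a -> Num.sqrt (1 + a ^+ 2) <= 1 + a.
Proof.
move=> a0; rewrite -[leRHS]ger0_norm ?addr_ge0 // -sqrtr_sqr ler_wsqrtr //; nra.
Qed.

Lemma sqrt1_ge (a : R) : 0 <= a -> a <= Num.sqrt (1 + a ^+ 2).
Proof. by move=> a0; rewrite -{1}(ger0_norm a0) -sqrtr_sqr ler_wsqrtr // lerDr. Qed.

Lemma chordal_ge0 (a b : Chat) : 0 <= chordal_dist a b.
Proof.
by case: a b => [a|] [b|] //=; rewrite ?divr_ge0 ?mulr_ge0 ?modulus_ge0 ?sqrtr_ge0.
Qed.

Lemma chordal_le2 (a b : Chat) : chordal_dist a b <= 2.
Proof.
have key (c : R[i]) : 2 / Num.sqrt (1 + modulus c ^+ 2) <= 2.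
  have h := sqrt1_ge1 (modulus_ge0 c).
  by rewrite ler_pdivrMr ?(lt_le_trans ltr01) //; lra.
case: a b => [a|] [b|] //=.
have ha := sqrt1_ge1 (modulus_ge0 a); have hb := sqrt1_ge1 (modulus_ge0 b).
rewrite ler_pdivrMr ?mulr_gt0 ?(lt_le_trans ltr01) // ler_pM2l //.
apply: (le_trans (le_modulusBD _ _)).
have a0 := modulus_ge0 a; have b0 := modulus_ge0 b.
rewrite -sqrtrM ?addr_ge0 ?exprn_ge0 // -[leLHS]ger0_norm ?addr_ge0 // -sqrtr_sqr ler_wsqrtr //.
(* [(1 + a^2) (1 + b^2) - (a + b)^2 = (1 - a b)^2]. *)
have := sqr_ge0 (1 - modulus a * modulus b); nra.
Qed.

Lemma chordal_le_sph (a b : Chat) : chordal_dist a b <= sph_dist a b.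
Proof.
rewrite /sph_dist; have h := chordal_ge0 a b; have h2 := chordal_le2 a b.
have : chordal_dist a b / 2 <= asin (chordal_dist a b / 2) by apply: le_asin; apply/andP; split; lra.
lra.
Qed.

Lemma sph_small (e : R) : 0 < e -> exists2 d : R, 0 < d &
  forall a b : Chat, chordal_dist a b < d -> sph_dist a b < e.
Proof.
move=> e0; have e20 : 0 < e / 2 by rewrite divr_gt0.
have [d d0 hd] := asin_small e20; exists d => // a b ab.
have h := chordal_ge0 a b.
have : asin (chordal_dist a b / 2) < e / 2 by apply: hd; apply/andP; split; lra.
rewrite /sph_dist; lra.
Qed.

Lemma chordal_le_modulus z w : chordal_dist (Some z : Chat) (Some w : Chat) <= 2 * modulus (z - w).
Proof.
have ha := sqrt1_ge1 (modulus_ge0 z); have hb := sqrt1_ge1 (modulus_ge0 w).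
have d0 := modulus_ge0 (z - w).
rewrite /= ler_pdivrMr ?mulr_gt0 ?(lt_le_trans ltr01) //.
rewrite ler_peMr ?mulr_ge0 //; nra.
Qed.

Lemma chordal_ge_modulus z w M : modulus z <= M -> modulus w <= M ->
  2 * modulus (z - w) / (1 + M) ^+ 2 <= chordal_dist (Some z : Chat) (Some w : Chat).
Proof.
move=> zM wM; have z0 := modulus_ge0 z; have w0 := modulus_ge0 w; have d0 := modulus_ge0 (z - w).
have ha := sqrt1_ge1 z0; have hb := sqrt1_ge1 w0.
have ka := sqrt1_le z0; have kb := sqrt1_le w0.
rewrite /= ; set a := Num.sqrt _ in ha ka *; set b := Num.sqrt _ in hb kb *.
have ab0 : 0 < a * b by nra.
have M0 : 0 < (1 + M) ^+ 2 by rewrite exprn_gt0 //; lra.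
apply: ler_wpM2l; first by rewrite mulr_ge0.
by rewrite lef_pV2 ?posrE // expr2 ler_pM //; lra.
Qed.

Lemma chordal_infty_le z : 0 < modulus z -> chordal_dist (Some z : Chat) None <= 2 / modulus z.
Proof.
move=> z0; have h := sqrt1_ge (ltW z0).
by rewrite /= ler_pM2l // lef_pV2 ?posrE // (lt_le_trans z0).
Qed.

Lemma chordal_infty_ge z : 2 / (1 + modulus z) <= chordal_dist (Some z : Chat) None.
Proof.
have z0 := modulus_ge0 z; have ha := sqrt1_ge1 z0.
by rewrite /= ler_pM2l // lef_pV2 ?posrE ?sqrt1_le ?ltr_wpDr ?(lt_le_trans ltr01).
Qed.

Lemma chordal_far z w M : modulus z <= M -> 2 * M + 1 <= modulus w ->
  (1 + M)^-1 / 2 <= chordal_dist (Some z : Chat) (Some w : Chat).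
Proof.
move=> zM wM; have z0 := modulus_ge0 z; have w0 := modulus_ge0 w.
have ha := sqrt1_ge1 z0; have hb := sqrt1_ge1 w0.
have ka := sqrt1_le z0; have kb := sqrt1_le w0.
have d0 := le_modulusB w z; rewrite modulusBC in d0.
rewrite /= ler_pdivlMr ?mulr_gt0 ?(lt_le_trans ltr01) //.
set a := Num.sqrt _ in ha ka *; set b := Num.sqrt _ in hb kb *.
have : (1 + M)^-1 * a <= 1 by rewrite mulrC ler_pdivrMr ?mul1r; lra.
have i0 : 0 <= (1 + M)^-1 by rewrite invr_ge0; lra.
move=> h; apply: (@le_trans _ _ (b / 2)).
  by rewrite [leLHS](_ : _ = (1 + M)^-1 * a * (b / 2)); [nra|ring].
lra.
Qed.

Lemma open_some_disc z (r : R) : 0 < r -> open_nbhs (Some z : Chat) (Some @` disc z r).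
Proof.
move=> r0; split; first by apply: one_point_compactification_open_some; exact: open_disc.
by exists z => //; rewrite /disc /= subrr modulus0.
Qed.

Lemma nbhs_some z (U : set Chat) : nbhs (Some z : Chat) U ->
  exists2 r : R, 0 < r & forall w, modulus (w - z) < r -> U (Some w).
Proof. by move=> /(nbhsC z)[r r0 hr]; exists r. Qed.

(** Either the values at [z0] stay bounded along a subsequence, and [avoid_bounded] with
    [montel_seq] gives a finite limit; or they tend to infinity and so does the sequence nearby,
    since a bounded value at [c] would, by [avoid_bounded] centred at [c], bound the value at
    [z0]. *)
Lemma avoid_Fatou p r (F : set (Chat -> Chat)) z0 (d : R) :
  (2 < size p)%N -> escaping p r -> 0 < d ->
  (forall f, F f -> exists2 u, f = poly_ext u &
     forall z, modulus (z - z0) < d -> ~ frontier (filled p r) u.[z]) ->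
  Fatou F (Some z0).
Proof.
move=> sp ep d0 hF.
have d80 : 0 < d / 8 by rewrite divr_gt0.
(* [montel_seq] halves the radius [d / 4]; and for [c] in this disc, [z0] is within a quarter of the
   radius [d / 2] used around [c]. *)
exists (Some @` disc z0 (d / 8)); first exact: open_some_disc.
move=> f Ff.
have hF' k : exists u, f k = poly_ext u /\ forall z, modulus (z - z0) < d -> ~ frontier (filled p r) u.[z].
  by have [u] := hF (f k) (Ff k); exists u.
have [u hu] := choice hF'.
have hu1 k : f k = poly_ext (u k) by have [] := hu k.
have hu2 k z : modulus (z - z0) < d -> ~ frontier (filled p r) (u k).[z] by have [_] := hu k; apply.
have [[A hA]|nA] := pselect (exists A, forall N, exists2 k, (N <= k)%N & modulus (u k).[z0] <= A).
  have [|s1 [s1m s1A]] := @pick_increasing (fun _ k => modulus (u k).[z0] <= A).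
    by move=> _ N; exact: hA.
  have [B hB] := avoid_bounded sp ep A.
  have d40 : 0 < d / 4 by rewrite divr_gt0.
  have [|s2 [s2m [l hl]]] := @montel_seq R (u \o s1) z0 (d / 4) B d40.
    by move=> k z zd; exact: (hB _ z0 d d0 (hu2 (s1 k)) (s1A k) z zd).
  exists (s1 \o s2); split; first by move=> i j ij; apply: s1m; apply: s2m.
  exists (fun a : Chat => if a is Some c then Some (l c) else None) => K cK KU e e0.
  have [eta eta0 heta] := sph_small e0.
  have eta20 : 0 < eta / 2 by rewrite divr_gt0.
  have [N hN] := hl _ eta20; exists N => k Nk a /KU[c cd <-].
  rewrite /= hu1 /=; apply: heta; apply: (le_lt_trans (chordal_le_modulus _ _)).
  have := hN k Nk c; rewrite /= => h.
  have : modulus ((u (s1 (s2 k))).[c] - l c) < eta / 2 by apply: h; apply: ltW; move: cd; rewrite /disc /= => cd; lra.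
  by lra.
exists id; split=> //; exists (fun=> None) => K cK KU e e0.
have [eta eta0 heta] := sph_small e0.
have [B hB] := avoid_bounded sp ep (2 / eta + 1).
have [N hN] : exists N, forall k, (N <= k)%N -> B < modulus (u k).[z0].
  apply: contrapT => h; apply: nA; exists B => N; apply: contrapT => h2; apply: h.
  exists N => k Nk; rewrite ltNge; apply/negP => le; apply: h2; by exists k.
exists N => k Nk a /KU[c cd <-]; rewrite hu1 /=; apply: heta.
have far : 2 / eta + 1 < modulus (u k).[c].
  rewrite ltNge; apply/negP => le.
  have d20 : 0 < d / 2 by rewrite divr_gt0.
  have : modulus (u k).[z0] <= B.
    apply: (hB (u k) c (d / 2)) => //.
      move=> z zc; apply: hu2; have := modulus_dist c z z0.
      move: cd; rewrite /disc /= => cd; lra.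
    rewrite modulusBC; move: cd; rewrite /disc /= => cd; lra.
  by rewrite leNgt hN.
have p0 : 0 < 2 / eta by rewrite divr_gt0.
have q0 : 0 < modulus (u k).[c] by lra.
apply: (le_lt_trans (chordal_infty_le q0)).
rewrite ltr_pdivrMr //; have : 2 / eta < modulus (u k).[c] by lra.
by rewrite ltr_pdivrMr // mulrC.
Qed.

(** A locally uniform limit would have to be both finite and infinite: once the approximation is
    uniform from stage [N] on, some [w] close enough to [z0] still has a value of modulus at most
    [r + 1] at stage [N], yet escapes at later stages. *)
Lemma frontier_Julia p r v (F : set (Chat -> Chat)) z0 :
  (2 < size p)%N -> escaping p r -> (1 < size v)%N ->
  (forall k, F (poly_ext (pit p k.+1 \Po v))) ->
  frontier (filled p r) v.[z0] -> Julia F (Some z0).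
Proof.
move=> sp ep sv hF fz [U [oU Uz] nU].
have [d d0 hd] := nbhs_some (open_nbhs_nbhs (conj oU Uz)).
have [s [smono [l hl]]] := nU (fun k => poly_ext (pit p k.+1 \Po v)) hF.
have d20 : 0 < d / 2 by rewrite divr_gt0.
pose K : set Chat := Some @` cdisc z0 (d / 2).
have cK : compact K.
  apply: (@continuous_compact C Chat); last exact: compact_cdisc.
  exact/continuous_subspaceT/one_point_compactification_some_continuous.
have KU : K `<=` U by move=> _ [c cd <-]; apply: hd; move: cd; rewrite /cdisc /= => cd; lra.
have r1 : 1 <= r := ep.1.
(* If the limit at [w] is infinite or of modulus at least [M2], it is too far from the value at
   stage [N]; otherwise later values, of modulus above [2 * M2 + 1], are too far from it. [e] is the
   gap of [chordal_far] for [M2]. *)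
pose M := r + 1; pose M2 := 2 * M + 1.
pose e := (1 + M2)^-1 / 2.
have e0 : 0 < e by rewrite divr_gt0 // invr_gt0 /M2 /M; lra.
have [N hN] := hl K cK KU e e0.
pose g := pit p (s N).+1 \Po v.
have gz0 : modulus g.[z0] <= r.
  by rewrite horner_comp horner_pit; case: fz => fz _; exact: fz.
have [d1 d10 hd1] := horner_continuousC g z0 ltr01.
have [w wd nw] : exists2 w, modulus (w - z0) < Num.min d1 (d / 2) & ~ filled p r v.[w].
  apply: contrapT => h; case: fz => _; apply.
  have := interior_preimage_horner (filled p r) sv => /seteqP[hs _]; apply: (hs z0).
  apply/nbhsC; exists (Num.min d1 (d / 2)); first by rewrite lt_min d10.
  by move=> w wd; apply: contrapT => nw; apply: h; exists w.
move: wd; rewrite lt_min => /andP[w1 w2].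
have gw : modulus g.[w] <= M.
  by have := hd1 w w1; have := le_modulusB g.[w] g.[z0]; rewrite /M => a b; lra.
have Kw : K (Some w) by exists w => //; rewrite /cdisc /= ltW.
have near k : (N <= k)%N -> chordal_dist (poly_ext (pit p (s k).+1 \Po v) (Some w)) (l (Some w)) < e.
  by move=> Nk; apply: (le_lt_trans (chordal_le_sph _ _)); exact: hN.
have sk k : (k <= s k)%N.
  elim: k => // k IH; apply: leq_ltn_trans IH _; exact: smono.
case lw : (l (Some w)) => [a|]; last first.
  have := near N (leqnn N); rewrite lw => h.
  have : 2 / (1 + modulus g.[w]) < e by apply: le_lt_trans h; exact: chordal_infty_ge.
  rewrite ltNge => /negP; apply; rewrite /e.
  have g0 := modulus_ge0 g.[w].
  have : (1 + M2)^-1 <= (1 + modulus g.[w])^-1.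
    by rewrite lef_pV2 ?posrE /M2 ?ltr_wpDr //; lra.
  have : 0 < (1 + modulus g.[w])^-1 by rewrite invr_gt0 ltr_wpDr.
  lra.
have [am|am] := leP (2 * M + 1) (modulus a).
  have := near N (leqnn N); rewrite lw ltNge => /negP; apply.
  apply: le_trans (chordal_far gw am); rewrite /e ler_pM2r ?invr_gt0 // lef_pV2 ?posrE /M2 /M; lra.
have [N2 hN2] := filledPn ep (2 * M2 + 1) nw.
pose k := maxn N N2.
have Nk : (N <= k)%N by rewrite leq_maxl.
have := near k Nk; rewrite lw ltNge => /negP; apply.
have am2 : modulus a <= M2 by rewrite ltW.
have far : 2 * M2 + 1 <= modulus (pit p (s k).+1 \Po v).[w].
  rewrite horner_comp horner_pit ltW // hN2 //.
  by apply: leq_trans (leqW (sk k)); rewrite leq_maxr.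
have := chordal_far am2 far; rewrite -/e.
by rewrite /= modulusBC [X in _ / X]mulrC.
Qed.

Lemma min_dist_ge (A B : set C) (d M : R) : 0 < d -> A !=set0 -> B !=set0 ->
  (forall a, A a -> modulus a <= M) -> (forall b, B b -> modulus b <= M) ->
  (forall a b, A a -> B b -> d <= modulus (a - b)) ->
  2 * d / (1 + M) ^+ 2 <= min_dist (Some @` B : set Chat) (Some @` A).
Proof.
move=> d0 [a0 Aa0] [b0 Bb0] AM BM AB.
have M0 : 0 <= M by apply: le_trans (modulus_ge0 a0) (AM _ Aa0).
apply: lb_le_inf; first by exists (dist_to_set (Some b0 : Chat) (Some @` A)), (Some b0) => //; exists b0.
move=> _ [_ [b Bb <-] <-]; apply: lb_le_inf.
  by exists (sph_dist (Some b : Chat) (Some a0)), (Some a0) => //; exists a0.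
move=> _ [_ [a Aa <-] <-].
apply: le_trans (chordal_le_sph _ _); apply: le_trans (chordal_ge_modulus (BM _ Bb) (AM _ Aa)).
by rewrite ler_wpM2r ?invr_ge0 ?exprn_ge0 ?addr_ge0 // ler_pM2l // modulusBC AB.
Qed.

End Sphere.

(** * Words in the generators *)

Section Words.
Context {R : realType}.
Implicit Types (z : R[i]) (p u : {poly R[i]}).
Local Notation C := (R[i]^o).
Local Notation Chat := (sphere R).
Local Open Scope complex_scope.

Lemma frontier_preimage p (A : set C) : (1 < size p)%N ->
  pfun p @^-1` frontier A = frontier (pfun p @^-1` A).
Proof. by move=> sp; rewrite /frontier interior_preimage_horner. Qed.

Lemma frontier_filled_invariant p r z : (2 < size p)%N -> escaping p r ->
  frontier (filled p r) p.[z] <-> frontier (filled p r) z.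
Proof.
move=> sp ep; have sp1 : (1 < size p)%N by exact: ltnW.
by rewrite -{2}(filled_preimage ep) -frontier_preimage.
Qed.

Lemma closed_frontier (D : set C) : closed D -> closed (frontier D).
Proof. by move=> cD; apply: closedI => //; apply: open_closedC; exact: open_interior. Qed.

Section Family.
Variables (I : finType) (h : I -> {poly R[i]}) (r : R).
Hypothesis sh : forall i, (2 < size (h i))%N.
Hypothesis eh : forall i, escaping (h i) r.

(* The first letter of a word is the map that is applied first. *)
Definition Pw (w : seq I) : {poly R[i]} := foldr (fun j q => q \Po h j) 'X w.

Lemma Pw_nil : Pw [::] = 'X. Proof. by []. Qed.

Lemma Pw_cons j w : Pw (j :: w) = Pw w \Po h j. Proof. by []. Qed.

Lemma Pw_cat w1 w2 : Pw (w1 ++ w2) = Pw w2 \Po Pw w1.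
Proof.
by elim: w1 => [|j w1 IH]; rewrite ?Pw_nil ?comp_polyXr // cat_cons !Pw_cons IH comp_polyA.
Qed.

Lemma Pw1 j : Pw [:: j] = h j. Proof. by rewrite Pw_cons Pw_nil comp_polyX. Qed.

Lemma Pw_nseq j n : Pw (nseq n j) = pit (h j) n.
Proof.
elim: n => [|n IH]; first by [].
have -> : nseq n.+1 j = nseq n j ++ [:: j] by rewrite -addn1 nseqD.
by rewrite Pw_cat Pw1 IH.
Qed.

Lemma size_Pw w : (1 < size (Pw w))%N.
Proof. by elim: w => [|j w IH]; [rewrite Pw_nil size_polyX|apply: size_comp_gt1 => //; exact: ltnW]. Qed.

Lemma Pw_escape w z : r <= modulus z -> 2 ^+ size w * modulus z <= modulus (Pw w).[z].
Proof.
elim: w z => [|j w IH] z zr; first by rewrite Pw_nil hornerX expr0 mul1r.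
have [r1 ej] := eh j; have hz := ej z zr.
rewrite Pw_cons horner_comp /=; apply: le_trans (IH _ _); last by have := modulus_ge0 z; lra.
by rewrite exprSr -mulrA ler_wpM2l // exprn_ge0.
Qed.

Definition wordmaps : set (Chat -> Chat) := [set f | exists2 w, w != [::] & f = poly_ext (Pw w)].

Lemma semigroup_gen_words : semigroup_gen (range (fun j => poly_ext (h j))) = wordmaps.
Proof.
apply/seteqP; split.
  apply: smallest_sub.
    move=> f g [w1 w10 ->] [w2 w20 ->]; exists (w2 ++ w1).
      by case: (w2) w20.
    apply/funext => -[c|] //=; by rewrite Pw_cat horner_comp.
  move=> _ [j _ <-]; exists [:: j] => //; by rewrite Pw1.
move=> f [w w0 ->]; elim: w w0 => [//|j w IH] _.
have gj : semigroup_gen (range (fun j => poly_ext (h j))) (poly_ext (h j)).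
  by apply: sub_gen_smallest; exists j.
have [->|w0] := eqVneq w [::]; first by rewrite Pw1.
have -> : poly_ext (Pw (j :: w)) = poly_ext (Pw w) \o poly_ext (h j).
  by apply/funext => -[c|] //=; rewrite horner_comp.
move=> A cA; have [cc sA] := cA; apply: cc; last exact: gj.
exact: IH.
Qed.

(** If infinitely many words have bounded length, one word recurs and a constant subsequence
    converges; otherwise the lengths tend to infinity and [Pw_escape] gives uniform convergence to
    infinity. *)
Lemma Fatou_infty : Fatou wordmaps None.
Proof.
exists ((Some @` ~` cdisc 0 r) `|` [set None]).
  split; last by right.
  rewrite openE => a [[c nc <-]|->].
    have := @one_point_compactification_some_nbhs C c (~` cdisc 0 r).
    move=> /(_ (open_nbhs_nbhs (conj (closed_openC (@closed_cdisc _ 0 r)) nc))).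
    by apply: filterS => x; left.
  by exists (cdisc 0 r) => //; split; [exact: compact_cdisc|exact: closed_cdisc].
move=> f Ff; have hF k : exists w, f k = poly_ext (Pw w) by have [w] := Ff k; exists w.
have [w hw] := choice hF.
have [[L hL]|nL] := pselect (exists L, forall N, exists2 k, (N <= k)%N & (size (w k) <= L)%N).
  have [v hv] : exists v, forall N, exists2 k, (N <= k)%N & w k = v.
    apply: contrapT => nv.
    have hN (v : {n : 'I_L.+1 & n.-tuple I}) : exists N, forall k, (N <= k)%N -> w k <> tagged v.
      apply: contrapT => hn; apply: nv; exists (tagged v) => N; apply: contrapT => hN; apply: hn.
      by exists N => k Nk e; apply: hN; exists k.
    have [g hg] := choice hN.
    have [k Nk sk] := hL (\max_v g v).
    pose v : {n : 'I_L.+1 & n.-tuple I} := Tagged (fun n : 'I_L.+1 => n.-tuple I)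
      (in_tuple (w k) : (Ordinal (sk : (size (w k) < L.+1)%N)).-tuple I).
    apply: (hg v k) => //; apply: leq_trans Nk; exact: leq_bigmax.
  have [|s [smono hs]] := @pick_increasing (fun _ k => w k = v); first by move=> _ N; exact: hv.
  exists s; split=> //; exists (poly_ext (Pw v)) => K _ _ e e0; exists 0%N => k _ a _.
  rewrite hw hs /sph_dist.
  have -> : chordal_dist (poly_ext (Pw v) a) (poly_ext (Pw v) a) = 0.
    by case: (poly_ext _ a) => [c|] //=; rewrite subrr modulus0 mulr0 mul0r.
  rewrite mul0r.
  have -> : asin (0 : R) = 0.
    rewrite -{1}(@sin0 R) sinK // in_itv /= oppr_le0 divr_ge0 ?(ltW (pi_gt0 R)) //.
  by rewrite mulr0.
exists id; split=> //; exists (fun=> None) => K cK KU e e0.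
have [eta eta0 heta] := sph_small e0.
pose L := Num.bound (2 / eta).
have [N hN] : exists N, forall k, (N <= k)%N -> (L < size (w k))%N.
  apply: contrapT => hn; apply: nL; exists L => N; apply: contrapT => h2; apply: hn.
  by exists N => k Nk; rewrite ltnNge; apply/negP => le; apply: h2; exists k.
exists N => k Nk a /KU Ua; rewrite hw /=; apply: heta.
case: Ua => [[c]|->] //=; rewrite /cdisc /= subr0 => /negP; rewrite -ltNge => rc <-.
have c1 : 1 <= modulus c.
  have [_ _] := (0%N, 0%N); case: (w k) (hN k Nk) => // j t _.
  by apply: le_trans (ltW rc); have [] := eh j.
have big : 2 / eta < modulus (Pw (w k)).[c].
  apply: (lt_le_trans (archi_boundP (ltW (divr_gt0 _ eta0)))) => //.
  apply: le_trans (Pw_escape _ (ltW rc)).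
  apply: (@le_trans _ _ (2 ^+ size (w k) * 1)); last by rewrite ler_pM2l // exprn_gt0.
  by rewrite mulr1 -natrX ler_nat ltnW // (ltn_trans (hN k Nk)) // ltn_expl.
have p0 : 0 < modulus (Pw (w k)).[c] by apply: lt_trans big; rewrite divr_gt0.
apply: (le_lt_trans (chordal_infty_le p0)).
by move: big; rewrite !ltr_pdivrMr // mulrC.
Qed.

Lemma closed_Julia_plane (F : set (Chat -> Chat)) : closed (Some @^-1` Julia F : set C).
Proof.
apply/closedC => z /contrapT[U [oU Uz] nU].
have [d d0 hd] := nbhs_some (open_nbhs_nbhs (conj oU Uz)).
by exists d => // w wd; apply; exists U => //; split=> //; exact: hd.
Qed.

(** Off the closure the words avoid the Julia set of [h j0] on a disc, hence are normal there. As
    [j0] is arbitrary, the closures for different generators coincide. *)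
Lemma Julia_words (j0 : I) : Julia wordmaps =
  Some @` (closure [set z : C | exists2 w, w != [::] & frontier (filled (h j0) r) (Pw w).[z]] : set C).
Proof.
apply/seteqP; split=> [[z|] Jz|_ [z cz <-]]; last 2 first.
- by exfalso; apply: Jz; exact: Fatou_infty.
- apply: (@closed_Julia_plane wordmaps); apply: closure_subset cz => y [w w0 fy].
  apply: (frontier_Julia (sh j0) (eh j0) (size_Pw w)) => // k.
  exists (w ++ nseq k.+1 j0); first by case: (w) w0.
  by rewrite Pw_cat Pw_nseq.
exists z => //; apply: contrapT => nz; apply: Jz.
have /closedC/(_ z nz)[d d0 hd] := @closed_closure C
  [set z : C | exists2 w, w != [::] & frontier (filled (h j0) r) (Pw w).[z]].
apply: (avoid_Fatou (sh j0) (eh j0) d0) => f [w w0 ->]; exists (Pw w) => // y yd fy.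
by apply: (hd y yd); apply: subset_closure; exists w.
Qed.

End Family.

Lemma semigroup_gen1 p : semigroup_gen [set (poly_ext p : Chat -> Chat)] =
  wordmaps (fun _ : 'I_1 => p).
Proof.
rewrite -semigroup_gen_words; congr semigroup_gen; apply/seteqP; split=> [_ ->|_ [j _ <-]] //.
by exists ord0.
Qed.

Lemma Julia_mapE p r : (2 < size p)%N -> escaping p r ->
  Julia_map (poly_ext p) = Some @` frontier (filled p r).
Proof.
move=> sp ep; rewrite /Julia_map semigroup_gen1.
rewrite (@Julia_words _ (fun=> p) r (fun=> sp) (fun=> ep) ord0).
have cl : closed (frontier (filled p r)).
  by apply: closed_frontier; exact: closed_filled.
have -> : [set z : C | exists2 w : seq 'I_1, w != [::] & frontier (filled p r) (Pw (fun=> p) w).[z]] =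
    frontier (filled p r).
  apply/seteqP; split=> z.
    move=> [w _]; elim: w z => [|j w IH] z; first by rewrite Pw_nil hornerX.
    by rewrite Pw_cons horner_comp => /IH/(frontier_filled_invariant _ sp ep).
  move=> fz; exists [:: ord0]; first by []; rewrite Pw1; exact: ((frontier_filled_invariant z sp ep).2 fz).
by rewrite -((closure_id _).1 cl).
Qed.

End Words.

(** * Continua attached to words *)

Section PlaneContinua.
Context {R : realType}.
Implicit Types (z : R[i]) (p u : {poly R[i]}).
Local Notation C := (R[i]^o).
Variables (I : finType) (h : I -> {poly R[i]}) (r : R).
Hypothesis sh : forall i, (2 < size (h i))%N.
Hypothesis eh : forall i, escaping (h i) r.
Hypothesis crit : forall w z, w != [::] -> (Pw h w)^`().[z] = 0 -> modulus (Pw h w).[z] < r.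


(* P_w^-1(K(h_i)) and its boundary P_w^-1(J(h_i)). *)
Definition solid w i : set C := pfun (Pw h w) @^-1` filled (h i) r.
Definition rim w i : set C := pfun (Pw h w) @^-1` frontier (filled (h i) r).

Lemma rimE w i : rim w i = frontier (solid w i).
Proof. by rewrite /rim frontier_preimage // size_Pw. Qed.

Lemma solid_cons j w i : solid (j :: w) i = pfun (h j) @^-1` solid w i.
Proof. by apply/seteqP; split=> z; rewrite /solid /preimage /pfun /= horner_comp. Qed.

Lemma rim_cons j w i : rim (j :: w) i = pfun (h j) @^-1` rim w i.
Proof. by apply/seteqP; split=> z; rewrite /rim /preimage /pfun /= horner_comp. Qed.

Lemma solid_nil i : solid [::] i = filled (h i) r.
Proof. by apply/seteqP; split=> z; rewrite /solid /preimage /pfun /= hornerX. Qed.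

Lemma rim_nil i : rim [::] i = frontier (filled (h i) r).
Proof. by apply/seteqP; split=> z; rewrite /rim /preimage /pfun /= hornerX. Qed.

Lemma rim_pre w i : rim w i = pfun (Pw h w) @^-1` rim [::] i.
Proof. by rewrite rim_nil. Qed.

Lemma solid_pre w i : solid w i = pfun (Pw h w) @^-1` solid [::] i.
Proof. by rewrite solid_nil. Qed.

Lemma solidP w i z : solid w i z <-> forall n, modulus (Pw h (w ++ nseq n i)).[z] <= r.
Proof.
split=> hz n; have := hz n; by rewrite Pw_cat Pw_nseq horner_comp horner_pit.
Qed.

Lemma compact_solid w i : compact (solid w i).
Proof. by apply: compact_preimage_horner; [exact: size_Pw|exact: compact_filled]. Qed.

Lemma closed_solid w i : closed (solid w i).
Proof. by apply: compact_closed; [exact: hausdorffC|exact: compact_solid]. Qed.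

Lemma full_solid w i : full (solid w i).
Proof.
have -> : solid w i = [set z | forall n, modulus (Pw h (w ++ nseq n i)).[z] <= r].
  by apply/seteqP; split=> z /solidP.
by apply: full_sublevel => n; exact: size_Pw.
Qed.

Lemma rim_sub w i : rim w i `<=` solid w i.
Proof. by rewrite rimE => z []. Qed.

Lemma r_gt0 (i : I) : 0 < r.
Proof. by apply: lt_le_trans (eh i).1. Qed.

Lemma connected_solid w i : connected (solid w i).
Proof.
(* [n.+1] letters, because [crit] speaks of nonempty words and [w] may be empty. *)
pose f n := Pw h (w ++ nseq n.+1 i).
have fi n z : (f n).[z] = iter n.+1 (horner (h i)) (Pw h w).[z].
  by rewrite /f Pw_cat Pw_nseq horner_comp horner_pit.
have nn n : w ++ nseq n.+1 i != [::] by case: (w).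
apply: (@connected_limit _ (fun n => [set z : C | modulus (f n).[z] <= r])); first exact: compact_solid.
- move=> n; apply: connected_sublevel; [exact: size_Pw|exact: r_gt0|].
  by move=> z rz; apply/eqP => /(crit (nn n)); rewrite ltNge rz.
- move=> U oU sU; pose S := [set z : C | modulus (f 0%N).[z] <= r] `&` ~` U.
  have cS : compact S.
    apply: compact_closedI; last exact: open_closedC.
    have -> : [set z : C | modulus (f 0%N).[z] <= r] = pfun (f 0%N) @^-1` cdisc 0 r.
      by apply/seteqP; split=> z; rewrite /cdisc /preimage /= subr0.
    by apply: compact_preimage_horner; [exact: size_Pw|exact: compact_cdisc].
  have [||N hN] := @escape_compact _ (h i) r (eh i) (pfun (Pw h w) @` S) r.
  - apply: continuous_compact => //; exact/continuous_subspaceT/horner_continuous.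
  - by move=> _ [z [_ nU] <-] fz; apply: nU; exact: sU.
  exists N => n Nn z /= zn; apply: contrapT => nU.
  have Sz : S z.
    split=> //=; rewrite leNgt; apply/negP => lt; move: zn; rewrite leNgt => /negP; apply.
    by move: lt; rewrite !fi; apply: escape_mono.
  have := hN n.+1 _ (leqW Nn) (ex_intro2 _ _ z Sz erefl).
  by rewrite ltNge -fi zn.
- move=> z d Dz d0; exists 0%N => n _; exists z; split; last by rewrite /disc /= subrr modulus0.
  by have /solidP/(_ n.+1) := Dz.
Qed.

(** The curves [|f n| = r] approach the rim from outside: they miss the filled set, and a disc
    around a point of the rim also contains an escaping point, so [|f n|] takes the value [r] in it
    for large [n]. *)
Lemma connected_rim w i : connected (rim w i).
Proof.
pose f n := Pw h (w ++ nseq n.+1 i).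
have fi n z : (f n).[z] = iter n.+1 (horner (h i)) (Pw h w).[z].
  by rewrite /f Pw_cat Pw_nseq horner_comp horner_pit.
have nn n : w ++ nseq n.+1 i != [::] by case: (w).
have crim : compact (rim w i).
  apply: (subclosed_compact _ (@compact_solid w i)); last exact: rim_sub.
  by rewrite rimE; apply: closed_frontier; exact: closed_solid.
have levelN n z : modulus (f n).[z] = r -> ~ solid w i z.
  move=> zr /solidP/(_ n.+2); rewrite leNgt => /negP; apply.
  rewrite Pw_cat Pw_nseq horner_comp horner_pit iterS -fi.
  have h1 := (eh i).2 (f n).[z]; rewrite zr lexx in h1.
  apply: lt_le_trans (h1 isT); have := r_gt0 i; lra.
apply: (@connected_limit _ (fun n => [set z : C | modulus (f n).[z] = r])) => //.
- move=> n; apply: connected_level; [exact: size_Pw|exact: r_gt0|].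
  by move=> z rz; apply/eqP => /(crit (nn n)); rewrite ltNge rz.
- move=> U oU sU; pose S := [set z : C | modulus (f 0%N).[z] <= r] `&` (~` U `&` ~` (solid w i)^°).
  have cS : compact S.
    apply: compact_closedI; last first.
      by apply: closedI; apply: open_closedC => //; exact: open_interior.
    have -> : [set z : C | modulus (f 0%N).[z] <= r] = pfun (f 0%N) @^-1` cdisc 0 r.
      by apply/seteqP; split=> z; rewrite /cdisc /preimage /= subr0.
    by apply: compact_preimage_horner; [exact: size_Pw|exact: compact_cdisc].
  have [||N hN] := @escape_compact _ (h i) r (eh i) (pfun (Pw h w) @` S) r.
  - apply: continuous_compact => //; exact/continuous_subspaceT/horner_continuous.
  - by move=> _ [z [_ [nU ni]] <-] fz; apply: nU; apply: sU; rewrite rimE; split.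
  exists N => n Nn z /= zn; apply: contrapT => nU.
  have Sz : S z.
    split=> //=.
      rewrite leNgt; apply/negP => lt.
      have : r < modulus (f n).[z] by move: lt; rewrite !fi; apply: escape_mono.
      by rewrite zn ltxx.
    by split=> // /interior_subset; exact: levelN zn.
  have := hN n.+1 _ (leqW Nn) (ex_intro2 _ _ z Sz erefl).
  by rewrite ltNge -fi zn lexx.
- move=> z d; rewrite rimE => -[Dz nDz] d0.
  have [x xd nx] : exists2 x, modulus (x - z) < d & ~ solid w i x.
    apply: contrapT => hx; apply: nDz; apply/nbhsC; exists d => // x xd.
    by apply: contrapT => nx; apply: hx; exists x.
  have [N hN] := filledPn (eh i) r nx.
  exists N => n Nn; apply: contrapT => nz.
  have oL : open [set y : C | modulus (f n).[y] < r].
    have -> : [set y : C | modulus (f n).[y] < r] = pfun (f n) @^-1` disc 0 r.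
      by apply/seteqP; split=> y; rewrite /disc /preimage /= subr0.
    by apply: open_preimage_horner; exact: open_disc.
  have oG : open [set y : C | r < modulus (f n).[y]].
    have -> : [set y : C | r < modulus (f n).[y]] = pfun (f n) @^-1` ~` cdisc 0 r.
      apply/seteqP; split=> y; rewrite /cdisc /preimage /= subr0; first by rewrite ltNge => /negP.
      by move=> /negP; rewrite -ltNge.
    by apply: open_preimage_horner; apply: closed_openC; exact: closed_cdisc.
  have zd : disc z d z by rewrite /disc /= subrr modulus0.
  have LG : [set y : C | modulus (f n).[y] < r] `&` [set y : C | r < modulus (f n).[y]] = set0.
    by apply/seteqP; split=> // y [/= a b]; have := lt_trans a b; rewrite ltxx.
  have [|a|a] := connected_open_split (@connected_disc _ z d) oL oG LG.
  + move=> y yd; have [lt|gt|e] := ltgtP (modulus (f n).[y]) r; [by left|by right|].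
    by exfalso; apply: nz; exists y.
  + have := a x xd; rewrite /= ltNge => /negP; apply; apply: ltW.
    by rewrite fi; apply: hN; exact: leqW.
  + have := a z zd; rewrite /= ltNge => /negP; apply.
    by have /solidP/(_ n.+1) := Dz.
Qed.

Lemma rim_nonempty_of w i b : solid w i b -> rim w i !=set0.
Proof.
move=> Db; apply: contrapT => ne.
have cT : connected [set: C] by apply: connected_convex.
have : [set: C] `<=` (solid w i)^°.
  apply: connected_cut cT (@closed_solid w i) _ _; first by exists b.
  move=> z _ Dz; apply: contrapT => nz; apply: ne; exists z; rewrite rimE; split=> //.
have [M hM] := compact_modulus_le (@compact_solid w i).
move=> /(_ (`|M| + 1)%:C%C Logic.I)/interior_subset/hM.
rewrite modulus_real ger0_norm ?addr_ge0 // => le.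
by have := ler_norm M; lra.
Qed.

(* A critical value of [h j] has a bounded orbit under all words. *)
Lemma common_point (j : I) : exists b, forall w i, solid w i b.
Proof.
have sd : (1 < size (h j)^`())%N.
  have sj := sh j; rewrite ltnNge; apply/negP => le.
  have [k sk] : exists k, size (h j) = k.+3 by case: (size (h j)) sj => [|[|[|k]]] // _; exists k.
  have /eqP : (h j)^`()`_k.+1 = 0 by rewrite nth_default // (leq_trans le).
  rewrite coef_deriv mulrn_eq0; have -> : (h j)`_k.+2 = lead_coef (h j) by rewrite lead_coefE sk.
  by rewrite lead_coef_eq0 -size_poly_eq0 sk.
have [c hc] := horner_surj 0 sd.
exists (h j).[c] => w i; apply/solidP => n; apply: ltW.
have := @crit (j :: (w ++ nseq n i)) c isT.
rewrite Pw_cons horner_comp; apply.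
by rewrite deriv_comp hornerM hc mulr0.
Qed.

Lemma dichotomy (S : set C) w i : connected S -> S `&` rim w i = set0 ->
  S `&` solid w i = set0 \/ S `<=` (solid w i)^°.
Proof.
move=> cS h0; have [|/eqP/set0P ne] := pselect (S `&` solid w i = set0); first by left.
right; apply: connected_cut cS (@closed_solid w i) ne _ => z Sz Dz.
apply: contrapT => nz; have : (S `&` rim w i) z.
  by split; [exact: Sz|rewrite rimE; split; [exact: Dz|exact: nz]].
by rewrite h0.
Qed.

(** The inclusion makes the set forward invariant under [h j], and the set is bounded. *)
Lemma solid_invariant_filled w i j : solid w i `<=` solid (j :: w) i -> solid w i `<=` filled (h j) r.
Proof.
move=> sub; have [M hM] := compact_modulus_le (@compact_solid w i).
move=> z Dz; apply: (@bounded_filled _ _ _ (eh j) _ M) => n; apply: hM.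
elim: n => [//|n IH]; rewrite iterS.
by have := sub _ IH; rewrite solid_cons.
Qed.

(** The inclusion makes the complement forward invariant under [h j]. A disc in it around a point of
    J(h_j) would have all its iterates off [rim w i], against [no_avoid]. *)
Lemma rim_in_solid w i j : solid (j :: w) i `<=` solid w i -> rim [::] j `<=` solid w i.
Proof.
move=> sub z; rewrite rim_nil => fz; apply: contrapT => nz.
have /closedC/(_ z nz)[d d0 hd] := @closed_solid w i.
apply: (@no_avoid _ (h j) r (h i) r (Pw h w) z d) => // [|k]; first exact: size_Pw.
exists k => // y yd fy; apply: (hd y yd).
have : solid w i (iter k (horner (h j)) y) by apply: rim_sub.
elim: k {fy} => [//|k IH]; rewrite iterS => Dk; apply: IH; apply: sub.
by rewrite solid_cons.
Qed.

End PlaneContinua.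

(** * Bounded plane sets *)

Section Bounded.
Context {R : realType}.
Local Notation C := (R[i]^o).

Lemma bounded_modulus (A : set C) (M : R) : (forall z, A z -> modulus z <= M) -> bounded_set A.
Proof.
move=> hM; exists (M%:C%C); split; first by rewrite complex_real.
move=> N MN z Az; rewrite /= norm_modulus; apply: le_trans (ltW MN).
by rewrite lecR hM.
Qed.

Lemma modulus_bounded (A : set C) : bounded_set A -> exists M : R, forall z, A z -> modulus z <= M.
Proof.
move=> [M [Mr hM]]; exists (complex.Re M + 1) => z Az.
have MM : M = (complex.Re M)%:C%C by rewrite RRe_real.
have := hM (complex.Re M + 1)%:C%C.
rewrite {1}MM ltcR ltrDl ltr01 => /(_ isT) /(_ z Az) /=.
by rewrite norm_modulus lecR.
Qed.

End Bounded.

(** * Arrangement of the components *)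

Section Arrangement.
Context {R : realType}.
Implicit Types (z : R[i]) (p u : {poly R[i]}).
Local Notation C := (R[i]^o).
Variables (I : finType) (h : I -> {poly R[i]}) (r : R).
Hypothesis sh : forall i, (2 < size (h i))%N.
Hypothesis eh : forall i, escaping (h i) r.
Hypothesis crit : forall w z, w != [::] -> (Pw h w)^`().[z] = 0 -> modulus (Pw h w).[z] < r.

Opaque solid rim filled.

Lemma disjoint_elim (A B : set C) z : A `&` B = set0 -> A z -> B z -> False.
Proof. by move=> e Az Bz; have : (A `&` B) z by []; rewrite e. Qed.

Local Notation solid := (solid h r).
Local Notation rim := (rim h r).

(** By [Julia_words] this is the plane part of J(G) for each [i]; hence the hypothesis [limE]. *)
Definition limit_set i : set C := closure [set z : C | exists2 w, w != [::] & rim w i z].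

Hypothesis limE : forall i j, limit_set i = limit_set j.

Variables (m j1 : I) (J0 : set C).
Hypothesis j1m : j1 != m.
Local Notation JG := (limit_set m).

Hypothesis J0_connected : connected J0.
Hypothesis J0_nonempty : J0 !=set0.
Hypothesis J0_closed : closed J0.
Hypothesis J0_sub : J0 `<=` JG.
Hypothesis J0_max : forall S, connected S -> S `<=` JG -> S `&` J0 !=set0 -> S `<=` J0.
Hypothesis J0_rims : forall j, j != m -> rim [::] j `<=` J0.
Hypothesis J0_meets : forall j, j != m -> rim [:: j] m `&` J0 !=set0.
Hypothesis JG_disconnected : ~ connected JG.

Let sh1 i : (1 < size (h i))%N. Proof. exact: ltnW. Qed.
Let cSolid w i : connected (solid w i). Proof. exact: connected_solid. Qed.
Let cRim w i : connected (rim w i). Proof. exact: connected_rim. Qed.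
Let kSolid w i : compact (solid w i). Proof. exact: compact_solid. Qed.
Let clSolid w i : closed (solid w i). Proof. exact: closed_solid. Qed.
Let fSolid w i : full (solid w i). Proof. exact: full_solid. Qed.
Let rimF w i : rim w i = frontier (solid w i). Proof. exact: rimE. Qed.

Lemma rim_self i : rim [:: i] i = rim [::] i.
Proof.
have inv z := frontier_filled_invariant z (sh i) (eh i).
by rewrite rim_cons rim_nil; apply/seteqP; split=> z /inv.
Qed.

Lemma solid_self i : solid [:: i] i = solid [::] i.
Proof. by rewrite solid_cons solid_nil; exact: filled_preimage. Qed.

Lemma rim_limit w i : rim w i `<=` JG.
Proof.
rewrite -(limE i m); case: w => [|j w]; last by move=> z hz; apply: subset_closure; exists (j :: w).
by rewrite -rim_self => z hz; apply: subset_closure; exists [:: i].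
Qed.

Lemma limit_backward j : pfun (h j) @^-1` JG `<=` JG.
Proof.
move=> z /= cz; apply/closureC => d d0.
have /openC o := open_horner (sh1 j) (@open_disc _ z d).
have [|e e0 he] := o (pfun (h j) z); first by exists z => //; rewrite /disc /= subrr modulus0.
have [y [w w0 wy] yz] := (closureC _ _).1 cz e e0.
have [x xd xy] := he y yz; exists x; last exact: xd.
exists (j :: w); first by [].
by rewrite rim_cons /preimage /= xy.
Qed.

Lemma limit_backwardW w : pfun (Pw h w) @^-1` JG `<=` JG.
Proof.
elim: w => [|j w IH] z; first by rewrite /preimage /pfun /= hornerX.
rewrite /preimage /pfun /= horner_comp => hz; apply: (limit_backward (j := j)).
exact: IH.
Qed.

Lemma rim_nonempty w i : rim w i !=set0.
Proof. by have [b hb] := common_point sh crit i; apply: (rim_nonempty_of sh eh (hb w i)). Qed.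

Lemma limit_bounded z : JG z -> modulus z <= r.
Proof.
move=> cz; rewrite leNgt; apply/negP => rz.
have e0 : 0 < modulus z - r by rewrite subr_gt0.
have [y [w w0 wy] yz] := (closureC _ _).1 cz _ e0.
have ry : r < modulus y.
  by have := le_modulusB z y; rewrite modulusBC => a; lra.
have := filled_modulus (rim_sub sh wy); rewrite leNgt => /negP; apply.
apply: (lt_le_trans ry); apply: le_trans (Pw_escape eh w (ltW ry)).
by rewrite ler_peMl ?modulus_ge0 // exprn_ege1 //; lra.
Qed.

Lemma J0_bounded z : J0 z -> modulus z <= r.
Proof. by move=> /J0_sub/limit_bounded. Qed.

Lemma J0_compact : compact J0.
Proof. exact: compact_closed_bounded J0_closed J0_bounded. Qed.

Lemma J0_disjoint : J0 `&` rim [::] m = set0.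
Proof.
apply/seteqP; split=> // x [J0x rx]; exfalso; apply: JG_disconnected.
have rm : rim [::] m `<=` J0.
  by apply: J0_max => //; [exact: rim_limit|exists x].
have rall j : rim [::] j `<=` J0 by have [->//|/J0_rims] := eqVneq j m.
(* [h j] pulls its own Julia set, a connected subset of [J0], back to itself, so
   [connected_preimage] makes the preimage of [J0] connected; being inside J(G) and meeting [J0], it
   lies in [J0]. *)
have back j : pfun (h j) @^-1` J0 `<=` J0.
  apply: J0_max.
  - apply: (connected_preimage (sh1 j) J0_connected (rim_nonempty [::] j) (rall j)).
    by rewrite -rim_cons.
  - by move=> z /= /J0_sub/limit_backward.
  - have [z rz] := rim_nonempty [::] j; exists z; split; last exact: (rall j z rz).
    have rz2 : rim [:: j] j z by rewrite rim_self.
    by apply: (rall j); move: rz2; rewrite rim_cons.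
have allw w : rim w m `<=` J0.
  elim: w => [//|j w IH] z; rewrite rim_cons => hz; apply: (back j); exact: IH.
suff -> : JG = J0 by [].
apply/seteqP; split=> //.
move=> z cz; apply: J0_closed; apply: closure_subset cz => y [w _]; exact: allw.
Qed.

Lemma J0_position : J0 `&` solid [::] m = set0 \/ J0 `<=` (solid [::] m)^°.
Proof. exact: (dichotomy sh eh J0_connected J0_disjoint). Qed.

Lemma first_rim j : j != m -> rim [:: j] m `<=` J0.
Proof. by move=> jm; apply: J0_max; [exact: cRim|exact: rim_limit|exact: J0_meets]. Qed.

Lemma rim_in_or_out w i : rim w i `<=` J0 \/ J0 `&` rim w i = set0.
Proof.
have [|/eqP/set0P ne] := pselect (J0 `&` rim w i = set0); [by right|left].
by apply: J0_max => //; [exact: rim_limit|rewrite setIC].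
Qed.

Lemma solid_full w i (S : set C) : compact S -> frontier S `<=` (solid w i)^° -> S `<=` (solid w i)^°.
Proof. by move=> cS hS; apply: full_interior => // z Sz nz; apply: hS. Qed.

Lemma rim_not_interior w i z : rim w i z -> ~ (solid w i)^° z.
Proof. by rewrite rimF => -[]. Qed.

Lemma solid_meet S w i (b : C) : connected S -> S b -> (forall w i, solid w i b) ->
  S `&` rim w i = set0 -> S `<=` (solid w i)^°.
Proof.
move=> cS Sb hb S0; have [e|//] := dichotomy sh eh cS S0.
by have := disjoint_elim e Sb (hb w i).
Qed.

Lemma solid_absorbing w i j : solid w i `<=` solid (j :: w) i -> solid w i `<=` solid [::] j.
Proof. by rewrite solid_nil; exact: solid_invariant_filled. Qed.

(** * J0 outside the filled set of h_m *)

Section Outside.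
Hypothesis outside : J0 `&` solid [::] m = set0.

(** Suppose [J0] is interior to the solid of [j :: w]. The solid of [w] then lies in it too: its rim
    is in [J0], or it misses [J0] and sits inside K(h_j1), whose boundary is in [J0]. So it is
    forward invariant under [h j] and lies in K(h_j), which forces [J0] into the interior of K(h_j):
    impossible for [j = m] by position, and for [j != m] because [J0] contains J(h_j). *)
Lemma outside_claim w : ~ (J0 `<=` (solid w m)^°).
Proof.
have [b hb] := common_point sh crit m; have [a0 J0a] := J0_nonempty.
elim: w => [|j w IH] sub.
  exact: (disjoint_elim outside J0a (interior_subset (sub _ J0a))).
have key : solid w m `<=` (solid (j :: w) m)^°.
  have [zin|zout] := rim_in_or_out w m.
    by apply: (solid_full (@kSolid w m)); rewrite -rimF => z /zin/sub.
  have [dis|//] := dichotomy sh eh J0_connected zout.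
  have s1 : solid w m `<=` (solid [::] j1)^°.
    apply: (@solid_meet _ [::] j1 b (@cSolid w m) (hb w m) hb).
    apply/seteqP; split=> // z [Dz /(J0_rims j1m) Jz].
    exact: (disjoint_elim dis Jz Dz).
  have s2 : solid [::] j1 `<=` (solid (j :: w) m)^°.
    by apply: (solid_full (@kSolid [::] j1)); rewrite -rimF => y /(J0_rims j1m)/sub.
  by move=> z /s1/interior_subset/s2.
have k1 : solid w m `<=` solid [::] j.
  by apply: solid_absorbing => z /key/interior_subset.
have k2 : solid (j :: w) m `<=` solid [::] j.
  by rewrite solid_cons -(solid_self j) solid_cons => z; exact: k1.
have [jm|jm] := eqVneq j m.
  apply: (disjoint_elim outside J0a); rewrite -jm; apply: k2; exact: interior_subset (sub _ J0a).
have [z rz] := rim_nonempty [::] j.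
apply: (rim_not_interior rz); apply: (interiorS k2); apply: sub; exact: J0_rims rz.
Qed.

(** K(h_m) is forward invariant under every generator: for [j != m] it misses [J0], hence the rim of
    [[:: j]], and it contains the common point. *)
Lemma outside_core w : solid [::] m `<=` solid w m.
Proof.
have [b hb] := common_point sh crit m.
elim: w => [//|j w IH] z Kz; rewrite solid_cons /preimage /=; apply: IH.
have [jm|jm] := eqVneq j m.
  by move: Kz; rewrite -{1}(solid_self m) jm solid_cons.
have s1 : solid [::] m `<=` (solid [:: j] m)^°.
  apply: (@solid_meet _ [:: j] m b (@cSolid [::] m) (hb [::] m) hb).
  apply/seteqP; split=> // y [Ky /(first_rim jm) Jy].
  exact: (disjoint_elim outside Jy Ky).
by have := interior_subset (s1 _ Kz); rewrite solid_cons.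
Qed.

(** If the rim missed [J0], then [J0] would be disjoint from the solid of [j :: w]; but by
    [outside_core] that solid contains the rim of [[:: j]], which lies in [J0]. *)
Lemma outside_rims j w : j != m -> rim (j :: w) m `<=` J0.
Proof.
move=> jm; have [//|zout] := rim_in_or_out (j :: w) m.
have [dis|/outside_claim//] := dichotomy sh eh J0_connected zout.
have [y ry] := rim_nonempty [:: j] m.
have Jy := first_rim jm ry.
have : False; last by [].
apply: (disjoint_elim dis Jy); rewrite solid_cons /preimage /=; apply: outside_core.
by apply: (rim_sub sh); move: ry; rewrite rim_cons.
Qed.

End Outside.

(** * J0 in the interior of the filled set of h_m *)

Section Inside.
Hypothesis inside : J0 `<=` (solid [::] m)^°.

(** The mirror image of [outside_claim]: here the solid of [j :: w] is inside that of [w], so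
    [rim_in_solid] and backward invariance put J(h_j) in both. For [j != m] this meets [J0]; for
    [j = m] fullness adds K(h_m), which contains [J0]. *)
Lemma inside_claim w : ~ (J0 `&` solid w m = set0).
Proof.
have [b hb] := common_point sh crit m; have [a0 J0a] := J0_nonempty.
elim: w => [|j w IH] dis.
  exact: (disjoint_elim dis J0a (interior_subset (inside J0a))).
have avoid1 S : S `<=` J0 -> solid (j :: w) m `&` S = set0.
  move=> sS; apply/seteqP; split=> // z [Dz /sS Jz].
  exact: (disjoint_elim dis Jz Dz).
have key : solid (j :: w) m `<=` (solid w m)^°.
  have [zin|zout] := rim_in_or_out w m.
    by apply: (@solid_meet _ w m b (@cSolid _ m) (hb _ m) hb); exact: avoid1.
  have [/IH//|sub] := dichotomy sh eh J0_connected zout.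
  have s1 : solid (j :: w) m `<=` (solid [::] j1)^°.
    by apply: (@solid_meet _ [::] j1 b (@cSolid _ m) (hb _ m) hb); apply: avoid1; exact: J0_rims.
  have s2 : solid [::] j1 `<=` (solid w m)^°.
    by apply: (solid_full (@kSolid [::] j1)); rewrite -rimF => y /(J0_rims j1m)/sub.
  by move=> z /s1/interior_subset/s2.
have k1 : rim [::] j `<=` solid w m.
  by apply: (rim_in_solid sh eh) => z /key/interior_subset.
have k2 : rim [::] j `<=` solid (j :: w) m.
  by rewrite -rim_self rim_cons solid_cons => z; exact: k1.
have [jm|jm] := eqVneq j m; last first.
  have [z rz] := rim_nonempty [::] j.
  exact: (disjoint_elim dis (J0_rims jm rz) (k2 _ rz)).
apply: (disjoint_elim dis J0a).
apply: (@fSolid (j :: w) m (solid [::] m) (@kSolid [::] m)).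
  by move=> z Kz nz; apply: k2; rewrite jm rimF.
exact: interior_subset (inside J0a).
Qed.

Lemma inside_first j : solid [:: j] m `<=` solid [::] m.
Proof.
have [->|jm] := eqVneq j m; first by rewrite solid_self.
have s1 : solid [:: j] m `<=` (solid [::] m)^°.
  by apply: (solid_full (@kSolid [:: j] m)); rewrite -rimF => y /(first_rim jm)/inside.
by move=> z /s1/interior_subset.
Qed.

Lemma inside_core w : solid w m `<=` solid [::] m.
Proof.
elim: w => [//|j w IH] z; rewrite solid_cons => Dz; apply: (inside_first (j := j)).
by rewrite solid_cons /preimage /=; apply: IH.
Qed.

(** By [inside_core] the solid of [j :: w] lies in that of [[:: j]]; were [J0] interior to the
    former, the rim of [[:: j]] would be interior to its own solid. *)
Lemma inside_rims j w : j != m -> rim (j :: w) m `<=` J0.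
Proof.
move=> jm; have [//|zout] := rim_in_or_out (j :: w) m.
have [/inside_claim//|sub] := dichotomy sh eh J0_connected zout.
have [y ry] := rim_nonempty [:: j] m; have Jy := first_rim jm ry.
have incl : solid (j :: w) m `<=` solid [:: j] m.
  by rewrite !solid_cons => z Dz; rewrite /preimage /=; apply: (inside_core (w := w)).
by have := rim_not_interior ry (interiorS incl (sub _ Jy)).
Qed.

End Inside.

Lemma outer_rims j w : j != m -> rim (j :: w) m `<=` J0.
Proof.
by move=> jm; have [out|ins] := J0_position; [exact: outside_rims|exact: inside_rims].
Qed.

Definition layer n : set C := [set z | J0 (iter n (horner (h m)) z)].

Lemma layer_preimage n : layer n = pfun (Pw h (nseq n m)) @^-1` J0.
Proof. by apply/seteqP; split=> z; rewrite /layer /preimage /pfun /= Pw_nseq horner_pit. Qed.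

Lemma layer_shift n k z : layer (n + k) z <-> layer n (iter k (horner (h m)) z).
Proof. by rewrite /layer /= iterD. Qed.

Lemma solid_iter n i z : solid (nseq n m) i z <-> solid [::] i (iter n (horner (h m)) z).
Proof. by rewrite solid_pre /preimage /pfun /= Pw_nseq horner_pit. Qed.

Lemma core_iter n z : solid [::] m (iter n (horner (h m)) z) <-> solid [::] m z.
Proof. by rewrite solid_nil; exact: (filled_iter (eh m) z n). Qed.

Lemma core_rim_iter n z : rim [::] m (iter n (horner (h m)) z) <-> rim [::] m z.
Proof.
rewrite rim_nil; elim: n => [//|n IH]; rewrite iterS.
by apply: iff_trans (frontier_filled_invariant _ (sh m) (eh m)) IH.
Qed.

Lemma rim_layer n : rim (nseq n m) j1 `<=` layer n.
Proof. by rewrite layer_preimage rim_pre => z hz; apply: (J0_rims j1m); exact: hz. Qed.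

Lemma layer_connected n : connected (layer n).
Proof.
rewrite layer_preimage; apply: (connected_preimage (size_Pw sh _) J0_connected (rim_nonempty [::] j1)).
  exact: J0_rims.
by rewrite -rim_pre; exact: cRim.
Qed.

Lemma layer_sub n : layer n `<=` JG.
Proof. by rewrite layer_preimage => z /J0_sub/limit_backwardW. Qed.

Lemma layer_compact n : compact (layer n).
Proof. by rewrite layer_preimage; apply: compact_preimage_horner; [exact: size_Pw|exact: J0_compact]. Qed.

Lemma layer_closed n : closed (layer n).
Proof. by apply: compact_closed; [exact: hausdorffC|exact: layer_compact]. Qed.

Lemma core_rim_closed : closed (rim [::] m).
Proof. by rewrite rimF; apply: closed_frontier; exact: clSolid. Qed.

(** Stripping the leading letters [m] leaves the empty word or a word starting with another letter,
    to which [outer_rims] applies. *)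
Lemma rim_layers w : rim w m `<=` rim [::] m `|` \bigcup_n layer n.
Proof.
elim: w => [z|j w IH z]; first by left.
have [->|jm] := eqVneq j m; last first.
  by move=> hz; right; exists 0%N => //; exact: (outer_rims jm hz).
rewrite rim_cons => /IH[rz|[n _ Ln]].
  left; rewrite -(rim_self m) rim_cons; exact: rz.
by right; exists n.+1 => //; rewrite -addn1; apply/layer_shift; exact: Ln.
Qed.

Lemma away_from_J0 z : rim [::] m z ->
  exists2 d : R, 0 < d & forall y, modulus (y - z) < d -> ~ J0 y.
Proof.
move=> rz; have nz : ~ J0 z by move=> Jz; exact: (disjoint_elim J0_disjoint Jz rz).
by have /closedC/(_ z nz) := J0_closed.
Qed.

Lemma core_point : exists z, rim [::] m z /\ frontier (filled (h m) r) z.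
Proof. by have [z rz] := rim_nonempty [::] m; exists z; split; [exact: rz|rewrite -(rim_nil h)]. Qed.

(** If [layer n] met [J0] it would be contained in it, and [J0] would be backward invariant under
    [h_m^n]. Near a point of J(h_m), which is away from [J0], the iterates [h_m^(n k)] would then
    avoid J(h_j1), against [no_avoid]. *)
Lemma layer_disjoint0 n : (0 < n)%N -> layer n `&` J0 = set0.
Proof.
move=> n0; apply/seteqP; split=> // x [Lx Jx]; exfalso.
have sub : layer n `<=` J0.
  apply: J0_max; [exact: layer_connected|exact: layer_sub|by exists x].
have [z [rz fz]] := core_point.
have [d d0 hd] := away_from_J0 rz.
have sX : (1 < size ('X : {poly R[i]}))%N by rewrite size_polyX.
apply: (no_avoid (sh m) (eh m) (sh j1) (eh j1) sX fz d0) => k.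
exists (n * k)%N; first by rewrite leq_pmull.
move=> y yd; rewrite hornerX -rim_nil => ry; apply: (hd y yd).
have : J0 (iter (n * k) (horner (h m)) y) by exact: J0_rims ry.
elim: (k) => [|l IH]; first by rewrite muln0.
by rewrite mulnS iterD => hl; apply: IH; exact: sub.
Qed.

Lemma layer_disjoint a b z : (a < b)%N -> layer a z -> layer b z -> False.
Proof.
move=> ab La; rewrite -(subnK (ltnW ab)) => /layer_shift Lb.
by apply: (disjoint_elim (layer_disjoint0 _) Lb La); rewrite subn_gt0.
Qed.

Lemma layer_rim n z : layer n z -> rim [::] m z -> False.
Proof. by move=> Lz /(core_rim_iter n) rz; exact: (disjoint_elim J0_disjoint Lz rz). Qed.

Lemma rim_solid w i : rim w i `<=` solid w i.
Proof. exact: rim_sub. Qed.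

(** [h_m^k] carries [layer k] into the bounded set [J0], whereas near a point off K(h_m) large
    iterates are uniformly big; K(h_m) itself meets no layer. *)
Lemma outside_sparse z : J0 `&` solid [::] m = set0 -> ~ rim [::] m z ->
  exists2 d : R, 0 < d & exists N, forall k y, (N <= k)%N -> modulus (y - z) < d -> ~ layer k y.
Proof.
move=> outside nr.
have [Kz|nK] := pselect (solid [::] m z).
  have iz : (solid [::] m)^° z by apply: contrapT => ni; apply: nr; rewrite rimF.
  have /nbhsC[d d0 hd] := iz; exists d => //; exists 0%N => k y _ yd Ly.
  by apply: (disjoint_elim outside Ly); rewrite core_iter; exact: hd.
have nF : ~ filled (h m) r z by rewrite -solid_nil.
have [d d0 [N hN]] := escape_near (eh m) r nF.
exists d => //; exists N => k y Nk yd Ly.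
by have := hN k y Nk yd; rewrite ltNge J0_bounded.
Qed.

(** * Layers inside the filled set of h_m *)

Section InsideLayers.
Hypothesis inside : J0 `<=` (solid [::] m)^°.

Lemma inner_core : solid [::] j1 `<=` (solid [::] m)^°.
Proof. by apply: (solid_full (@kSolid [::] j1)); rewrite -rimF => y /(J0_rims j1m)/inside. Qed.

(** Otherwise [h_m] would pull K(h_j1) back into its own interior, and [rim_in_solid] would place
    J(h_m) in K(h_j1), which is interior to K(h_m). *)
Lemma J0_in_preimage : J0 `<=` (solid [:: m] j1)^°.
Proof.
have [b hb] := common_point sh crit m.
have r1 : rim [:: m] j1 `<=` layer 1 by exact: (@rim_layer 1).
have dis1 : J0 `&` rim [:: m] j1 = set0.
  by apply/seteqP; split=> // z [Jz /r1 Lz]; exact: (disjoint_elim (layer_disjoint0 (ltn0Sn 0)) Lz Jz).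
have [dis|//] := dichotomy sh eh J0_connected dis1; exfalso.
have s1 : solid [:: m] j1 `<=` (solid [::] j1)^°.
  apply: (@solid_meet _ [::] j1 b (@cSolid _ _) (hb _ _) hb).
  by apply/seteqP; split=> // z [Dz /(J0_rims j1m) Jz]; exact: (disjoint_elim dis Jz Dz).
have r2 : rim [::] m `<=` solid [::] j1.
  by apply: (rim_in_solid sh eh) => z /s1/interior_subset.
have [z rz] := rim_nonempty [::] m.
exact: (rim_not_interior rz (inner_core (r2 _ rz))).
Qed.

Lemma inner_absorbing : solid [::] j1 `<=` (solid [:: m] j1)^°.
Proof.
by apply: (solid_full (@kSolid [::] j1)); rewrite -rimF => y /(J0_rims j1m)/J0_in_preimage.
Qed.

Lemma inner_iter z n : solid [::] j1 z -> solid [::] j1 (iter n (horner (h m)) z).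
Proof.
move=> Dz; elim: n => [//|n IH]; rewrite iterS.
by have := interior_subset (inner_absorbing IH); rewrite solid_cons.
Qed.

(** Otherwise K(h_j1) and its preimage under [h_m] would each lie in the interior of the other. *)
Lemma layer1_inner : layer 1 `&` solid [::] j1 = set0.
Proof.
have dis : layer 1 `&` rim [::] j1 = set0.
  apply/seteqP; split=> // z [Lz /(J0_rims j1m) Jz].
  exact: (disjoint_elim (layer_disjoint0 (ltn0Sn 0)) Lz Jz).
have [//|sub] := dichotomy sh eh (@layer_connected 1) dis; exfalso.
have r1 : rim [:: m] j1 `<=` layer 1 by exact: (@rim_layer 1).
have s1 : solid [:: m] j1 `<=` (solid [::] j1)^°.
  by apply: (solid_full (@kSolid [:: m] j1)); rewrite -rimF => y /r1/sub.
have [z rz] := rim_nonempty [:: m] j1.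
apply: (rim_not_interior rz); apply: inner_absorbing; apply: interior_subset.
by apply: s1; exact: rim_solid.
Qed.

(** Together with [layer_late]: the orbit does not reach K(h_j1) before time [k], and is there from
    time [k + 1] on. *)
Lemma layer_early z n k : layer k z -> (n < k)%N -> ~ solid [::] j1 (iter n (horner (h m)) z).
Proof.
move=> Lz nk Dz; case: k nk Lz => // k nk Lz.
have Lk : layer 1 (iter k (horner (h m)) z) by rewrite -layer_shift add1n.
apply: (disjoint_elim layer1_inner Lk).
have le : (n <= k)%N by [].
by rewrite -(subnK le) iterD; exact: inner_iter.
Qed.

Lemma layer_late z n k : layer k z -> (k < n)%N -> solid [::] j1 (iter n (horner (h m)) z).
Proof.
move=> Lz kn; rewrite -(subnK kn) iterD; apply: inner_iter.
by have := interior_subset (J0_in_preimage Lz); rewrite solid_cons.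
Qed.

(** If layers accumulated at [z], the orbit of [z] would by continuity never enter the interior of
    K(h_j1), hence never that of its preimage, while points near [z] do enter K(h_j1). Compactness
    leaves a gap [delta] between K(h_j1) and the outside of that preimage interior; but the iterates
    of [h_m], bounded on K(h_m), share a Lipschitz constant near [z]. *)
Lemma inside_sparse z : ~ rim [::] m z ->
  exists2 d : R, 0 < d & exists N, forall k y, (N <= k)%N -> modulus (y - z) < d -> ~ layer k y.
Proof.
move=> nr; have [Kz|nK] := pselect (solid [::] m z); last first.
  have /closedC/(_ z nK)[d d0 hd] := @clSolid [::] m.
  exists d => //; exists 0%N => k y _ yd Ly; apply: (hd y yd).
  by rewrite -(core_iter k); exact: interior_subset (inside Ly).
have iz : (solid [::] m)^° z by apply: contrapT => ni; apply: nr; rewrite rimF.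
have /nbhsC[rho rho0 hrho] := iz.
apply: contrapT => nsparse.
have acc (d : R) N : 0 < d -> exists2 k, (N <= k)%N & exists2 y, modulus (y - z) < d & layer k y.
  move=> d0; apply: contrapT => nk; apply: nsparse; exists d => //; exists N => k y Nk yd Ly.
  by apply: nk; exists k => //; exists y.
have never n : ~ (solid [::] j1)^° (iter n (horner (h m)) z).
  move=> /nbhsC[e e0 he].
  have [d d0 hd] := horner_continuousC (pit (h m) n) z e0.
  have [k nk [y yd Ly]] := acc d n.+1 d0.
  apply: (layer_early Ly nk); apply: he; have := hd y yd; by rewrite !horner_pit.
have never1 n : ~ (solid [:: m] j1)^° (iter n (horner (h m)) z).
  have -> : (solid [:: m] j1)^° = pfun (h m) @^-1` (solid [::] j1)^°.
    by rewrite solid_cons interior_preimage_horner.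
  exact: (never n.+1).
have [delta delta0 hdelta] : exists2 d : R, 0 < d &
    forall a b, solid [::] j1 a -> (~` (solid [:: m] j1)^°) b -> d <= modulus (a - b).
  apply: compact_closed_dist; first exact: kSolid.
    by apply: open_closedC; exact: open_interior.
  by apply/seteqP; split=> // y [Dy]; apply; exact: inner_absorbing.
have rho20 : 0 < rho / 2 by rewrite divr_gt0.
have bound n y : modulus (y - z) <= rho / 2 -> modulus (pit (h m) n).[y] <= r.
  move=> yr; rewrite horner_pit.
  have : solid [::] m (iter n (horner (h m)) y).
    by rewrite core_iter; apply: hrho; lra.
  by rewrite solid_nil => /filled_modulus.
(* The constant of [lipschitz_disc] for radius [rho / 2] and bound [r]. *)
pose L := 4 * r / (rho / 2).
have rr0 : 0 < r := r_gt0 eh m.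
have L0 : 0 < L by rewrite divr_gt0 // mulr_gt0.
pose d := Num.min (rho / 2 / 2) (delta / L).
have d0 : 0 < d by rewrite lt_min divr_gt0 //= divr_gt0.
have [k _ [y yd Ly]] := acc d 0%N d0.
have /andP[yd1 yd2] : (modulus (y - z) < rho / 2 / 2) && (modulus (y - z) < delta / L).
  by move: yd; rewrite lt_min.
have yy : modulus (z - z) <= rho / 2 / 2 by rewrite subrr modulus0 !divr_ge0 // ltW.
have := lipschitz_disc rho20 (bound k.+1) (ltW yd1) yy; rewrite !horner_pit.
apply/negP; rewrite -ltNge.
apply: (@lt_le_trans _ _ delta); first by rewrite -/L mulrC -ltr_pdivlMr.
apply: hdelta; first exact: layer_late Ly _.
exact: never1.
Qed.

End InsideLayers.

Lemma layer_sparse z : ~ rim [::] m z ->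
  exists2 d : R, 0 < d & exists N, forall k y, (N <= k)%N -> modulus (y - z) < d -> ~ layer k y.
Proof.
by move=> nr; have [out|ins] := J0_position; [exact: outside_sparse|exact: inside_sparse].
Qed.

Lemma layer_apart n N z : layer n z -> exists2 d : R, 0 < d &
  forall k y, (k < N)%N -> k != n -> modulus (y - z) < d -> ~ layer k y.
Proof.
move=> Lz; elim: N => [|N [d d0 hd]]; first by exists 1.
have [Nn|Nn] := eqVneq N n.
  exists d => // k y; rewrite ltnS leq_eqVlt => /predU1P[->|kN]; first by rewrite Nn eqxx.
  exact: hd.
have nL : ~ layer N z.
  move=> LN; have [lt|gt|e] := ltngtP N n; last by rewrite e eqxx in Nn.
    exact: (layer_disjoint lt LN Lz).
  exact: (layer_disjoint gt Lz LN).
have /closedC/(_ z nL)[e e0 he] := @layer_closed N.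
exists (Num.min d e); first by rewrite lt_min d0.
move=> k y; rewrite ltnS leq_eqVlt lt_min => /predU1P[->|kN] kn /andP[y1 y2]; first exact: he.
exact: hd kN kn y1.
Qed.

Lemma limit_set_layers : JG = rim [::] m `|` \bigcup_n layer n.
Proof.
apply/seteqP; split=> [z cz|z [|[n _]]]; [|exact: rim_limit|exact: layer_sub].
have [rz|nr] := pselect (rim [::] m z); [by left|right].
have [d d0 [N hN]] := layer_sparse nr.
have /closedC/(_ z nr)[e e0 he] := core_rim_closed.
apply: contrapT => nz.
have [d' d'0 hd'] : exists2 d : R, 0 < d & forall k y, (k < N)%N -> modulus (y - z) < d -> ~ layer k y.
  elim: (N) => [|M [a a0 ha]]; first by exists 1.
  have nL : ~ layer M z by move=> LM; apply: nz; exists M.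
  have /closedC/(_ z nL)[c c0 hc] := @layer_closed M.
  exists (Num.min a c); first by rewrite lt_min a0.
  move=> k y; rewrite ltnS leq_eqVlt lt_min => /predU1P[->|kN] /andP[y1 y2]; first exact: hc.
  exact: ha kN y1.
have [|y [w _ wy]] := (closureC _ _).1 cz (Num.min (Num.min d e) d').
  by rewrite !lt_min d0 e0.
rewrite !lt_min => /andP[/andP[y1 y2] y3].
have [ry|[k _ Lk]] := rim_layers wy; first exact: (he y y2 ry).
have [kN|Nk] := ltnP k N; first exact: (hd' k y kN y3 Lk).
exact: (hN k y Nk y1 Lk).
Qed.

(** Closedness of this remainder makes each layer relatively clopen in J(G): a component at positive
    distance from the rest. *)
Definition co_layer n : set C := JG `&` ~` layer n.

Lemma co_layer_closed n : closed (co_layer n).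
Proof.
move=> z cz; have Jz : JG z.
  by apply: closed_closure; apply: closure_subset cz => y [].
split=> // Lz.
have nr : ~ rim [::] m z by exact: layer_rim Lz.
have [d d0 [N hN]] := layer_sparse nr.
have [e e0 he] := layer_apart N Lz.
have /closedC/(_ z nr)[c c0 hc] := core_rim_closed.
have [|y [Jy nL]] := (closureC _ _).1 cz (Num.min (Num.min d e) c).
  by rewrite !lt_min d0 e0.
rewrite !lt_min => /andP[/andP[y1 y2] y3].
move: Jy; rewrite limit_set_layers => -[ry|[k _ Lk]]; first exact: (hc y y3 ry).
have [kn|kn] := eqVneq k n; first by apply: nL; rewrite -kn.
have [kN|Nk] := ltnP k N; first exact: (he k y kN kn y2 Lk).
exact: (hN k y Nk y1 Lk).
Qed.

Lemma layer_isolated n : exists2 d : R, 0 < d &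
  forall a b, layer n a -> co_layer n b -> d <= modulus (a - b).
Proof.
apply: compact_closed_dist; [exact: layer_compact|exact: co_layer_closed|].
by apply/seteqP; split=> // z [Lz [_ nL]]; case: (nL Lz).
Qed.

Lemma layer_max n (S : set C) : connected S -> S `<=` JG -> S `&` layer n !=set0 -> S `<=` layer n.
Proof.
move=> cS SJ [x [Sx Lx]].
have dis : layer n `&` co_layer n = set0 by apply/seteqP; split=> // z [Lz [_ nL]]; case: (nL Lz).
have cov : S `<=` layer n `|` co_layer n.
  by move=> z Sz; have [Lz|nL] := pselect (layer n z); [left|right; split=> //; exact: SJ].
have [//|sub] := connected_closed_split cS (@layer_closed n) (@co_layer_closed n) dis cov.
by have [] := sub x Sx.
Qed.

Lemma core_rim_max (S : set C) : connected S -> S `<=` JG -> S `&` rim [::] m !=set0 -> S `<=` rim [::] m.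
Proof.
move=> cS SJ [x [Sx rx]] z Sz; apply: contrapT => nr.
have : JG z by exact: SJ.
rewrite limit_set_layers => -[//|[n _ Ln]].
have sub : S `<=` layer n.
  by apply: (layer_max cS SJ); exists z; split; [exact: Sz|exact: Ln].
exact: (layer_rim (sub x Sx) rx).
Qed.

(** The witness is the component of the complement of [K2] at [b]. It contains [Q], and it is
    bounded because it misses a rim while [b] lies in the corresponding solid. *)
Lemma surround_of (K1 K2 Q : set C) w i (b : C) : (forall w i, solid w i b) ->
  connected Q -> Q b -> K1 `<=` Q -> Q `&` K2 = set0 -> rim w i `<=` K2 -> surround_le K1 K2.
Proof.
move=> hb cQ Qb KQ dis rK; right; exists b.
have QK : Q `<=` ~` K2 by move=> z Qz Kz; exact: (disjoint_elim dis Qz Kz).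
split; [exact: QK| |].
  have [M hM] := compact_modulus_le (@kSolid w i).
  apply: (@bounded_modulus _ _ M) => z Cz; apply: hM; apply: interior_subset.
  apply: (@solid_meet _ w i b (@component_connected _ _ _) _ hb _ _ Cz).
    by apply: connected_component_refl; exact: QK.
  apply/seteqP; split=> // y [Cy /rK Ky].
  exact: (connected_component_sub Cy Ky).
by move=> z /KQ Qz; apply: (connected_component_max Qb QK cQ).
Qed.

Lemma surround_refl (K : set C) : surround_le K K.
Proof. by left. Qed.

Lemma outside_order : J0 `&` solid [::] m = set0 ->
  (forall n, surround_le (rim [::] m) (layer n)) /\ (forall n, surround_le (layer n) J0).
Proof.
move=> outside; have [b hb] := common_point sh crit m; split=> n.
  have dis : solid [::] m `&` layer n = set0.
    apply/seteqP; split=> z; last by [].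
    by move=> [Kz Lz]; exact: (disjoint_elim outside Lz ((@core_iter n z).2 Kz)).
  have sub : rim [::] m `<=` solid [::] m by move=> z; exact: rim_solid.
  have key := @surround_of (rim [::] m) (layer n) (solid [::] m) (nseq n m) j1 b hb (@cSolid [::] m) (hb [::] m) sub dis.
  apply: key.
  exact: (@rim_layer n).
case: n => [|n]; first by left.
have cQ : connected (solid (nseq n.+1 m) j1 `|` layer n.+1).
  apply: connectedU; [|exact: cSolid|exact: layer_connected].
  have [z rz] := rim_nonempty (nseq n.+1 m) j1.
  by exists z; split; [exact: rim_solid|exact: rim_layer].
apply: (surround_of hb cQ _ _ _ (J0_rims j1m)).
- by left; exact: hb.
- by move=> z Lz; right.
apply/seteqP; split=> // z [[Dz|Lz] Jz]; last first.
  exact: (disjoint_elim (layer_disjoint0 (ltn0Sn n)) Lz Jz).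
have dis1 : J0 `&` rim (nseq n.+1 m) j1 = set0.
  apply/seteqP; split=> // y [Jy /rim_layer Ly].
  exact: (disjoint_elim (layer_disjoint0 (ltn0Sn n)) Ly Jy).
have [dis|sub] := dichotomy sh eh J0_connected dis1; first exact: (disjoint_elim dis Jz Dz).
have s1 : solid [::] j1 `<=` (solid (nseq n.+1 m) j1)^°.
  by apply: (solid_full (@kSolid [::] j1)); rewrite -rimF => y /(J0_rims j1m)/sub.
(* Bounded and invariant under a positive iterate of [h_m], K(h_j1) contains no escaping point of
   [h_m]; but its boundary is in [J0], outside K(h_m). *)
have s2 : solid [::] j1 `<=` solid [::] m.
  move=> y Dy; rewrite solid_nil; apply: contrapT => ny.
  have [N hN] := filledPn (eh m) r ny.
  have : solid [::] j1 (iter (n.+1 * N) (horner (h m)) y).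
    elim: (N) => [|k IH]; first by rewrite muln0.
    by rewrite mulnS iterD; apply/solid_iter; exact: interior_subset (s1 _ IH).
  rewrite solid_nil => /filled_modulus; rewrite leNgt => /negP; apply; apply: hN.
  by rewrite leq_pmull.
have [y ry] := rim_nonempty [::] j1.
exact: (disjoint_elim outside (J0_rims j1m ry) (s2 _ (rim_solid ry))).
Qed.

Lemma inside_order : J0 `<=` (solid [::] m)^° ->
  (forall n, surround_le J0 (layer n)) /\ (forall n, surround_le (layer n) (rim [::] m)).
Proof.
move=> inside; have [b hb] := common_point sh crit m.
have rim_int z : rim [::] m z -> (solid [::] m)^° z -> False by move=> rz; exact: (rim_not_interior rz).
have it_int n z : (solid [::] m)^° (iter n (horner (h m)) z) -> (solid [::] m)^° z.
  move=> iz; apply: contrapT => nz.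
  have Sz : solid [::] m z by apply: (core_iter n z).1; exact: interior_subset iz.
  have rz : rim [::] m z by rewrite rimF; split; [exact: Sz|exact: nz].
  exact: (rim_int _ ((core_rim_iter n z).2 rz) iz).
split=> n.
  case: n => [|n]; first by left.
  have cQ : connected (solid [::] j1 `|` J0).
    apply: connectedU; [|exact: cSolid|exact: J0_connected].
    have [z rz] := rim_nonempty [::] j1.
    by exists z; split; [exact: rim_solid|exact: (J0_rims j1m)].
  have dis : (solid [::] j1 `|` J0) `&` layer n.+1 = set0.
    apply/seteqP; split=> [z [[Dz|Jz] Lz]|z []].
      exact: (@layer_early inside z 0 n.+1 Lz (ltn0Sn n) Dz).
    exact: (disjoint_elim (layer_disjoint0 (ltn0Sn n)) Lz Jz).
  have Qb : (solid [::] j1 `|` J0) b by left; exact: hb.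
  have sub : J0 `<=` solid [::] j1 `|` J0 by move=> z Jz; right; exact: Jz.
  have key := @surround_of J0 (layer n.+1) (solid [::] j1 `|` J0) (nseq n.+1 m) j1 b hb cQ Qb sub dis.
  apply: key.
  exact: (@rim_layer n.+1).
have cQ : connected (solid (nseq n m) j1 `|` layer n).
  apply: connectedU; [|exact: cSolid|exact: layer_connected].
  have [z rz] := rim_nonempty (nseq n m) j1.
  by exists z; split; [exact: rim_solid|exact: rim_layer].
have dis : (solid (nseq n m) j1 `|` layer n) `&` rim [::] m = set0.
  apply/seteqP; split=> [z [[Dz|Lz] rz]|z []]; apply: (rim_int z rz); apply: (it_int n).
    by apply: (inner_core inside); apply/solid_iter; exact: Dz.
  by apply: inside; exact: Lz.
have Qb : (solid (nseq n m) j1 `|` layer n) b by left; exact: hb.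
have sub : layer n `<=` solid (nseq n m) j1 `|` layer n by move=> z Lz; right; exact: Lz.
have key := @surround_of (layer n) (rim [::] m) (solid (nseq n m) j1 `|` layer n) [::] m b hb cQ Qb sub dis.
by apply: key.
Qed.

(* The components of J(G): J(h_m) comes first, then h_m^-k(J0). *)
Definition stratum n : set C := if n is k.+1 then layer k else rim [::] m.

Lemma stratum_components : [set connected_component JG z | z in JG] = range stratum.
Proof.
have core z : rim [::] m z -> connected_component JG z = rim [::] m.
  move=> rz; have Jz : JG z by exact: (rim_limit rz).
  apply/seteqP; split.
    apply: (@core_rim_max _ (@component_connected _ _ _) (@connected_component_sub _ _ _)).
    by exists z; split; [exact: connected_component_refl|exact: rz].
  exact: (@connected_component_max _ JG (rim [::] m) z rz (@rim_limit [::] m) (@cRim [::] m)).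
have strat n z : layer n z -> connected_component JG z = layer n.
  move=> Lz; have Jz : JG z by exact: (layer_sub Lz).
  apply/seteqP; split.
    apply: (@layer_max n _ (@component_connected _ _ _) (@connected_component_sub _ _ _)).
    by exists z; split; [exact: connected_component_refl|exact: Lz].
  exact: (@connected_component_max _ JG (layer n) z Lz (@layer_sub n) (@layer_connected n)).
apply/seteqP; split=> [_ [z Jz <-]|_ [[|n] _ <-]].
- have [rz|[n _ Lz]] : (rim [::] m `|` \bigcup_n layer n) z by rewrite -limit_set_layers.
    by exists 0%N; [|exact: (esym (core z rz))].
  by exists n.+1; [|exact: (esym (strat n z Lz))].
- have [z rz] := rim_nonempty [::] m.
  by exists z; [exact: (rim_limit rz)|exact: core].
- have [z rz] := rim_nonempty (nseq n m) j1.
  by exists z; [exact: (layer_sub (rim_layer rz))|exact: (strat _ _ (rim_layer rz))].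
Qed.

Lemma stratum_nonempty n : stratum n !=set0.
Proof.
case: n => [|n]; first exact: rim_nonempty.
by have [z rz] := rim_nonempty (nseq n m) j1; exists z; exact: rim_layer.
Qed.

Lemma stratum_disjoint a b z : stratum a z -> stratum b z -> a = b.
Proof.
case: a b => [|a] [|b] //= h1 h2; [exact: False_ind (layer_rim h2 h1)|exact: False_ind (layer_rim h1 h2)|].
have [lt|lt|->//] := ltngtP a b; [exact: False_ind (layer_disjoint lt h1 h2)|exact: False_ind (layer_disjoint lt h2 h1)].
Qed.

Lemma stratum_compact n : compact (stratum n).
Proof.
case: n => [|n]; last exact: (@layer_compact n).
by apply: (compact_closed_bounded core_rim_closed (M := r)) => z rz; exact: (limit_bounded (@rim_limit [::] m z rz)).
Qed.

Lemma stratum_order :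
  (forall n, surround_le (stratum 0) (stratum n) /\ surround_le (stratum n) (stratum 1)) \/
  (forall n, surround_le (stratum 1) (stratum n) /\ surround_le (stratum n) (stratum 0)).
Proof.
have [out|ins] := J0_position; [left|right].
  have [u1 u2] := outside_order out.
  by case=> [|n]; split; [exact: surround_refl|exact: (u1 0%N)|exact: u1|exact: u2].
have [u1 u2] := inside_order ins.
case=> [|n]; split; [exact: (u2 0%N)|exact: surround_refl|exact: u1|exact: u2].
Qed.

Lemma stratum_sub n : stratum n `<=` JG.
Proof. by case: n => [|n]; [exact: (@rim_limit [::] m)|exact: (@layer_sub n)]. Qed.

Lemma stratum_isolated k : exists2 d : R, 0 < d &
  forall i a b, i != k.+1 -> stratum k.+1 a -> stratum i b -> d <= modulus (a - b).
Proof.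
have [d d0 hd] := layer_isolated k; exists d; first exact: d0.
move=> i a b ik sa sb; apply: hd; first exact: sa.
split; first exact: (stratum_sub sb).
by move=> Lb; move/eqP: ik; apply; exact: (@stratum_disjoint i k.+1 b sb Lb).
Qed.

End Arrangement.

(** * From the plane to the sphere *)

Section Lifting.
Context {R : realType}.
Local Notation C := (R[i]^o).
Local Notation Chat := (sphere R).
Implicit Types (A B K : set C) (z : C).

Lemma some_imageK A : Some @^-1` (Some @` A : set Chat) = A.
Proof. by apply/seteqP; split=> [z [w Aw [<-]]|z Az] //; exists z. Qed.

Lemma some_image_inj A B : (Some @` A : set Chat) = Some @` B -> A = B.
Proof. by move=> e; rewrite -(some_imageK A) e some_imageK. Qed.

Lemma connected_some A : connected (Some @` A : set Chat) <-> connected A.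
Proof.
split=> cA; last first.
  apply: connected_continuous_connected cA _; apply: continuous_subspaceT.
  exact: one_point_compactification_some_continuous.
move=> B B0 [V oV BV] [D cD BD]; apply: some_image_inj; apply: cA.
- by have [z Bz] := B0; exists (Some z), z.
- exists (Some @` V); first exact: one_point_compactification_open_some.
  by rewrite BV; apply/seteqP; split=> [_ [z [Az Vz] <-]|_ [[z Az <-] [w Vw [wz]]]];
    [split; exists z|exists z => //; rewrite -wz in Az *; split].
exists (~` (Some @` (~` D) : set Chat)).
  by apply: open_closedC; apply: one_point_compactification_open_some; exact: closed_openC.
rewrite BD; apply/seteqP; split=> [_ [z [Az Dz] <-]|_ [[z Az <-] nz]].
  by split; [exists z|move=> [w nw [wz]]; apply: nw; rewrite wz].
by exists z => //; split=> //; apply: contrapT => nD; apply: nz; exists z.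
Qed.

Lemma component_some A z :
  connected_component (Some @` A : set Chat) (Some z) = Some @` connected_component A z.
Proof.
apply/seteqP; split=> [x [B [Bz BA cB] Bx]|_ [x [B [Bz BA cB] Bx] <-]]; last first.
  by exists (Some @` B); [split; [exists z|exact: image_subset|exact/connected_some]|exists x].
have [w Aw wx] := BA _ Bx; exists w => //; rewrite -wx in Bx.
have BE : B = Some @` (Some @^-1` B : set C).
  by apply/seteqP; split=> [y By|_ [y By <-]] //; have [v _ vy] := BA _ By; exists v => //; rewrite /= vy.
exists (Some @^-1` B); last exact: Bx.
split=> //; last by apply/connected_some; rewrite -BE.
by move=> y By; have [v Av [<-]] := BA _ By.
Qed.

Lemma components_some G A : Julia G = Some @` A ->
  Julia_components G = [set (Some @` K : set Chat) | K in [set connected_component A z | z in A]].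
Proof.
rewrite /Julia_components => ->; apply/seteqP; split=> [_ [_ [z Az <-] <-]|_ [_ [z Az <-] <-]].
  by rewrite component_some; exists (connected_component A z) => //; exists z.
by exists (Some z); [exists z|rewrite component_some].
Qed.

(* The horizontal ray going right from [z] avoids [K2] and is unbounded. *)
Lemma surround_rightmost K1 K2 z : surround_le K1 K2 -> K1 z ->
  (forall w, K2 w -> complex.Re w <= complex.Re z) -> K1 = K2.
Proof.
move=> [//|[c [nc bc sub]]] K1z hK2; exfalso.
pose S : set C := [set w | exists2 t : R, 0 <= t & w = z + t%:C%C].
have cS : connected S.
  apply: connected_convex => _ _ t [a a0 ->] [b b0 ->] /andP[t0 t1].
  exists (a + t * (b - a)); first by nra.
  by rewrite rmorphD rmorphM rmorphB /=; ring.
have Sz : S z by exists 0; rewrite ?addr0.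
have Sn : S `<=` ~` K2.
  move=> _ [t t0 ->]; have [->|tn] := eqVneq t 0.
    by rewrite addr0; exact: (connected_component_sub (sub z K1z)).
  move=> /hK2; rewrite ReD /= => le; have tp : 0 < t by rewrite lt_neqAle eq_sym tn.
  lra.
have SC : S `<=` connected_component (~` K2) c.
  move=> w Sw; apply: connected_component_trans (sub z K1z) _.
  exact: (@connected_component_max _ (~` K2) S z Sz Sn cS w Sw).
have [M hM] := modulus_bounded bc.
have [t tE] : {t | t = M + modulus z + 1} by exists (M + modulus z + 1).
have M0 : 0 <= M by apply: le_trans (modulus_ge0 z) (hM _ (SC z Sz)).
have z0 := modulus_ge0 z.
have t0 : 0 <= t by rewrite tE; lra.
have := hM _ (SC (z + t%:C%C) (ex_intro2 _ _ t t0 erefl)).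
have := le_modulusBD (z + t%:C%C) z.
rewrite addrAC subrr add0r modulus_real ger0_norm // tE; lra.
Qed.

(** Of two sets surrounding each other, the one reaching further right cannot be properly
    surrounded. This antisymmetry identifies the values of [get] in [Jmin] and [Jmax]. *)
Lemma surround_anti K1 K2 : compact K1 -> compact K2 -> K1 !=set0 -> K2 !=set0 ->
  surround_le K1 K2 -> surround_le K2 K1 -> K1 = K2.
Proof.
move=> k1 k2 n1 n2 le12 le21.
have Re_continuous : continuous ((fun z => complex.Re z) : C -> R).
  move=> z B /nbhs_ballP[e /= e0 eB]; apply/nbhsC; exists e => // w wz; apply: eB.
  by rewrite /ball /= -raddfB (le_lt_trans (modulus_Re _)) // modulusBC.
have [z1 /set_mem m1 h1] := compact_EVT_max n1 k1 (continuous_subspaceT Re_continuous).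
have [z2 /set_mem m2 h2] := compact_EVT_max n2 k2 (continuous_subspaceT Re_continuous).
have [le|lt] := leP (complex.Re z2) (complex.Re z1).
  apply: (surround_rightmost le12 m1) => w /mem_set/h2 h; exact: le_trans h le.
apply/esym; apply: (surround_rightmost le21 m2) => w /mem_set/h1 h; exact: le_trans h (ltW lt).
Qed.

End Lifting.

(** * Polynomials and a common escape radius for a semigroup in calG *)

Section Semigroups.
Context {R : realType}.
Local Notation C := (R[i]^o).
Local Notation Chat := (sphere R).
Implicit Types (p f : {poly R[i]}) (z c : C).

Lemma is_derive_pfun p z : is_derive z (1 : C) (pfun p : C -> C) (p^`().[z] : C).
Proof.
elim/poly_ind: p => [|p c ih].
  rewrite deriv0 horner0 (_ : pfun 0 = cst (0 : C)); first exact: is_derive_cst.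
  by apply/funext => y; rewrite /pfun horner0.
rewrite (_ : pfun (p * 'X + c%:P) = (pfun p * (id : C -> C) + cst (c : C))%R); last first.
  by apply/funext => y; rewrite /pfun !fctE !hornerE.
have dM := is_deriveM ih (is_derive_id z (1 : C)).
have dD := is_deriveD dM (is_derive_cst (c : C) z (1 : C)).
apply: (@is_derive_eq _ _ _ _ _ _ _ _ dD).
by rewrite derivD derivM derivX derivC !hornerE /pfun /GRing.scale /=; ring.
Qed.

(** At a finite point with finite image both charts are affine, and the coordinate expression of
    [poly_ext p] reduces to [pfun p]. *)
Lemma critical_poly_ext p c : p^`().[c] = 0 -> critical_point (poly_ext p) (Some c).
Proof. by move=> pc; have := is_derive_pfun p c; rewrite pc. Qed.

Lemma escaping_large p : (2 < size p)%N ->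
  exists2 r0 : R, 1 <= r0 & forall r, r0 <= r -> escaping p r.
Proof.
move=> sp; have [_ [c2 [r0 [_ /andP[c20 _] r1 _ lo]]]] := horner_growth (ltnW sp).
have ci : 0 < 2 / c2 by rewrite divr_gt0.
(* [|z| >= 2 / c2] gives [c2 |z| >= 2], and since the degree [d] is at least two,
   [c2 |z|^d >= 2 |z|]. *)
exists (r0 + 2 / c2); first by lra.
move=> r hr; split=> [|z rz]; first by lra.
have := lo z; move/(_ (le_trans _ rz)) => lo'.
apply: le_trans (lo' _); last by lra.
have [d dE] : exists d, (size p).-1 = d.+2 by exists (size p - 3)%N; lia.
rewrite dE !exprS.
have zc : 2 <= c2 * modulus z.
  rewrite mulrC -ler_pdivrMr //; lra.
have m1 : 1 <= modulus z by lra.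
have u1 := exprn_ege1 d m1; move: (modulus z ^+ d) u1 => u u1.
have mm : 2 * modulus z <= c2 * modulus z * modulus z by rewrite ler_wpM2r // modulus_ge0.
apply: (le_trans mm); rewrite -mulrA ler_wpM2l ?(ltW c20) // mulrA ler_peMr //; nra.
Qed.

Lemma calG_polynomials (n : nat) (h : 'I_n.+1 -> Chat -> Chat) : calG (semigroup_gen (range h)) ->
  exists (p : 'I_n.+1 -> {poly R[i]}) (r : R), [/\ forall j, h j = poly_ext (p j), forall j, (2 < size (p j))%N,
    forall j, escaping (p j) r & forall w z, w != [::] -> (Pw p w)^`().[z] = 0 -> modulus (Pw p w).[z] < r].
Proof.
move=> [_ deg /modulus_bounded[M hM]].
have /choice[p hp] j : exists p : {poly R[i]}, (2 < size p)%N /\ h j = poly_ext p.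
  have [|d d2 [p sp hj]] := deg (h j); last by exists p; rewrite sp.
  by move=> S [_ sub]; apply: sub; exists j.
have hE : h = (fun j => poly_ext (p j)) by apply/funext => j; case: (hp j).
have /choice[s hs] j : exists s : R, 1 <= s /\ forall r, s <= r -> escaping (p j) r.
  by have [s s1 hs] := escaping_large (hp j).1; exists s.
(* One radius beyond all the escape radii, and strictly beyond the critical values of all words. *)
pose r := `|M| + 1 + \sum_j s j.
have sr j : s j <= r.
  rewrite /r (bigD1 j) //=.
  have : 0 <= \sum_(i | i != j) s i by apply: sumr_ge0 => i _; apply: le_trans (hs i).1.
  have := normr_ge0 M; lra.
exists p, r; split=> [j|j|j|w z w0 cr]; [by case: (hp j)|by case: (hp j)|exact: (hs j).2|].
have : modulus (Pw p w).[z] <= M.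
  apply: hM; apply: subset_closure; exists (poly_ext (Pw p w)).
    by rewrite hE semigroup_gen_words; exists w.
  by exists (Some z) => //; exact: critical_poly_ext.
have : 0 <= \sum_j s j by apply: sumr_ge0 => i _; apply: le_trans (hs i).1.
have := ler_norm M; rewrite /r; lra.
Qed.

End Semigroups.

(** * Extremal and isolated components *)

Section Components.
Context {R : realType}.
Local Notation C := (R[i]^o).
Local Notation Chat := (sphere R).

Lemma extremal_components (G : set (Chat -> Chat)) (F : nat -> set C) a b :
  Julia_components G = range (fun k => Some @` F k : set Chat) ->
  (forall k, compact (F k)) -> (forall k, F k !=set0) ->
  (forall k, surround_le (F a) (F k) /\ surround_le (F k) (F b)) ->
  Jmin G = Some @` F a /\ Jmax G = Some @` F b.
Proof.
move=> GE kF nF ord; have leE i j : component_le (Some @` F i : set Chat) (Some @` F j) = surround_le (F i) (F j).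
  by rewrite /component_le !some_imageK.
have anti i j : surround_le (F i) (F j) -> surround_le (F j) (F i) -> F i = F j.
  exact: surround_anti (kF i) (kF j) (nF i) (nF j).
split; rewrite /Jmin /Jmax GE; apply: get_unique.
- split=> [|_ [k _ <-]]; first by exists a.
  by rewrite leE; exact: (ord k).1.
- move=> _ [[k _ <-] /(_ _ (ex_intro2 _ _ a I erefl))]; rewrite leE => ka.
  by rewrite (anti _ _ ka (ord k).1).
- split=> [|_ [k _ <-]]; first by exists b.
  by rewrite leE; exact: (ord k).2.
move=> _ [[k _ <-] /(_ _ (ex_intro2 _ _ b I erefl))]; rewrite leE => bk.
by rewrite (anti _ _ bk (ord k).2).
Qed.

Lemma isolated_not_approached (G : set (Chat -> Chat)) (F : nat -> set C) k (d M : R) : 0 < d ->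
  Julia_components G = range (fun i => Some @` F i : set Chat) ->
  (forall i, F i !=set0) -> (forall i z, F i z -> modulus z <= M) ->
  (forall i a b, i != k -> F k a -> F i b -> d <= modulus (a - b)) ->
  ~ approached_by_components G (Some @` F k).
Proof.
move=> d0 GE nF bF iso [D [injD GD cvD]].
have M0 : 0 <= M by have [z Fz] := nF k; apply: le_trans (modulus_ge0 z) (bF _ _ Fz).
have e0 : 0 < 2 * d / (1 + M) ^+ 2 by rewrite divr_gt0 ?mulr_gt0 ?exprn_gt0 //; lra.
move/cvgrPdist_lt/(_ _ e0) : cvD => [N _ hN].
(* Every other component stays a fixed distance away, so from [N] on the sequence is constantly
   [F k], contradicting injectivity. *)
have far j : (N <= j)%N -> D j = Some @` F k.
  move=> Nj; have := GD j; rewrite GE => -[i _ Di]; rewrite -Di.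
  have [->//|ik] := eqVneq i k; exfalso.
  have := hN j Nj; rewrite /= sub0r normrN ltNge => /negP; apply.
  apply: le_trans (ler_norm _); rewrite -Di.
  by apply: min_dist_ge => //; [exact: bF|exact: bF|move=> a b; exact: iso].
have := injD N N.+1; rewrite (far N) // (far N.+1) // => /(_ erefl)/eqP.
by rewrite eqn_leq ltnn andbF.
Qed.

End Components.

(* m = n.+1, and h_m is [h ord_max] *)
Theorem theorem2p27 (R : realType) (n : nat) (hm : (3 <= n.+1)%N)
    (h : 'I_n.+1 -> sphere R -> sphere R)
    (hpoly : forall j, nonconstant_poly_map (h j))
    (G : set (sphere R -> sphere R))
    (hG : G = semigroup_gen (range h))
    (hdis : calG_dis G)
    (J0 : set (sphere R))
    (hJ0 : Julia_components G J0)
    (hsub : \bigcup_(j in [set j | j != ord_max]) Julia_map (h j) `<=` J0)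
    (hmeet : forall j, j != ord_max ->
       (h j @^-1` Julia_map (h ord_max)) `&` J0 !=set0) :
  [/\ (Julia_components G #= [set: nat])%card,
      J0 = Jmin G \/ J0 = Jmax G,
      J0 = Jmin G ->
        [/\ Jmax G = Julia_map (h ord_max),
            Julia G = Jmax G `|`
              \bigcup_(k in [set: nat]) (iter k (h ord_max) @^-1` Jmin G)
          & forall J, Julia_components G J -> J <> Jmax G ->
              ~ approached_by_components G J]
    & J0 = Jmax G ->
        [/\ Jmin G = Julia_map (h ord_max),
            Julia G = Jmin G `|`
              \bigcup_(k in [set: nat]) (iter k (h ord_max) @^-1` Jmax G)
          & forall J, Julia_components G J -> J <> Jmin G ->
              ~ approached_by_components G J]].
Proof.
move: hdis => [cG ndis]; rewrite {1}hG in cG.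
have [p [r [hE sp ep crit]]] := calG_polynomials cG.
have GW : G = wordmaps p.
  by rewrite hG (funext hE) semigroup_gen_words.
have JE i : Julia G = Some @` limit_set p r i by rewrite GW; exact: (Julia_words sp ep i).
have limE i j : limit_set p r i = limit_set p r j by apply: some_image_inj; rewrite -!JE.
have mapE j : Julia_map (h j) = Some @` rim p r [::] j by rewrite hE (Julia_mapE (sp j) (ep j)) rim_nil.
pose m : 'I_n.+1 := ord_max.
have [K [z0 Lz0 KE] J0E] : [set (Some @` A : set (sphere R)) |
    A in [set connected_component (limit_set p r m) z | z in limit_set p r m]] J0.
  by rewrite -(components_some (JE m)).
(* The auxiliary generator [j1] is the first one. *)
have j1m : (ord0 : 'I_n.+1) != m by rewrite -val_eqE /= eq_sym -lt0n; lia.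
have Kz0 : K z0 by rewrite -KE; exact: connected_component_refl.
have Kc : connected K by rewrite -KE; exact: component_connected.
have Kcl : closed K by rewrite -KE; apply: component_closed; exact: closed_closure.
have Ks : K `<=` limit_set p r m by rewrite -KE; exact: connected_component_sub.
have Kmax S : connected S -> S `<=` limit_set p r m -> S `&` K !=set0 -> S `<=` K.
  move=> cS SL [y [Sy]]; rewrite -KE => Ky z Sz;
  apply: (@connected_component_trans _ (limit_set p r m) y z0 z Ky).
  exact: (@connected_component_max _ (limit_set p r m) S y Sy SL cS z Sz).
have Krim j : j != m -> rim p r [::] j `<=` K.
  move=> jm z rz; have [] : (Some @` K) (Some z : sphere R); last by move=> y Ky [<-].
  by rewrite J0E; apply: hsub; exists j => //; rewrite mapE; exists z.
have Kmeet j : j != m -> rim p r [:: j] m `&` K !=set0.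
  move=> /hmeet[x []]; rewrite -J0E => hx [y Ky yx]; exists y; split=> //.
  move: hx; rewrite /preimage -yx mapE hE /= => -[z rz [zy]].
  by rewrite rim_cons /preimage /pfun /= -zy.
have ndis' : ~ connected (limit_set p r m) by rewrite -connected_some -JE.
have Kne : K !=set0 by exists z0.
pose F := stratum p r m K.
have compE : Julia_components G = range (fun k => Some @` F k : set (sphere R)).
  rewrite (components_some (JE m)).
  rewrite (stratum_components sp ep crit limE j1m Kc Kne Kcl Ks Kmax Krim Kmeet ndis').
  by rewrite image_comp.
have nF := stratum_nonempty sp ep crit j1m Krim.
have kF k : compact (F k) := @stratum_compact _ _ _ _ sp ep limE m K Kcl Ks k.
have ord := stratum_order sp ep crit limE j1m Kc Kcl Ks Kmax Krim ndis'.
have dF a b z : F a z -> F b z -> a = b.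
  exact: (@stratum_disjoint _ _ _ _ sp ep crit limE m ord0 K j1m Kc Kcl Ks Kmax Krim ndis' a b z).
have injF a b : (Some @` F a : set (sphere R)) = Some @` F b -> a = b.
  by move=> /some_image_inj e; have [z Fz] := nF a; apply: (dF a b z Fz); rewrite -e.
have F0 : (Some @` F 0 : set (sphere R)) = Julia_map (h ord_max) by rewrite mapE.
have F1 : (Some @` F 1 : set (sphere R)) = J0 by rewrite -J0E.
have bF i z : F i z -> modulus z <= r.
  by move=> /(stratum_sub sp ep limE Ks)/(limit_bounded sp ep).
have iter_h k (x : sphere R) : iter k (h ord_max) x =
    if x is Some z then Some (iter k (horner (p m)) z : R[i]^o) else None.
  by elim: k => [|k IH]; [case: x|rewrite iterS IH hE; case: x {IH}].
have JG : Julia G = Julia_map (h ord_max) `|` \bigcup_(k in [set: nat]) (iter k (h ord_max) @^-1` J0).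
  rewrite (JE m) (limit_set_layers sp ep crit limE j1m Kc Kne Kcl Ks Kmax Krim Kmeet ndis').
  rewrite mapE -J0E; apply/seteqP; split=> [_ [z [rz|[k _ Lz]] <-]|x [[z rz <-]|[k _ ]]].
  - by left; exists z.
  - by right; exists k => //; rewrite /preimage /= iter_h; exists (iter k (horner (p m)) z).
  - by exists z => //; left.
  rewrite /preimage /= iter_h; case: x => [z [y Ky [yz]]|[]//].
  by exists z => //; right; exists k => //; rewrite /layer /= -yz.
have isolated J : Julia_components G J -> J <> Julia_map (h ord_max) -> ~ approached_by_components G J.
  rewrite {1}compE => -[[|k] _ <-]; first by rewrite F0.
  move=> _; have [d d0 hd] := stratum_isolated sp ep crit limE j1m Kc Kne Kcl Ks Kmax Krim Kmeet ndis' k.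
  exact: (isolated_not_approached d0 compE nF bF hd).
(* Excludes the case in which [J0] would equal the extremal component J(h_m), so each conditional
   statement keeps a single live case. *)
have distinct : J0 <> Julia_map (h ord_max) by rewrite -F0 -F1 => /injF.
have extremes : (Jmin G = Julia_map (h ord_max) /\ Jmax G = J0) \/
    (Jmin G = J0 /\ Jmax G = Julia_map (h ord_max)).
  by rewrite -F0 -F1; case: ord => o; [left|right]; exact: (extremal_components compE kF nF o).
split.
- rewrite compE; apply: inj_card_eq => a b _ _; exact: injF.
- by case: extremes => -[-> ->]; [right|left].
- by case: extremes => -[-> ->].
- by case: extremes => -[-> ->].
Qed.
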